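(* Let $\mathcal U_h=\mathcal U_h^i$ with $i=0$ (piecewise constant discretization) or $i=1$ (continuous piecewise linear discretization). Let $\bar u\in\mathcal U_{ad}$ be a strict local minimum of $(P)$ with $\bar y:=S(\bar u)$, and let $\{(\bar y_h,\bar u_h)\}$ be the sequence of discrete solutions converging strongly to $(\bar y,\bar u)$ in $H^1_0(\Omega)\times L^2(\Omega)$ as $h\to0$. Assume that $\{\bar y=\bar t\}$ decomposes into finitely many connected components and that on each such connected component $\mathcal C$ either (1) $\nabla\bar y(x)\neq0$ for all $x\in\mathcal C$, or (2) $\nabla\bar y=0$ on $\mathcal C$ and there are constants $c_s,\epsilon_0,r_0>0$ with $\mathrm{meas}_{\mathbb R^2}(\{0<|\bar y-\bar t|<r\}\cap\mathcal C^{\epsilon_0})\le c_sr$ for all $r\in(0,r_0)$, where $\mathcal C^{\epsilon_0}:=\{x\in\overline\Omega:\mathrm{dist}(x,\mathcal C)<\epsilon_0\}$. Assume further that there exists $\bar\varphi\in W^{1,\bar p}_0(\Omega)\cap W^{1,\infty}(\Omega)$ such that $$-\mathrm{div}[(b+a(\bar y))\nabla\bar\varphi]+\mathbf 1_{\{\bar y\ne\bar t\}}a'(\bar y)\nabla\bar y\cdot\nabla\bar\varphi=\tfrac{\partial L}{\partial y}(\cdot,\bar y)\ \text{in }\Omega,\quad\bar\varphi=0\ \text{on }\partial\Omega,$$ $$\int_\Omega(\bar\varphi+\nu\bar u)(u-\bar u)\,dx\ge0\quad\text{for all }u\in\mathcal U_{ad},$$ and $Q(\bar u,\bar y,\bar\varphi;v)>0$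 for all $v\in\mathcal C(\mathcal U_{ad};\bar u)\setminus\{0\}$. Then there exist constants $C>0$ and $\hat h_*\in(0,\hat h)$ such that $$\|\bar u_h-\bar u\|_{L^2(\Omega)}\le C h\qquad\text{for all }h\in(0,\hat h_* ).$$
   Context: Setting: $\Omega\subset\mathbb R^2$ is an open bounded convex polygonal domain. $b:\overline\Omega\to\mathbb R$ is Lipschitz continuous with $b\ge\underline b>0$. $a:\mathbb R\to[0,\infty)$ is given by $a(t)=a_0(t)$ for $t\le\bar t$ and $a(t)=a_1(t)$ for $t>\bar t$, where $\bar t\in\mathbb R$, $a_0\in C^2((-\infty,\bar t])$, $a_1\in C^2([\bar t,\infty))$, $a_0(\bar t)=a_1(\bar t)$. Its directional derivative is $a'(t;s)=a'(t)s$ for $t\ne\bar t$, and $a'(\bar t;s)=a_1'(\bar t)s$ for $s\geq0$, $a_0'(\bar t)s$ for $s<0$. $\mathbf 1_{\{y\neq\bar t\}}a'(y)$ and $\mathbf 1_{\{y\neq\bar t\}}a''(y)$ are $0$ on $\{y=\bar t\}$. $L:\Omega\times\mathbb R\to\mathbb R$ is a Carathéodory function of class $C^2$ in the second variable, $L(\cdot,0)\in L^1(\Omega)$, and for every $M>0$ there are $C_M>0$, $\psi_M\in L^{\bar p}(\Omega)$ ($\bar p>2$ fixed) with $|\partial_yL(x,y)|\le\psi_M(x)$, $|\partial_{yy}L(x,y)|\le C_M$ for $|y|\le M$, a.e. $x$. Constants $\alpha<\beta$, $\nu>0$. For $u\in L^2(\Omega)$, $S(u)=y_u$ is the unique weak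 solution of $-\mathrm{div}[(b+a(y_u))\nabla y_u]=u$ in $\Omega$, $y_u=0$ on $\partial\Omega$; $S$ is $C^1$ and $z_v=S'(u)v$ is the unique solution of $-\mathrm{div}[(b+a(y_u))\nabla z_v+\mathbf 1_{\{y_u\ne\bar t\}}a'(y_u)z_v\nabla y_u]=v$, $z_v|_{\partial\Omega}=0$. $p_*>2$ is a number (known to exist) such that $S$ maps bounded sets of $L^p(\Omega)$ into bounded sets of $W^{2,p}(\Omega)$ for $p\in[2,p_* )$. $\mathcal U_{ad}:=\{u\in L^\infty(\Omega):\alpha\le u\le\beta\text{ a.e.}\}$; $j(u):=\int_\Omega L(x,S(u)(x))dx+\frac\nu2\|u\|_{L^2}^2$; $(P)$ is $\min_{u\in\mathcal U_{ad}}j(u)$; $j'(u)v=\int_\Omega(\varphi_u+\nu u)v\,dx$ with $\varphi_u\in H^1_0(\Omega)$ solving $-\mathrm{div}[(b+a(y_u))\nabla\varphi_u]+\mathbf 1_{\{y_u\ne\bar t\}}a'(y_u)\nabla y_u\cdot\nabla\varphi_u=\partial_yL(\cdot,y_u)$. Critical cone: $\mathcal C(\mathcal U_{ad};\bar u):=\{v\in L^2(\Omega):v\ge0\text{ where }\bar u=\alpha,\ v\le0\text{ where }\bar u=\beta,\ v=0\text{ where }\bar\varphi+\nu\bar u\ne0,\text{ a.e. in }\Omega\}$. With $z_v=S'(\bar u)v$ and $\mathcal H^1$ the one-dimensional Hausdorff measure, $$Q(\bar u,\bar y,\bar\varphi;v)=\tfrac12\int_\Omega\partial_{yy}L(\cdot,\bar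 y)z_v^2dx+\tfrac\nu2\int_\Omega v^2dx-\tfrac12\int_\Omega\mathbf 1_{\{\bar y\ne\bar t\}}a''(\bar y)z_v^2\nabla\bar y\cdot\nabla\bar\varphi\,dx-\int_\Omega a'(\bar y;z_v)\nabla z_v\cdot\nabla\bar\varphi\,dx+\tfrac12[a_0'(\bar t)-a_1'(\bar t)]\int_{\{\bar y=\bar t\}}\mathbf 1_{\{|\nabla\bar y|>0\}}z_v^2\tfrac{\nabla\bar y\cdot\nabla\bar\varphi}{|\nabla\bar y|}d\mathcal H^1.$$ Finite elements: $\{\mathcal T_h\}_{h>0}$ is a family of triangulations of $\overline\Omega$, mesh size $h=\max_T\varrho(T)$, with $\varrho(T)/\delta(T)\le\bar\delta$, $h/\varrho(T)\le\bar\varrho$ for all $T,h$ and fixed $\bar\varrho,\bar\delta>0$ ($\varrho(T)$ = diameter of $T$, $\delta(T)$ = diameter of largest ball in $T$). $V_h$: continuous, affine on each $T\in\mathcal T_h$, zero on $\partial\Omega$. $\mathcal U_h^0:=\{u\in L^\infty(\Omega):u|_T\text{ constant }\forall T\in\mathcal T_h\}$; $\mathcal U_h^1:=\{u\in C(\overline\Omega):u|_T\text{ affine }\forall T\in\mathcal T_h\}$; $\mathcal U_{ad,h}:=\mathcal U_{ad}\cap\mathcal U_h$. Discrete state equation: $y_h\in V_h$, $\int_\Omega(b+a(y_h))\nabla y_h\cdot\nabla v_hdx=\int_\Omega uv_hdx$ $\forall v_h\in V_h$. Fixed constants: $\tilde p\ge4$; $h_1,\rho,\kappa_\rho>0$ such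 that for $h<h_1$, $u\in\overline B_{L^2(\Omega)}(\bar u,\rho)$ the discrete state equation has a unique solution $S_h(u)$ in $\overline B_{W^{1,\tilde p}_0(\Omega)}(\bar y,\kappa_\rho)\cap V_h$, with $\|S(u)-S_h(u)\|_{L^2}+h\|S(u)-S_h(u)\|_{H^1_0}+h\|S(u)-S_h(u)\|_{L^\infty}\le C_\rho h^2$, $C_\rho$ independent of $u,h$; $h_2\in(0,h_1)$ such that for $h<h_2$ and $y_h\in\overline B_{W^{1,\tilde p}_0(\Omega)}(\bar y,\kappa_\rho)\cap V_h$ the discrete linearized operator $w_h\mapsto\big(z_h\mapsto\int_\Omega[(b+a(y_h))\nabla w_h+\mathbf 1_{\{y_h\ne\bar t\}}a'(y_h)w_h\nabla y_h]\cdot\nabla z_hdx\big)$ is an isomorphism $V_h\to V_h^*$. Exponents $\gamma,p_0,p_1$ with $p_0>2$, $p_1\in(2,p_* )$, $1-\frac2{p_0}\le\gamma<\min\{\frac1{p_0},1-\frac2{p_1}\}<\frac12$. Notation: $\sigma_0:=|a_0'(\bar t)-a_1'(\bar t)|$; $Z_{y,\hat y}:=\mathbf 1_{\{y\ne\bar t\}}a'(y)\nabla y-\mathbf 1_{\{\hat y\ne\bar t\}}a'(\hat y)\nabla\hat y$; $V(y,r):=\sigma_0\sum_{m=1}^2\mathbf 1_{\{0<|y-\bar t|\le r\}}|\partial_{x_m}y|$; $\epsilon_h^u:=h^{1+\gamma}+h\|Z_{S(u),\bar y}\|_{L^2(\Omega)}+h\|V(S(u),\|S_h(u)-S(u)\|_{L^\infty(\Omega)})\|_{L^2(\Omega)}$.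 Discrete problems: $\bar\epsilon\in(0,\rho)$ is such that $j(\bar u)<j(u)$ for all $u\in\mathcal U_{ad}\cap\overline B_{L^2(\Omega)}(\bar u,\bar\epsilon)$, $u\ne\bar u$. $j_h(u):=\int_\Omega L(x,S_h(u)(x))dx+\frac\nu2\|u\|^2_{L^2}$ for $u\in\overline B_{L^2(\Omega)}(\bar u,\rho)$. The discrete problem $(P_h)$ is to minimize $\int_\Omega L(x,y_h)dx+\frac\nu2\|u_h\|_{L^2}^2$ over $u_h\in\mathcal U_{ad,h}$, $y_h\in V_h$ satisfying the discrete state equation with $u=u_h$. ''Discrete solutions $(\bar y_h,\bar u_h)$'' means (local) solutions of $(P_h)$ with $\bar u_h\in\mathcal U_{ad,h}\cap\overline B_{L^2(\Omega)}(\bar u,\bar\epsilon)$ and $\bar y_h=S_h(\bar u_h)$, i.e. for some $r_h>0$, $j_h(\bar u_h)\le j_h(u)$ for all $u\in\mathcal U_{ad,h}\cap\overline B_{L^2(\Omega)}(\bar u,\bar\epsilon)$ with $\|u-\bar u_h\|_{L^2}\le r_h$. $\hat h\in(0,h_2)$ is a fixed constant (known to exist under the hypotheses of the claim) for which there are $C>0$ and $\hat\epsilon\in(0,\bar\epsilon]$ such that $\|\bar u_h-\bar u\|_{L^2}^2\le C[(\epsilon_h^{\bar u_h})^2+\|\bar u-u_h\|_{L^2}^2+j'(\bar u)(u_h-\bar u)]$ for all $h\in(0,\hat h)$ and $u_h\in\mathcal U_{ad,h}\cap\overline B_{L^2(\Omega)}(\bar u,\hat\epsilon)$. *)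

(* Defs.v *)
From HB Require Import structures.
From mathcomp Require Import all_boot all_order all_algebra.
From mathcomp Require Import all_classical all_reals all_analysis.

Set Implicit Arguments.
Unset Strict Implicit.
Unset Printing Implicit Defensive.

Import Order.TTheory GRing.Theory Num.Theory.
Import numFieldNormedType.Exports.

Local Open Scope classical_set_scope.
Local Open Scope ring_scope.

Section plane.
Context {R : realType}.
Local Notation pt := (R * R)%type.

Definition dot (x y : pt) : R := x.1 * y.1 + x.2 * y.2.

(* The norm of the library on [R * R] is the maximum norm. *)
Definition enorm (x : pt) : R := Num.sqrt (dot x x).

Definition basis_vec (i : 'I_2) : pt := if i == 0 then (1, 0) else (0, 1).

Definition leb2 : {measure set (measurableTypeR R * measurableTypeR R) -> \bar R} :=
  (@lebesgue_measure R \x @lebesgue_measure R)%E.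

Definition hull (s : seq pt) : set pt :=
  [set x | exists w : nat -> R, [/\ forall i, 0 <= w i,
     \sum_(i < size s) w i = 1 & x = \sum_(i < size s) w i *: s`_i]].

Definition ediam (A : set pt) : \bar R :=
  ereal_sup ([set 0%E] `|` [set (enorm (x - y))%:E | x in A & y in A]).

End plane.

Section hausdorff.
Variable R : realType.
Local Open Scope ereal_scope.

(* The plane with all its subsets measurable: [measurable_cover] is then a
   cover by an arbitrary sequence of sets. *)
Definition discrete_plane : Type := (R * R)%type.
HB.instance Definition _ := Pointed.on discrete_plane.
HB.instance Definition _ := @isMeasurable.Build default_measure_display
  discrete_plane discrete_measurable discrete_measurable0
  discrete_measurableC discrete_measurableU.

Definition gauge (d : R) (A : set discrete_plane) : \bar R :=
  if ediam A <= d%:E then ediam A else +oo.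

Lemma ediam_ge0 (A : set (R * R)) : 0 <= ediam A.
Proof. by apply: ereal_sup_ubound; left. Qed.

Lemma gauge0 d : (0 < d)%R -> gauge d set0 = 0.
Proof.
move=> d0; rewrite /gauge.
have -> : ediam (set0 : set (R * R)) = 0.
  rewrite /ediam (_ : image2 _ _ _ = set0) ?setU0 ?ereal_sup1//.
  by rewrite -subset0 => x [? []].
by rewrite lee_fin ltW.
Qed.

Lemma gauge_ge0 d A : 0 <= gauge d A.
Proof. by rewrite /gauge; case: ifP => // _; exact: ediam_ge0. Qed.

Definition hausdorff1 (A : set (R * R)) : \bar R :=
  ereal_sup [set mu_ext (gauge d) A | d in [set d | (0 < d)%R]].

Lemma hausdorff1_set0 : hausdorff1 set0 = 0.
Proof.
apply/eqP; rewrite eq_le; apply/andP; split.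
  apply: ge_ereal_sup => _ [d /= d0 <-].
  by rewrite mu_ext0//; [exact: gauge0|exact: gauge_ge0].
apply: ereal_sup_ubound; exists 1%R => //=.
by rewrite mu_ext0//; [exact: gauge0|exact: gauge_ge0].
Qed.

Lemma hausdorff1_ge0 A : 0 <= hausdorff1 A.
Proof.
apply: (@le_trans _ _ (mu_ext (gauge 1%R) A)).
  by apply: mu_ext_ge0; exact: gauge_ge0.
by apply: ereal_sup_ubound; exists 1%R => /=.
Qed.

Lemma le_hausdorff1 : {homo hausdorff1 : A B / A `<=` B >-> A <= B}.
Proof.
move=> A B AB; apply: ge_ereal_sup => _ [d /= d0 <-].
apply: (@le_trans _ _ (mu_ext (gauge d) B)); first exact: le_mu_ext.
by apply: ereal_sup_ubound; exists d.
Qed.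

Lemma hausdorff1_sigma_subadditive : sigma_subadditive hausdorff1.
Proof.
move=> A; apply: ge_ereal_sup => _ [d /= d0 <-].
apply: (le_trans (mu_ext_sigma_subadditive (gauge_ge0 d) A)).
apply: lee_nneseries => n _; first by move=> *; apply: mu_ext_ge0; exact: gauge_ge0.
by apply: ereal_sup_ubound; exists d.
Qed.

HB.instance Definition _ := isOuterMeasure.Build R (R * R)%type hausdorff1
  hausdorff1_set0 hausdorff1_ge0 le_hausdorff1 hausdorff1_sigma_subadditive.

Definition outer_measure_restriction (T : pointedType)
    (mu : {outer_measure set T -> \bar R}) :
  {measure set (caratheodory_type mu) -> \bar R} := mu.

(* The one-dimensional Hausdorff measure, on its Caratheodory sigma-algebra
   (which contains the Borel sets). *)
Definition hausdorff1_measure := outer_measure_restriction hausdorff1.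

End hausdorff.

Section sobolev.
Context {R : realType}.
Local Notation pt := (R * R)%type.
Local Notation fn := (pt -> R).
Variable Omega : set pt.
Implicit Types (f g u v : fn) (p : \bar R).

(* Lebesgue measurability on Omega: up to a null set, Borel. *)
Definition lmeasurable f :=
  exists2 g : fn, measurable_fun [set: measurableTypeR R * measurableTypeR R] g
    & {ae leb2, forall x, Omega x -> f x = g x}.

Definition LpN p f : \bar R :=
  ('N[leb2]_p[(fun x => (\1_Omega x * f x)%:E)])%E.

Definition memLp p f := lmeasurable f /\ (LpN p f < +oo)%E.

Definition aeq f g := {ae leb2, forall x, Omega x -> f x = g x}.

(* The continuous representative on the closure of Omega, if there is one;
   otherwise f itself. *)
Definition crep f : fn :=
  xget f [set g : fn | {within closure Omega, continuous g} /\ aeq f g].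

Fixpoint Ck (n : nat) f : Prop :=
  continuous f /\
  if n is m.+1 then
    forall i : 'I_2, (forall x, derivable f x (basis_vec i)) /\
      Ck m (fun x => 'D_(basis_vec i) f x)
  else True.

Definition test_fun f :=
  (forall n, Ck n f) /\
  exists K : set pt, [/\ compact K, K `<=` Omega & forall x, ~ K x -> f x = 0].

Definition weak_partial (i : 'I_2) f g :=
  [/\ memLp 1%:E f, memLp 1%:E g & forall phi, test_fun phi ->
    \int[leb2]_(x in Omega) (f x * 'D_(basis_vec i) phi x) =
    - \int[leb2]_(x in Omega) (g x * phi x)].

(* A weak derivative is determined almost everywhere only; where its pointwise
   values matter below it has a continuous representative, which is the one
   chosen. *)
Definition partial (i : 'I_2) f : fn :=
  crep (xget (fun=> 0) [set g | weak_partial i f g]).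

Definition grad f (x : pt) : pt := (partial 0 f x, partial 1 f x).

Definition W1p p f :=
  memLp p f /\ forall i, exists2 g, weak_partial i f g & memLp p g.

Definition W1N p f : \bar R :=
  (LpN p f + \sum_(i < 2) LpN p (partial i f))%E.

Definition W2p p f := W1p p f /\ forall i, W1p p (partial i f).

Definition W2N p f : \bar R :=
  (LpN p f + \sum_(i < 2) W1N p (partial i f))%E.

(* For finite p: the closure of the test functions in W^{1,p}. *)
Definition W1p0 p f :=
  W1p p f /\ exists phi : nat -> fn, (forall n, test_fun (phi n)) /\
    (fun n => W1N p (f \- phi n)) @ \oo --> 0%E.

Definition H10 f := W1p0 2%:E f.

End sobolev.

Arguments LpN {R} Omega p%_E f%_R.
Arguments W1N {R} Omega p%_E f%_R.
Arguments W2N {R} Omega p%_E f%_R.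

Section triangulation.
Context {R : realType}.
Local Notation pt := (R * R)%type.
Local Notation fn := (pt -> R).

(* A triangle is the convex hull of its three vertices. *)
Definition triangle := 3.-tuple pt.
Implicit Type T : triangle.

Definition tdiam T : R :=
  sup [set enorm (x - y) | x in hull T & y in hull T].

Definition tball T : R :=
  sup [set 2 * r | r in [set r | 0 <= r /\
    exists c, forall x, enorm (x - c) <= r -> hull T x]].

(* Distinct triangles meet in the hull of their common vertices: in nothing,
   a common vertex or a common edge. *)
Definition triangulates (Omega : set pt) (mesh : seq triangle) :=
  [/\ forall T, T \in mesh -> interior (hull T) !=set0,
      closure Omega = \bigcup_(T in [set` mesh]) hull T
    & forall T T', T \in mesh -> T' \in mesh ->
        hull T `&` hull T' = hull [seq x <- T | x \in tval T']].

Definition mesh_size (mesh : seq triangle) (h : R) :=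
  (forall T, T \in mesh -> tdiam T <= h) /\
  exists2 T, T \in mesh & tdiam T = h.

Definition affine_on (A : set pt) (f : fn) :=
  exists (c : R) (d : pt), forall x, A x -> f x = c + dot d x.

(* The elements of V_h, extended by zero. *)
Definition Vh (Omega : set pt) (mesh : seq triangle) (f : fn) :=
  [/\ continuous f, forall T, T \in mesh -> affine_on (hull T) f
    & forall x, ~ Omega x -> f x = 0].

Definition Uh0 (Omega : set pt) (mesh : seq triangle) (u : fn) :=
  memLp Omega +oo%E u /\
  forall T, T \in mesh ->
    exists c, {ae leb2, forall x, hull T x -> u x = c}.

Definition Uh1 (Omega : set pt) (mesh : seq triangle) (u : fn) :=
  {within closure Omega, continuous u} /\
  forall T, T \in mesh -> affine_on (hull T) u.

Definition Uh (i : 'I_2) := if i == 0 then Uh0 else Uh1.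

End triangulation.

(* [coef_a0] and [coef_a1] are total; only their values on the half-lines
   t <= tbar and t >= tbar are used, and being C^2 on a closed half-line is
   being the restriction of a C^2 function. *)
Record problem (R : realType) := Problem {
  Omega : set (R * R);
  coef_b : R * R -> R;
  coef_a0 : R -> R;
  coef_a1 : R -> R;
  tbar : R;
  cost_L : R * R -> R -> R;
  alpha : R;
  beta : R;
  nu : R }.

Section control_problem.
Context {R : realType}.
Local Notation pt := (R * R)%type.
Local Notation fn := (pt -> R).
Variable P : problem R.
Local Notation Omega := (Omega P).
Local Notation b := (coef_b P).
Local Notation a0 := (coef_a0 P).
Local Notation a1 := (coef_a1 P).
Local Notation tbar := (tbar P).
Local Notation L := (cost_L P).
Local Notation nu := (nu P).
Local Notation grad := (grad Omega).
Local Notation H10 := (H10 Omega).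
Local Notation "'int' x , F" := (\int[leb2]_(x in Omega) F)
  (at level 200, x name).
Implicit Types (u v w y z phi : fn).

Definition C2 (f : R -> R) :=
  [/\ forall t, derivable f t 1, forall t, derivable (derive1 f) t 1
    & continuous (derive1n 2 f)].

Definition convex_polygonal_domain (A : set pt) :=
  [/\ open A, A !=set0, bounded_set A, convex_set A
    & exists s : seq pt, closure A = hull s].

Definition coef_a (t : R) : R := if t <= tbar then a0 t else a1 t.

(* 1_{t <> tbar} a'(t) and 1_{t <> tbar} a''(t). *)
Definition da (t : R) : R := if t == tbar then 0 else derive1 coef_a t.
Definition dda (t : R) : R := if t == tbar then 0 else derive1n 2 coef_a t.

Definition dir_a (t s : R) : R :=
  if t != tbar then derive1 coef_a t * s
  else if 0 <= s then derive1 a1 tbar * s else derive1 a0 tbar * s.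

Definition dL (x : pt) (t : R) : R := derive1 (L x) t.
Definition ddL (x : pt) (t : R) : R := derive1n 2 (L x) t.

Definition admissible_L (pbar : R) :=
  [/\ forall t, lmeasurable Omega (fun x => L x t),
      {ae leb2, forall x, Omega x -> C2 (L x)},
      memLp Omega 1%:E (fun x => L x 0)
    & forall M, 0 < M -> exists CM psi,
        [/\ 0 < CM, memLp Omega pbar%:E psi
          & {ae leb2, forall x, Omega x -> forall t, `|t| <= M ->
              `|dL x t| <= psi x /\ `|ddL x t| <= CM}]].

Definition is_state u y :=
  [/\ H10 y, memLp Omega +oo%E y & forall w, H10 w ->
    (int x, (b x + coef_a (y x)) * dot (grad y x) (grad w x)) =
    (int x, u x * w x)].

Definition S u : fn := crep Omega (xget (fun=> 0) [set y | is_state u y]).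

Definition is_linearized_state y v z :=
  H10 z /\ forall w, H10 w ->
    (int x, dot ((b x + coef_a (y x)) *: grad z x
                 + (da (y x) * z x) *: grad y x) (grad w x)) =
    (int x, v x * w x).

(* S'(u) v, as the solution of the linearized state equation at u. *)
Definition dS u v : fn :=
  crep Omega (xget (fun=> 0) [set z | is_linearized_state (S u) v z]).

Definition is_adjoint_state y phi :=
  H10 phi /\ forall w, H10 w ->
    (int x, (b x + coef_a (y x)) * dot (grad phi x) (grad w x)
            + da (y x) * dot (grad y x) (grad phi x) * w x) =
    (int x, dL x (y x) * w x).

Definition Uad u :=
  memLp Omega +oo%E u /\
  {ae leb2, forall x, Omega x -> alpha P <= u x <= beta P}.

Definition L2ball u (r : R) : set fn :=
  [set v | memLp Omega 2%:E v /\ (LpN Omega 2%:E (v \- u) <= r%:E)%E].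

Definition cost (y u : fn) : R :=
  (int x, L x (y x)) + nu / 2 * (int x, u x ^+ 2).

Definition j u : R := cost (S u) u.

(* The derivative of j at u in direction v when phi is the adjoint state at u. *)
Definition dj u phi v : R := int x, (phi x + nu * u x) * v x.

Definition critical_cone u phi : set fn :=
  [set v | memLp Omega 2%:E v /\
    {ae leb2, forall x, Omega x ->
      [/\ u x = alpha P -> 0 <= v x, u x = beta P -> v x <= 0
        & phi x + nu * u x != 0 -> v x = 0]}].

Definition level_set y : set pt := [set x | closure Omega x /\ y x = tbar].

Definition Q u y phi v : R :=
  let z := dS u v in
  2^-1 * (int x, ddL x (y x) * z x ^+ 2)
  + nu / 2 * (int x, v x ^+ 2)
  - 2^-1 * (int x, dda (y x) * z x ^+ 2 * dot (grad y x) (grad phi x))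
  - (int x, dir_a (y x) (z x) * dot (grad z x) (grad phi x))
  + 2^-1 * (derive1 a0 tbar - derive1 a1 tbar) *
    \int[@hausdorff1_measure R]_(x in level_set y)
      (if 0 < enorm (grad y x)
       then z x ^+ 2 * (dot (grad y x) (grad phi x) / enorm (grad y x))
       else 0).

Definition components y : set (set pt) :=
  [set connected_component (level_set y) x | x in level_set y].

Definition regular_component y (C : set pt) :=
  forall x, C x -> grad y x != 0.

Definition neighbourhood (C : set pt) (e : R) : set pt :=
  [set x | closure Omega x /\ exists2 c, C c & enorm (x - c) < e].

Definition band y (r : R) : set pt := [set x | 0 < `|y x - tbar| < r].

Definition singular_component y (C : set pt) :=
  (forall x, C x -> grad y x = 0) /\
  exists cs e0 r0, [/\ 0 < cs, 0 < e0, 0 < r0 & forall r, 0 < r < r0 ->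
    (leb2 (band y r `&` neighbourhood C e0) <= (cs * r)%:E)%E].

Definition sigma0 : R := `|derive1 a0 tbar - derive1 a1 tbar|.

Definition Z (y yhat : fn) (x : pt) : pt :=
  da (y x) *: grad y x - da (yhat x) *: grad yhat x.

Definition V y (r : \bar R) (x : pt) : R :=
  sigma0 * \sum_(m < 2)
    if (0 < `|y x - tbar|) && (`|y x - tbar|%R%:E <= r)%E
    then `|partial Omega m y x| else 0.

Section discretization.
Variables (ybar : fn) (ptilde kappa : R) (mesh : seq (@triangle R)).

Definition W1p0_ball : set fn :=
  [set y | W1p0 Omega ptilde%:E (y \- ybar) /\
           (W1N Omega ptilde%:E (y \- ybar) <= kappa%:E)%E].

Definition is_discrete_state u y :=
  Vh Omega mesh y /\ forall w, Vh Omega mesh w ->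
    (int x, (b x + coef_a (y x)) * dot (grad y x) (grad w x)) =
    (int x, u x * w x).

Definition Sh u : fn :=
  xget (fun=> 0) [set y | W1p0_ball y /\ is_discrete_state u y].

Definition jh u : R := cost (Sh u) u.

Definition discrete_linearized y w z : R :=
  int x, dot ((b x + coef_a (y x)) *: grad w x
              + (da (y x) * w x) *: grad y x) (grad z x).

Definition linear_on_Vh (l : fn -> R) :=
  forall (c : R) z z', Vh Omega mesh z -> Vh Omega mesh z' ->
    l (fun x => c * z x + z' x) = c * l z + l z'.

(* V_h being finite dimensional, an isomorphism of V_h onto its dual is a
   linear bijection onto the linear functionals. *)
Definition discrete_linearized_iso y :=
  forall l, linear_on_Vh l -> exists! w, Vh Omega mesh w /\
    forall z, Vh Omega mesh z -> discrete_linearized y w z = l z.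

Definition Uadh (i : 'I_2) : set fn :=
  [set u | Uad u /\ Uh i Omega mesh u].

Definition discrete_solution (i : 'I_2) ubar (eps : R) (yh uh : fn) :=
  [/\ Uadh i uh, L2ball ubar eps uh, yh = Sh uh
    & exists2 r, 0 < r & forall u, Uadh i u -> L2ball ubar eps u ->
        L2ball uh r u -> jh uh <= jh u].

Definition eps_h (gamma h : R) u : \bar R :=
  ((h `^ (1 + gamma))%R%:E
   + h%:E * LpN Omega 2%:E (enorm \o Z (S u) ybar)
   + h%:E * LpN Omega 2%:E
       (V (S u) (LpN Omega +oo%E (Sh u \- S u))))%E.

End discretization.

End control_problem.

(* Main.v *)
Require Import Defs.
From HB Require Import structures.
From mathcomp Require Import all_boot all_order all_algebra.
From mathcomp Require Import all_classical all_reals all_analysis.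
From mathcomp Require Import measurable_realfun ess_sup_inf.
From mathcomp Require Import ring lra.

Set Implicit Arguments.
Unset Strict Implicit.
Unset Printing Implicit Defensive.

Import Order.TTheory GRing.Theory Num.Theory.
Import numFieldNormedType.Exports.

Local Open Scope classical_set_scope.
Local Open Scope ring_scope.

(** The hypothesis on the discrete solutions bounds the squared error by a
    constant times eps_h^2 + |ubar - w|^2 + j'(ubar)(w - ubar), where |.| is the
    norm of L^2 and w is any admissible discrete control close to ubar. The rate
    follows once eps_h = O(h) and some such w satisfies |ubar - w| = O(h) and
    j'(ubar)(w - ubar) = O(h^2).

    Consistency error. Besides h^(1 + gamma), which is at most h for h <= 1,
    eps_h consists of h times the norms of Z and V, and it is enough to bound
    these two norms. Both are controlled by the gradients of states of admissible
    controls, uniformly bounded in L^2 by the regularity of the state equation at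
    p = 2, and by a' on the range of these states. That range is bounded for the
    following reason: on one fixed mesh V_h is finite dimensional, so that the
    bound of the discrete states in L^2 is a bound in the maximum norm
    ([Vh_sup_le_L2]), and the error estimate on that one mesh, in the norm of
    L^infinity, transfers it to the states ([state_sup_bound]). The result is
    [eps_h_linear].

    Test control. The variational inequality says that ubar is the projection of
    -phibar / nu on [alpha, beta] ([projection_formula]). An adjoint state in
    W^{1,infinity} over a convex domain agrees almost everywhere with a Lipschitz
    function ([W1infty_lipschitz]), so ubar has a Lipschitz representative ut,
    and so has the reduced gradient gt = phibar + nu ut. Take for w the
    interpolant of ut: one value per triangle, or the values at the vertices
    ([interpolant]). It stays in [alpha, beta] because its values are averages of
    values of ut, and it is within O(h) of ut. For the second order of
    gt (w - ut), there are two cases. Either |gt| = O(h) at the point, and the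
    product of two such factors is O(h^2); or |gt| is so large there that gt has
    no zero within distance O(h), in which case ut equals one of the constants
    alpha, beta on the surrounding triangle and w = ut ([near_estimate]).
    [discrete_test_control] collects this.

    The Lipschitz representative is obtained by mollification. The difference
    of two translates of the mollifying kernel along an axis is the partial
    derivative of a test function, of size proportional to the translation, so
    the definition of a weak derivative bounds the variation of the mollified
    function along each axis ([moll_axis0], [moll_axis1]). Along segments this
    yields a Lipschitz constant independent of the scale ([moll_lip]). A sequence
    of mollifications converges almost everywhere, hence the function is Lipschitz
    on a set of full measure ([ae_lipschitz]), and it is extended from there to
    the plane ([mcshane]). *)

(** * Integrals and measurability in the plane *)

Section integral_without_measurability.
Import HBNNSimple.
Local Open Scope ereal_scope.
Context d (T : measurableType d) (R : realType) (mu : {measure set T -> \bar R}).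
Implicit Types (D : set T) (f g : T -> \bar R).

(** The integral of a nonnegative function is a supremum over the simple
    functions below it, so it is monotone for arbitrary functions; a simple
    function is cut off on the exceptional null set. This form is needed because
    functions that are only almost everywhere equal to a Borel function need not
    be measurable for the product of the Borel sigma-algebras. *)
Lemma ae_le_integral_ge0 D f g : (forall x, D x -> 0 <= f x) ->
  (forall x, D x -> 0 <= g x) -> {ae mu, forall x, D x -> f x <= g x} ->
  \int[mu]_(x in D) f x <= \int[mu]_(x in D) g x.
Proof.
move=> f0 g0 fg; rewrite (integral_mkcond D f) (integral_mkcond D g).
have f0' x : 0 <= (f \_ D) x by apply: erestrict_ge0.
have g0' x : 0 <= (g \_ D) x by apply: erestrict_ge0.
have [N [mN N0 sN]] : {ae mu, forall x, (f \_ D) x <= (g \_ D) x}.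
  apply: filterS fg => x; rewrite !patchE; case: ifP => // /[!inE] Dx; exact.
rewrite !ge0_integralTE//; apply: ge_ereal_sup => _ [h /= hf <-].
pose k := mul_nnsfun h (indic_nnsfun R (measurableC mN)).
apply: ereal_sup_ubound; exists k => /=.
  move=> x; rewrite /k/= /measurable_realfun.mindic indicE; have [xN|xN] := boolP (x \in ~` N).
    rewrite mulr1 (le_trans (hf x))//; apply: contrapT => fgx.
    by move: xN; rewrite inE => /(_ (sN x fgx)).
  by rewrite mulr0.
rewrite -!integralT_nnsfun; apply: ge0_ae_eq_integral => //.
- by apply: measurableT_comp => //; exact: measurable_funPT.
- by apply: measurableT_comp => //; exact: measurable_funPT.
- by move=> x _; rewrite lee_fin.
- by move=> x _; rewrite lee_fin.
exists N; split=> // x /= /not_implyP[_ hk]; apply: contrapT => Nx; apply: hk.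
by rewrite /k/= /measurable_realfun.mindic indicE mem_set// mulr1.
Qed.

Lemma ae_eq_integral_gen D f g : {ae mu, forall x, D x -> f x = g x} ->
  \int[mu]_(x in D) f x = \int[mu]_(x in D) g x.
Proof.
move=> fg; rewrite [LHS]integralE [RHS]integralE.
have E (s t : T -> \bar R) : (forall x, D x -> 0 <= s x) ->
    (forall x, D x -> 0 <= t x) -> {ae mu, forall x, D x -> s x = t x} ->
    \int[mu]_(x in D) s x = \int[mu]_(x in D) t x.
  move=> s0 t0 st; apply/eqP; rewrite eq_le; apply/andP; split.
    by apply: ae_le_integral_ge0 => //; apply: filterS st => x + Dx => ->.
  by apply: ae_le_integral_ge0 => //; apply: filterS st => x + Dx => ->.
congr (_ - _); apply: E => //; apply: filterS fg => x + Dx => /(_ Dx) fgx.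
  by rewrite !funeposE fgx.
by rewrite !funenegE fgx.
Qed.

Lemma ae_eq_Rintegral D (f g : T -> R) :
  {ae mu, forall x, D x -> f x = g x} ->
  (\int[mu]_(x in D) f x = \int[mu]_(x in D) g x)%R.
Proof.
move=> fg; rewrite /Rintegral; congr fine; apply: ae_eq_integral_gen.
by apply: filterS fg => x + Dx => ->.
Qed.

End integral_without_measurability.

Section borel_plane.
Context {R : realType}.
Local Notation mpt := (measurableTypeR R * measurableTypeR R)%type.

(** The measurable sets are those of the product of the two Borel
    sigma-algebras; an open set is one of them as a countable union of squares
    with rational centres. *)
Lemma open_measurable_plane (U : set (R * R)) :
  open U -> measurable (U : set mpt).
Proof.
move=> oU.
pose B (k : rat * rat * nat) : set (R * R) :=
  ball (ratr k.1.1 : R, ratr k.1.2 : R) (k.2.+1%:R^-1).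
have -> : U = \bigcup_(k in [set k | B k `<=` U]) B k.
  apply/seteqP; split => [x Ux|x [k /= kU]]; last exact: kU.
  have /nbhs_ballP[e /= e0 eU] : nbhs x U by exact: open_nbhs_nbhs.
  have e20 : 0 < e / 2 by rewrite divr_gt0.
  have [n en] : exists n : nat, n.+1%:R^-1 < e / 2.
    by have [n _ /(_ n (leqnn _))] := near_infty_natSinv_lt (PosNum e20); exists n.
  have [q1 q1x] : exists q : rat, `|x.1 - ratr q| < n.+1%:R^-1.
    have := @rat_in_itvoo R (x.1 - n.+1%:R^-1) (x.1 + n.+1%:R^-1).
    have n0 : 0 < n.+1%:R^-1 :> R by [].
    move: n0; set d := _^-1 => n0.
    have lt12 : x.1 - d < x.1 + d by lra.
    move=> /(_ lt12)[q]; rewrite in_itv/= => /andP[q1 q2]; exists q.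
    by rewrite ltr_distlC; apply/andP; split; lra.
  have [q2 q2x] : exists q : rat, `|x.2 - ratr q| < n.+1%:R^-1.
    have := @rat_in_itvoo R (x.2 - n.+1%:R^-1) (x.2 + n.+1%:R^-1).
    have n0 : 0 < n.+1%:R^-1 :> R by [].
    move: n0; set d := _^-1 => n0.
    have lt12 : x.2 - d < x.2 + d by lra.
    move=> /(_ lt12)[q]; rewrite in_itv/= => /andP[? ?]; exists q.
    by rewrite ltr_distlC; apply/andP; split; lra.
  exists (q1, q2, n); last first.
    by split => /=; rewrite /ball/= distrC.
  move=> z [/= z1 z2]; apply: eU; split; rewrite /ball/=.
    move: en z1 q1x; set d := _^-1 => en z1 q1x.
    rewrite (le_lt_trans (ler_distD (ratr q1) _ _))//.
    by move: z1; rewrite /ball/= => z1; lra.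
  move: en z2 q2x; set d := _^-1 => en z2 q2x.
  rewrite (le_lt_trans (ler_distD (ratr q2) _ _))//.
  by move: z2; rewrite /ball/= => z2; lra.
rewrite bigcup_mkcond; apply: countable_bigcupT_measurable => // k.
case: ifP => // _; rewrite (_ : B k = ball (ratr k.1.1 : R) k.2.+1%:R^-1 `*` ball (ratr k.1.2 : R) k.2.+1%:R^-1)//.
by apply: measurableX; exact: measurable_ball.
Qed.

Lemma closed_measurable_plane (F : set (R * R)) :
  closed F -> measurable (F : set mpt).
Proof.
by move=> /closed_openC/open_measurable_plane/measurableC; rewrite setCK.
Qed.

Lemma continuous_measurable_plane (f : R * R -> R) :
  continuous f -> measurable_fun [set: mpt] (f : mpt -> R).
Proof.
move=> /continuousP cf; apply: (measurability _ (RGenOpens.measurableE R)).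
move=> _ [_ [a [b ->] <-]]; rewrite setTI; apply: open_measurable_plane.
exact/cf/interval_open.
Qed.

(** Lets the filter combinators find the almost everywhere filter of the
    planar measure. *)
#[export] Instance leb2_ae_filter : Filter (nbhs (almost_everywhere (@leb2 R))).
Proof. exact: ae_filter_ringOfSetsType. Qed.

Lemma leb2X (A B : set (measurableTypeR R)) : measurable A -> measurable B ->
  leb2 (A `*` B) = (lebesgue_measure A * lebesgue_measure B)%E.
Proof. exact: product_measure1E. Qed.

Lemma leb2_sigma_finite : sigma_finite [set: mpt] (@leb2 R).
Proof.
have /sigma_finiteP[F [TF ndF Foo]] := sigma_finiteT (@lebesgue_measure R).
exists (fun n => F n `*` F n).
  rewrite -setXTT TF predeqE => -[x y]; split.
    move=> [/= [n _ Fnx] [k _ Fky]]; exists (maxn n k) => //; split.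
    - by move: x Fnx; exact/subsetPset/ndF/leq_maxl.
    - by move: y Fky; exact/subsetPset/ndF/leq_maxr.
  by move=> [n _ []/= ? ?]; split; exists n.
move=> k; have [? ?] := Foo k; split; first exact: measurableX.
by rewrite leb2X// lte_mul_pinfty// ge0_fin_numE.
Qed.

(** The planar measure carrying the sigma-finiteness that Tonelli's theorem
    reads off its argument. *)
Definition leb2_sigma_finite_measure : {sigma_finite_measure set mpt -> \bar R} :=
  HB.pack_for {sigma_finite_measure set mpt -> \bar R} (Measure.sort (@leb2 R))
    (isSFinite.Build _ _ _ _ (sfinite_measure_sigma_finite leb2_sigma_finite))
    (isSigmaFinite.Build _ _ _ _ leb2_sigma_finite).

Lemma leb2E : @leb2 R = leb2_sigma_finite_measure.
Proof. exact: eq_measure. Qed.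

Lemma bounded_leb2 (A : set (R * R)) : bounded_set A -> exists r : R,
  [/\ 0 < r, A `<=` [set x | `|x.1| <= r /\ `|x.2| <= r] &
     (leb2 [set x : R * R | (`|x.1| <= r)%R /\ (`|x.2| <= r)%R] < +oo)%E].
Proof.
move=> [M [Mr HM]]; have M1 : M < `|M| + 1 by rewrite (le_lt_trans (ler_norm _))// ltrDl.
exists (`|M| + 1); split => //.
- by move=> x /(HM _ M1); rewrite /= prod_normE ge_max => /andP[].
- rewrite (_ : [set x | _ /\ _] = `[- (`|M|+1), `|M|+1]%classic `*` `[- (`|M|+1), `|M|+1]%classic); last first.
    by apply/seteqP; split => -[x y] /=; rewrite !in_itv/= !ler_norml.
  rewrite leb2X//= !lebesgue_measure_itv/=.
  by case: ifP => _; rewrite ?mule0// -?EFinB -EFinM ltry.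
Qed.
End borel_plane.

Section lmeas.
Context {R : realType}.
Variable Om : set (R * R).
Implicit Types f g : R * R -> R.
Local Notation mpt := (measurableTypeR R * measurableTypeR R)%type.

Lemma borel_lmeasurable f : measurable_fun [set: mpt] (f : mpt -> R) -> lmeasurable Om f.
Proof. by move=> mf; exists f => //; exact: aeW. Qed.

Lemma lmeasurableD f g : lmeasurable Om f -> lmeasurable Om g ->
  lmeasurable Om (fun x => f x + g x).
Proof.
move=> [f' mf ff'] [g' mg gg']; exists (fun x => f' x + g' x).
  exact: measurable_funD.
by apply: filterS2 ff' gg' => x ff' gg' Ox; rewrite ff'// gg'.
Qed.

Lemma lmeasurable_norm f : lmeasurable Om f -> lmeasurable Om (fun x => `|f x|).
Proof.
move=> [f' mf ff']; exists (fun x => `|f' x|); first exact: measurableT_comp.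
by apply: filterS ff' => x ff' Ox; rewrite ff'.
Qed.

End lmeas.

(** * A smooth step function *)

Section smooth_functions.
Context {R : realType}.
Implicit Types f g : R -> R.

(** The derivatives are existential witnesses, so that a smoothness proof
    exhibits them instead of computing with the derivative operator. *)
Fixpoint smooth (n : nat) f : Prop :=
  match n with
  | 0 => continuous f
  | m.+1 => exists2 f' : R -> R, (forall x : R, is_derive x (1 : R) f (f' x)) & smooth m f'
  end.

Lemma is_derive_continuous f f' : (forall x : R, is_derive x (1 : R) f (f' x)) ->
  continuous f.
Proof.
move=> df x; apply: differentiable_continuous; apply/derivable1_diffP.
exact: ex_derive.
Qed.

Lemma smooth_continuous n f : smooth n f -> continuous f.
Proof. by case: n => [//|n] [f' df _]; exact: is_derive_continuous df. Qed.

Lemma smoothW n f : smooth n.+1 f -> smooth n f.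
Proof.
elim: n f => [|n IH] f [f' df sf']; first exact: is_derive_continuous df.
by exists f' => //; exact: IH.
Qed.

Lemma smoothD n f g : smooth n f -> smooth n g -> smooth n (fun x => f x + g x).
Proof.
elim: n f g => [|n IH] f g.
  by move=> cf cg x; apply: cvgD; [exact: cf|exact: cg].
move=> [f' df sf] [g' dg sg]; exists (fun x => f' x + g' x); last exact: IH.
by move=> x; exact: is_deriveD.
Qed.

Lemma smoothM n f g : smooth n f -> smooth n g -> smooth n (fun x => f x * g x).
Proof.
elim: n f g => [|n IH] f g.
  by move=> cf cg x; apply: cvgM; [exact: cf|exact: cg].
move=> sf0 sg0; have [f' df sf] := sf0; have [g' dg sg] := sg0.
exists (fun x => f x * g' x + g x * f' x).
  by move=> x; exact: is_deriveM.
by apply: smoothD; apply: IH => //; exact: smoothW.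
Qed.

Lemma smooth_comp n f g : smooth n f -> smooth n g -> smooth n (f \o g).
Proof.
elim: n f g => [|n IH] f g.
  by move=> cf cg x; apply: continuous_comp; [exact: cg|exact: cf].
move=> [f' df sf] sg0; have [g' dg sg] := sg0.
exists (fun x => (f' \o g) x * g' x).
  by move=> x; apply: is_derive1_comp.
by apply: smoothM => //; apply: IH => //; exact: smoothW.
Qed.

Lemma smooth_cst n (c : R) : smooth n (fun=> c).
Proof.
elim: n c => [|n IH] c; first by move=> x; exact: cvg_cst.
by exists (fun=> 0) => // x; exact: is_derive_cst.
Qed.

Lemma is_derive_affine (a b x : R) : is_derive x (1 : R) (fun x : R => a * x + b) a.
Proof.
have -> : (fun x => a * x + b) = (a \*: (id : R -> R)) + cst b by [].
by apply: is_derive_eq; rewrite addr0 /GRing.scale/= mulr1.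
Qed.

Lemma smooth_affine n (a b : R) : smooth n (fun x => a * x + b).
Proof.
have da := is_derive_affine a b; case: n => [|n]; first exact: is_derive_continuous da.
by exists (fun=> a) => //; exact: smooth_cst.
Qed.

(** Each monomial s^n is at most n! times exp s, by the exponential series. *)
Lemma poly_expRN_bounded (p : {poly R}) :
  exists2 C, 0 < C & forall s, 0 < s -> `|p.[s]| * expR (- s) <= C.
Proof.
have mono n s : 0 < s -> s ^+ n * expR (- s) <= n`!%:R.
  move=> s0; rewrite expRN ler_pdivrMr ?expR_gt0//.
  case: n => [|n]; first by rewrite expr0 fact0 mul1r -expR0 ler_expR ltW.
  have := expR_ge1Dxn n (ltW s0); have f0 : 0 < n.+1`!%:R :> R by rewrite ltr0n fact_gt0.
  move=> h; rewrite mulrC -ler_pdivrMr//; apply: le_trans h; lra.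
exists (\sum_(i < size p) `|p`_i| * i`!%:R + 1).
  by rewrite ltr_pwDr// sumr_ge0// => i _; rewrite mulr_ge0.
move=> s s0; rewrite horner_coef.
apply: (@le_trans _ _ (\sum_(i < size p) `|p`_i| * i`!%:R)); last by rewrite lerDl.
apply: (@le_trans _ _ ((\sum_(i < size p) `|p`_i| * s ^+ i) * expR (- s))).
  rewrite ler_wpM2r ?expR_ge0// (le_trans (ler_norm_sum _ _ _))//.
  by apply: ler_sum => i _; rewrite normrM (ger0_norm (exprn_ge0 _ (ltW s0))).
rewrite mulr_suml; apply: ler_sum => i _; rewrite -mulrA ler_wpM2l//.
exact: mono.
Qed.

(** This family, indexed by polynomials in 1/x, is closed under differentiation;
    this is what makes exp (- 1/x), extended by zero, smooth at the origin. *)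
Definition flat (p : {poly R}) (x : R) : R :=
  if 0 < x then p.[x^-1] * expR (- x^-1) else 0.

(** At the origin the difference quotient is dominated by the next power of 1/x
    times exp (- 1/x), which is bounded. *)
Lemma is_derive_flat (p : {poly R}) x :
  is_derive x (1 : R) (flat p) (flat ('X^2 * (p - p^`())) x).
Proof.
have [x0|x0|->] := ltgtP x 0.
- have -> : flat ('X^2 * (p - p^`())) x = 0 by rewrite /flat ltNge (ltW x0).
  apply: (@near_eq_is_derive _ _ _ (cst 0)).
    near=> y; rewrite /flat ltNge (_ : y <= 0)//.
    by near: y; exact: lt_le_nbhsl.
- rewrite {2}/flat x0.
  apply: (@near_eq_is_derive _ _ _ (fun y => (horner p \o GRing.inv) y * (expR \o (fun y => - y^-1)) y)).
    near=> y; rewrite /flat (_ : 0 < y)//.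
    by near: y; exact: lt_nbhsr.
  have dV : is_derive x (1 : R) (@GRing.inv R) (- (x ^- 2)).
    by apply: is_derive_eq; [apply: is_deriveV; rewrite gt_eqF|rewrite /GRing.scale/= mulr1].
  have dNV : is_derive x (1 : R) (fun y : R => - y^-1) (x ^- 2).
    by have := is_deriveN dV; rewrite opprK.
  have dpV := is_derive1_comp (is_derive_poly p x^-1) dV.
  have deV := @is_derive1_comp R expR (fun y => - y^-1) x _ _ (is_derive_expR _) dNV.
  apply: is_derive_eq (is_deriveM dpV deV) _.
  rewrite /= /GRing.scale/= hornerM hornerXn hornerD hornerN.
  rewrite exprVn; ring.
- have E q : flat q 0 = 0 by rewrite /flat ltxx.
  rewrite E; have [C C0 HC] := poly_expRN_bounded ('X^2 * p).
  have cv : h^-1 *: ((flat p \o shift 0) (h *: (1 : R)) - flat p 0) @[h --> 0^'] --> (0 : R).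
    apply/cvgrPdist_le => e e0; near=> h.
    rewrite sub0r normrN E subr0 /= addr0 /GRing.scale/= mulr1 normrM /flat.
    case: ifPn => [h0|_]; last by rewrite normr0 mulr0 ltW.
    have he : `|h| <= e / C.
      by near: h; apply: dnbhs0_le; rewrite divr_gt0.
    have h'0 : 0 < h^-1 by rewrite invr_gt0.
    have := HC _ h'0; rewrite hornerM hornerXn normrM => HCh.
    rewrite normrM (ger0_norm (expR_ge0 _)) (gtr0_norm h'0).
    rewrite (gtr0_norm h0) ler_pdivlMr// in he.
    rewrite (le_trans _ he)// -[leLHS](@mulVKf _ h) ?gt_eqF// ler_pM2l//.
    apply: le_trans HCh; rewrite normrX (gtr0_norm h'0) expr2 !mulrA.
    by rewrite le_eqVlt eqxx.
  by apply: DeriveDef; [apply/cvg_ex; exists 0|exact: cvg_lim].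
Unshelve. all: by end_near. Qed.

Lemma smooth_flat n (p : {poly R}) : smooth n (flat p).
Proof.
elim: n p => [|n IH] p.
  by apply: is_derive_continuous => x; exact: is_derive_flat.
by exists (flat ('X^2 * (p - p^`()))) => // x; exact: is_derive_flat.
Qed.

Definition flatexp := flat 1.
Definition dflatexp := flat 'X^2.

Lemma is_derive_flatexp (x : R) : is_derive x (1 : R) flatexp (dflatexp x).
Proof.
have -> : dflatexp = flat ('X^2 * (1 - 1^`())).
  by rewrite /dflatexp -polyC1 derivC subr0 mulr1.
exact: is_derive_flat.
Qed.

Lemma flatexp_gt0 x : 0 < x -> 0 < flatexp x.
Proof. by move=> x0; rewrite /flatexp /flat x0 hornerC mul1r expR_gt0. Qed.

Lemma flatexp_eq0 x : x <= 0 -> flatexp x = 0.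
Proof. by rewrite /flatexp /flat leNgt => /negbTE ->. Qed.

Lemma dflatexp_ge0 x : 0 <= dflatexp x.
Proof.
rewrite /dflatexp /flat; case: ifP => // x0.
by rewrite hornerXn mulr_ge0 ?expR_ge0// sqr_ge0.
Qed.

Lemma dflatexp_eq0 x : x <= 0 -> dflatexp x = 0.
Proof. by rewrite /dflatexp /flat leNgt => /negbTE ->. Qed.

Lemma le_flatexp x y : x <= y -> flatexp x <= flatexp y.
Proof.
have [x0|x0] := leP x 0.
  rewrite (flatexp_eq0 x0) => _; have [y0|y0] := leP y 0; first by rewrite flatexp_eq0.
  by rewrite ltW// flatexp_gt0.
move=> xy; have y0 := lt_le_trans x0 xy.
rewrite /flatexp /flat x0 y0 !hornerC !mul1r ler_expR lerN2 lef_pV2//.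
Qed.

(** With F = exp (- 1/x), extended by zero, F (F 1 - F (1 - x)) vanishes for
    x <= 0 because F is nondecreasing and is constant for x >= 1 because
    F (1 - x) = 0 there. Dividing by the constant yields a smooth step from 0 to 1
    in closed form, with no integral; the bump is its derivative. *)
Definition sstep (x : R) : R :=
  flatexp (flatexp 1 - flatexp (1 - x)) / flatexp (flatexp 1).

Definition sbump (x : R) : R :=
  dflatexp (flatexp 1 - flatexp (1 - x)) * dflatexp (1 - x) / flatexp (flatexp 1).

Let ff0 : 0 < flatexp (flatexp 1).
Proof. by rewrite !flatexp_gt0. Qed.

Lemma is_derive_sstep (x : R) : is_derive x (1 : R) sstep (sbump x).
Proof.
have d1 : is_derive x (1 : R) (fun x : R => 1 - x) (-1).
  rewrite (_ : (fun x : R => 1 - x) = (fun x => -1 * x + 1)); first exact: is_derive_affine.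
  by apply/funext => y; rewrite mulN1r addrC.
have d2 : is_derive x (1 : R) (flatexp \o (fun x : R => 1 - x)) (dflatexp (1 - x) * -1).
  by apply: is_derive1_comp; exact: is_derive_flatexp.
have d3 : is_derive x (1 : R) (fun x : R => flatexp 1 - flatexp (1 - x)) (dflatexp (1 - x)).
  by have := is_deriveB (is_derive_cst (flatexp 1) x 1) d2; rewrite sub0r mulrN1 opprK.
have d4 : is_derive x (1 : R) (flatexp \o (fun x : R => flatexp 1 - flatexp (1 - x)))
   (dflatexp (flatexp 1 - flatexp (1 - x)) * dflatexp (1 - x)).
  by apply: is_derive1_comp; exact: is_derive_flatexp.
have -> : sstep = (flatexp (flatexp 1))^-1 \*: (flatexp \o (fun x : R => flatexp 1 - flatexp (1 - x))).
  by apply/funext => y; rewrite /sstep mulrC.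
by have := is_deriveZ (flatexp (flatexp 1))^-1 d4; rewrite /GRing.scale/= mulrC.
Qed.

Lemma smooth_sstep n : smooth n sstep.
Proof.
have s1 k : smooth k (flatexp \o (fun x => 1 - x)).
  apply: smooth_comp; first exact: smooth_flat.
  rewrite (_ : (fun x : R => 1 - x) = (fun x => -1 * x + 1)); first exact: smooth_affine.
  by apply/funext => x; rewrite mulN1r addrC.
apply: smoothM; last exact: smooth_cst.
apply: (@smooth_comp n flatexp (fun x => flatexp 1 - flatexp (1 - x))); first exact: smooth_flat.
apply: smoothD; first exact: smooth_cst.
rewrite (_ : (fun x : R => _) = (fun x => -1 * x + 0) \o (flatexp \o (fun x => 1 - x))).
  by apply: smooth_comp => //; exact: smooth_affine.
by apply/funext => x /=; rewrite mulN1r addr0.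
Qed.

(** The bump is the derivative of a function that is smooth to one more order. *)
Lemma smooth_sbump n : smooth n sbump.
Proof.
have [f' df sf] := smooth_sstep n.+1; suff -> : sbump = f' by [].
apply/funext => x; have <- := @derive_val _ _ _ _ _ _ _ (is_derive_sstep x).
exact: derive_val.
Qed.

Lemma sbump_ge0 x : 0 <= sbump x.
Proof. by rewrite /sbump !mulr_ge0 ?dflatexp_ge0// invr_ge0 ltW. Qed.

Lemma sbump_eq0 x : (x <= 0) || (1 <= x) -> sbump x = 0.
Proof.
rewrite /sbump => /orP[x0|x1].
  rewrite dflatexp_eq0 ?mul0r// subr_le0 le_flatexp//; lra.
by rewrite (@dflatexp_eq0 (1 - x)) ?mulr0 ?mul0r// subr_le0.
Qed.

Lemma sstep0 x : x <= 0 -> sstep x = 0.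
Proof.
move=> x0; rewrite /sstep flatexp_eq0 ?mul0r// subr_le0 le_flatexp//; lra.
Qed.

Lemma sstep1 x : 1 <= x -> sstep x = 1.
Proof.
move=> x1; rewrite /sstep (@flatexp_eq0 (1 - x)) ?subr_le0// subr0 divff//.
by rewrite gt_eqF.
Qed.

Lemma sbump_bounded : exists2 B, 0 < B & forall x, sbump x <= B.
Proof.
have [c _ Hc] := @EVT_max R sbump 0 1 ler01 (continuous_subspaceT (smooth_continuous (smooth_sbump 0))).
exists (sbump c + 1); first by rewrite ltr_pwDr// sbump_ge0.
move=> x; have [x01|] := boolP (x \in `[0, 1]).
  by rewrite (le_trans (Hc _ x01))// lerDl.
rewrite in_itv/= negb_and -!ltNge => h; rewrite sbump_eq0.
  by rewrite addr_ge0// sbump_ge0.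
by case/orP: h => /ltW ->; rewrite ?orbT.
Qed.

Lemma sstep_lipschitz B x y : (forall x, sbump x <= B) -> `|sstep x - sstep y| <= B * `|x - y|.
Proof.
move=> HB; wlog xy : x y / x <= y.
  move=> H; have [xy|/ltW yx] := leP x y; first exact: H.
  by rewrite distrC (distrC x); exact: H.
have [c _ E] := @MVT_segment R sstep sbump x y xy (fun x _ => is_derive_sstep x)
   (continuous_subspaceT (smooth_continuous (smooth_sstep 0))).
rewrite distrC E normrM ger0_norm ?sbump_ge0// (distrC x).
by rewrite ler_wpM2r.
Qed.

End smooth_functions.

(** * Product test functions and the mollifying kernel *)

Section product_test_functions.
Context {R : realType}.
Implicit Types A B : R -> R.

Let cvg_quotient A (a x : R) : is_derive x (1 : R) A a ->
  h^-1 *: ((A \o shift x) (h *: (1 : R)) - A x) @[h --> 0^'] --> a.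
Proof. by move=> dA; rewrite -(derive_val (is_derive := dA)); exact: ex_derive. Qed.

Lemma is_derive_prod0 A B (a : R) (x : R * R) : is_derive x.1 (1 : R) A a ->
  is_derive x (basis_vec 0) (fun x => A x.1 * B x.2) (a * B x.2).
Proof.
move=> dA.
have cv : h^-1 *: (((fun x => A x.1 * B x.2) \o shift x) (h *: basis_vec 0) - A x.1 * B x.2)
    @[h --> 0^'] --> a * B x.2.
  rewrite (_ : (fun h => _) = (fun h => h^-1 *: ((A \o shift x.1) (h *: (1 : R)) - A x.1) * B x.2)).
    by apply: cvgM; [exact: cvg_quotient|exact: cvg_cst].
  apply/funext => h; rewrite /= /basis_vec/= /GRing.scale/= !mulr1 mulr0 add0r.
  by rewrite -mulrBl mulrA.
by apply: DeriveDef; [apply/cvg_ex; exists (a * B x.2)|exact: cvg_lim].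
Qed.

Lemma is_derive_prod1 A B (b : R) (x : R * R) : is_derive x.2 (1 : R) B b ->
  is_derive x (basis_vec 1) (fun x => A x.1 * B x.2) (A x.1 * b).
Proof.
move=> dB.
have cv : h^-1 *: (((fun x => A x.1 * B x.2) \o shift x) (h *: basis_vec 1) - A x.1 * B x.2)
    @[h --> 0^'] --> A x.1 * b.
  rewrite (_ : (fun h => _) = (fun h => A x.1 * (h^-1 *: ((B \o shift x.2) (h *: (1 : R)) - B x.2)))).
    by apply: cvgM; [exact: cvg_cst|exact: cvg_quotient].
  apply/funext => h; rewrite /= /basis_vec/= /GRing.scale/= !mulr1 mulr0 add0r.
  by rewrite -mulrBr mulrCA.
by apply: DeriveDef; [apply/cvg_ex; exists (A x.1 * b)|exact: cvg_lim].
Qed.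

(** A partial derivative of a product A x.1 * B x.2 has the same form. *)
Lemma Ck_prod n A B : smooth n A -> smooth n B -> Ck n (fun x => A x.1 * B x.2).
Proof.
elim: n A B => [|n IH] A B sA sB; split => //.
- move=> x; apply: cvgM.
    by apply: (continuous_comp cvg_fst); exact: sA.
  by apply: (continuous_comp cvg_snd); exact: sB.
- move=> x; apply: cvgM.
    by apply: (continuous_comp cvg_fst); exact: (smooth_continuous sA).
  by apply: (continuous_comp cvg_snd); exact: (smooth_continuous sB).
have [A' dA sA'] := sA; have [B' dB sB'] := sB.
move=> i; have : i = 0 \/ i = 1.
  by case: i => -[|[|//]] ?; [left|right]; apply/val_inj.
case=> ->; split.
- by move=> x; apply: ex_derive; apply: is_derive_prod0; exact: dA.
- rewrite (_ : (fun x => _) = (fun x => A' x.1 * B x.2)).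
    by apply: IH => //; exact: smoothW.
  by apply/funext => x; apply: derive_val; apply: is_derive_prod0; exact: dA.
- by move=> x; apply: ex_derive; apply: is_derive_prod1; exact: dB.
- rewrite (_ : (fun x => _) = (fun x => A x.1 * B' x.2)).
    by apply: IH => //; exact: smoothW.
  by apply/funext => x; apply: derive_val; apply: is_derive_prod1; exact: dB.
Qed.

Definition box (a b c d : R) : set (R * R) := `[a, b]%classic `*` `[c, d]%classic.

Lemma compact_box a b c d : compact (box a b c d).
Proof. by apply: compact_setX; exact: segment_compact. Qed.

Lemma test_fun_prod (Om : set (R * R)) A B a b c d :
  (forall n, smooth n A) -> (forall n, smooth n B) ->
  (forall x, ~~ (a <= x <= b) -> A x = 0) -> (forall x, ~~ (c <= x <= d) -> B x = 0) ->
  box a b c d `<=` Om -> test_fun Om (fun x => A x.1 * B x.2).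
Proof.
move=> sA sB A0 B0 sub; split; first by move=> n; exact: Ck_prod.
exists (box a b c d); split => //; first exact: compact_box.
move=> x; rewrite /box /= => /not_andP[]; rewrite in_itv/= => /negP h.
  by rewrite A0// mul0r.
by rewrite B0// mulr0.
Qed.

Definition rstep (r a y : R) := sstep ((y - a) / r).
Definition rbump (r a y : R) := sbump ((y - a) / r) / r.

Let affE r a : (fun y : R => (y - a) / r) = (fun y => r^-1 * y + (- a / r)).
Proof. by apply/funext => y; rewrite mulrBl mulrC mulNr. Qed.

Lemma is_derive_rstep r a (y : R) : is_derive y (1 : R) (rstep r a) (rbump r a y).
Proof.
apply: (@is_derive1_comp R sstep (fun y => (y - a) / r)); first exact: is_derive_sstep.
by rewrite affE; exact: is_derive_affine.
Qed.

Lemma smooth_rstep n r a : smooth n (rstep r a).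
Proof.
apply: (@smooth_comp R n sstep (fun y => (y - a) / r)); first exact: smooth_sstep.
by rewrite affE; exact: smooth_affine.
Qed.

Lemma smooth_rbump n r a : smooth n (rbump r a).
Proof.
apply: smoothM; last exact: smooth_cst.
apply: (@smooth_comp R n sbump (fun y => (y - a) / r)); first exact: smooth_sbump.
by rewrite affE; exact: smooth_affine.
Qed.

Lemma rbump_ge0 r a y : 0 < r -> 0 <= rbump r a y.
Proof. by move=> r0; rewrite /rbump mulr_ge0 ?sbump_ge0// invr_ge0 ltW. Qed.

Lemma rbump_eq0 r a y : 0 < r -> ~~ (a <= y <= a + r) -> rbump r a y = 0.
Proof.
move=> r0; rewrite negb_and -!ltNge /rbump => h; rewrite sbump_eq0 ?mul0r//.
case/orP: h => h; apply/orP; [left|right].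
  by rewrite mulr_le0_ge0 ?invr_ge0 ?ltW// subr_lt0.
by rewrite ler_pdivlMr// mul1r lerBrDl ltW.
Qed.

Lemma rbump_le (M : R) r a y : (forall x, sbump x <= M) -> 0 < r -> rbump r a y <= M / r.
Proof. by move=> HB r0; rewrite ler_pM2r ?invr_gt0. Qed.

(** To the left of both steps the two are 0, to the right of both they are 1. *)
Lemma rstepB_eq0 r a a' y : 0 < r ->
  ~~ (Num.min a a' <= y <= Num.max a a' + r) -> rstep r a y - rstep r a' y = 0.
Proof.
move=> r0; rewrite negb_and -!ltNge lt_min => /orP[/andP[ya ya']|].
  have n z : y < z -> sstep ((y - z) / r) = 0.
    by move=> yz; rewrite sstep0// mulr_le0_ge0 ?invr_ge0 ?ltW// subr_lt0.
  by rewrite /rstep !n// subrr.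
rewrite -ltrBrDr gt_max => /andP[ya ya'].
have n z : z < y - r -> sstep ((y - z) / r) = 1.
  by move=> yz; rewrite sstep1// ler_pdivlMr// mul1r; lra.
by rewrite /rstep !n// subrr.
Qed.

Lemma rstepB_le (M : R) r a a' y : (forall x, sbump x <= M) -> 0 < r ->
  `|rstep r a y - rstep r a' y| <= M * `|a - a'| / r.
Proof.
move=> HB r0; rewrite /rstep (le_trans (sstep_lipschitz _ _ HB))//.
rewrite (_ : (y - a) / r - (y - a') / r = (a' - a) / r); last first.
  by rewrite -mulrBl; congr (_ / _); ring.
by rewrite normrM (gtr0_norm (_ : 0 < r^-1)) ?invr_gt0// mulrA (distrC a').
Qed.

(** By the fundamental theorem of calculus the integral is the height of the
    step. *)
Lemma integral_rbump r a : 0 < r ->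
  (\int[lebesgue_measure]_y (rbump r a y)%:E = 1)%E.
Proof.
move=> r0.
have -> : (\int[lebesgue_measure]_y (rbump r a y)%:E =
    \int[lebesgue_measure]_(y in `[a, (a + r)%R]) (rbump r a y)%:E)%E.
  rewrite [RHS]integral_mkcond; apply: eq_integral => y _; rewrite patchE.
  case: ifPn => //; rewrite notin_setE /= in_itv/= => /negP h.
  by rewrite rbump_eq0.
have cs := smooth_continuous (smooth_rstep 0 r a).
have cb := smooth_continuous (smooth_rbump 0 r a).
rewrite (@continuous_FTC2 _ _ (rstep r a)) ?ltrDl//.
- have -> : rstep r a (a + r) = 1.
    by rewrite /rstep (_ : a + r - a = r) ?divff ?gt_eqF ?sstep1//; ring.
  have -> : rstep r a a = 0 by rewrite /rstep subrr mul0r sstep0.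
  by rewrite sube0.
- exact: continuous_subspaceT.
- split.
  + by move=> x _; apply: ex_derive; exact: is_derive_rstep.
  + by apply: cvg_at_right_filter; exact: cs.
  + by apply: cvg_at_left_filter; exact: cs.
- by move=> x _; rewrite derive1E; apply: derive_val; exact: is_derive_rstep.
Qed.

(** The bump lives on [0, 1], so this mollifying kernel is supported in the
    square of side r whose lower left corner is x; it is one-sided. *)
Definition kern (r : R) (x y : R * R) : R := rbump r x.1 y.1 * rbump r x.2 y.2.

Lemma kern_ge0 r x y : 0 < r -> 0 <= kern r x y.
Proof. by move=> r0; rewrite mulr_ge0// rbump_ge0. Qed.

Lemma kern_eq0 r x y : 0 < r -> ~ box x.1 (x.1 + r) x.2 (x.2 + r) y -> kern r x y = 0.
Proof.
rewrite /box => r0 /= /not_andP[]; rewrite in_itv/= => /negP h; rewrite /kern.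
  by rewrite rbump_eq0// mul0r.
by rewrite (@rbump_eq0 _ x.2)// mulr0.
Qed.

Local Notation mpt := (measurableTypeR R * measurableTypeR R)%type.

Lemma measurable_rbump r :
  measurable_fun [set: measurableTypeR R * measurableTypeR R]
    (fun z : measurableTypeR R * measurableTypeR R => rbump r z.1 z.2).
Proof.
apply: measurable_funM; last exact: measurable_cst.
apply: (@measurableT_comp _ _ _ _ _ _ (@sbump R)).
  exact: (continuous_measurable_fun (smooth_continuous (smooth_sbump 0))).
apply: measurable_funM; last exact: measurable_cst.
by apply: measurable_funB; [exact: measurable_snd|exact: measurable_fst].
Qed.

Lemma integral_kern r x : 0 < r -> (\int[leb2]_y (kern r x y)%:E = 1)%E.
Proof.
move=> r0; rewrite /leb2 fubini_tonelli1//=; last 2 first.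
- apply/measurable_EFinP; apply: continuous_measurable_plane => y.
  apply: cvgM.
    by apply: (continuous_comp cvg_fst); exact: (smooth_continuous (smooth_rbump 0 _ _)).
  by apply: (continuous_comp cvg_snd); exact: (smooth_continuous (smooth_rbump 0 _ _)).
- by move=> y; rewrite lee_fin kern_ge0.
rewrite /fubini_F -[RHS](integral_rbump x.1 r0); apply: eq_integral => y1 _.
under eq_integral do rewrite /kern/= EFinM.
rewrite ge0_integralZl//=.
- by rewrite integral_rbump// mule1.
- apply/measurable_EFinP.
  exact: (continuous_measurable_fun (smooth_continuous (smooth_rbump 0 _ _))).
- by move=> y2 _; rewrite lee_fin rbump_ge0.
- by rewrite lee_fin rbump_ge0.
Qed.

(** Differentiation in the position of the step; it is used to see that the
    kernel has mass one also as a function of its first argument. *)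
Lemma is_derive_rstepl r y (a : R) :
  is_derive a (1 : R) (fun a => rstep r a y) (- rbump r a y).
Proof.
rewrite -mulrN -invrN.
have aff : (fun a => (y - a) / r) = (fun a => (- r)^-1 * a + y / r).
  by apply/funext => z; rewrite invrN mulrBl addrC mulNr mulrC.
have := @is_derive1_comp R sstep (fun a => (y - a) / r) a _ _ (is_derive_sstep _).
by move=> /(_ (- r)^-1); apply; rewrite aff; exact: is_derive_affine.
Qed.

Lemma integral_rbumpl r y : 0 < r ->
  (\int[lebesgue_measure]_a (rbump r a y)%:E = 1)%E.
Proof.
move=> r0.
have -> : (\int[lebesgue_measure]_a (rbump r a y)%:E =
    \int[lebesgue_measure]_(a in `[(y - r)%R, y]) (rbump r a y)%:E)%E.
  rewrite [RHS]integral_mkcond; apply: eq_integral => a _; rewrite patchE.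
  case: ifPn => //; rewrite notin_setE /= in_itv/= => /negP h.
  rewrite rbump_eq0//; apply: contra h => /andP[ay yar].
  by rewrite ay lerBlDr yar.
have cr : continuous (fun a => rstep r a y).
  exact: (is_derive_continuous (is_derive_rstepl r y)).
have cb : continuous (fun a => rbump r a y).
  move=> a; apply: cvgM; last exact: cvg_cst.
  apply: (@continuous_comp _ _ _ (fun a => (y - a) / r)); last exact: (smooth_continuous (smooth_sbump 0)).
  by apply: cvgM; [apply: cvgB; [exact: cvg_cst|exact: cvg_id]|exact: cvg_cst].
rewrite (@continuous_FTC2 _ _ (fun a => - rstep r a y)) ?ltrBlDr ?ltrDl//.
- have -> : rstep r (y - r) y = 1.
    by rewrite /rstep (_ : y - (y - r) = r) ?divff ?gt_eqF ?sstep1//; ring.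
  have -> : rstep r y y = 0 by rewrite /rstep subrr mul0r sstep0.
  by rewrite oppr0 sub0e EFinN oppeK.
- exact: continuous_subspaceT.
- have cN : continuous (fun a => - rstep r a y) by move=> a; apply: cvgN; exact: cr.
  split.
  + by move=> x _; apply: derivableN; apply: ex_derive; exact: is_derive_rstepl.
  + by apply: cvg_at_right_filter; exact: cN.
  + by apply: cvg_at_left_filter; exact: cN.
- move=> x _; rewrite derive1E; apply: derive_val.
  by have := is_deriveN (is_derive_rstepl r y x); rewrite opprK.
Qed.

Lemma measurable_kern r (D : set (mpt * mpt)) :
  measurable_fun D (fun z : mpt * mpt => kern r z.1 z.2).
Proof.
apply: measurable_funTS; apply: measurable_funM.
- apply: (@measurableT_comp _ _ _ _ _ _ (fun z : measurableTypeR R * measurableTypeR R => rbump r z.1 z.2) _ (fun z : mpt * mpt => (z.1.1, z.2.1))).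
    exact: measurable_rbump.
  apply/measurable_fun_pairP; split => /=.
    by apply: (@measurableT_comp _ _ _ _ _ _ fst _ (fst : mpt * mpt -> mpt)).
  by apply: (@measurableT_comp _ _ _ _ _ _ fst _ (snd : mpt * mpt -> mpt)).
- apply: (@measurableT_comp _ _ _ _ _ _ (fun z : measurableTypeR R * measurableTypeR R => rbump r z.1 z.2) _ (fun z : mpt * mpt => (z.1.2, z.2.2))).
    exact: measurable_rbump.
  apply/measurable_fun_pairP; split => /=.
    by apply: (@measurableT_comp _ _ _ _ _ _ snd _ (fst : mpt * mpt -> mpt)).
  by apply: (@measurableT_comp _ _ _ _ _ _ snd _ (snd : mpt * mpt -> mpt)).
Qed.

Lemma integral_kernl r y : 0 < r -> (\int[leb2]_x (kern r x y)%:E = 1)%E.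
Proof.
have mb (a : R) : measurable_fun setT (fun x : measurableTypeR R => rbump r x a).
  exact: (measurableT_comp (measurable_rbump r) (measurable_pair2 a)).
move=> r0; rewrite /leb2 fubini_tonelli1//=; last 2 first.
- apply/measurable_EFinP.
  apply: (@measurableT_comp _ _ _ _ _ _ (fun z : mpt * mpt => kern r z.1 z.2) _ (fun x : mpt => (x, y))).
    exact: measurable_kern.
  exact: measurable_pair2.
- by move=> x; rewrite lee_fin kern_ge0.
rewrite /fubini_F -[RHS](integral_rbumpl y.1 r0); apply: eq_integral => y1 _.
under eq_integral do rewrite /kern/= EFinM.
rewrite ge0_integralZl//=.
- by rewrite integral_rbumpl// mule1.
- exact/measurable_EFinP.
- by move=> y2 _; rewrite lee_fin rbump_ge0.
- by rewrite lee_fin rbump_ge0.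
Qed.

End product_test_functions.

(** * Mollification of a function with bounded weak derivatives *)

Section integral_bounds.
Context d (T : measurableType d) (R : realType) (mu : {measure set T -> \bar R}).
Implicit Types (D : set T) (F : T -> R).

Lemma integral_le_indic D F (c : R) (A : set T) : measurable A -> 0 <= c ->
  {ae mu, forall x, D x -> F x <= c * \1_A x} ->
  (\int[mu]_(x in D) (F^\+ x)%:E <= c%:E * mu A)%E.
Proof.
move=> mA c0 FA; apply: (@le_trans _ _ (\int[mu]_x (c%:E * (\1_A x)%:E))%E).
  rewrite integral_mkcond; apply: ae_le_integral_ge0.
  - by move=> x _; apply: erestrict_ge0 => y _; rewrite lee_fin /funrpos le_max lexx orbT.
  - by move=> x _; rewrite mule_ge0 ?lee_fin// indicE.
  apply: filterS FA => x FA _; rewrite patchE; case: ifPn => [/[!inE]Dx|_].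
    rewrite -EFinM lee_fin /funrpos ge_max FA//= mulr_ge0// indicE//.
  by rewrite mule_ge0// lee_fin// indicE.
rewrite ge0_integralZl//=; first by rewrite integral_indic// setIT.
by apply/measurable_EFinP; exact: measurable_indic.
Qed.

Lemma norm_Rintegral_le D F (c : R) (A : set T) : measurable A -> 0 <= c ->
  (mu A < +oo)%E ->
  {ae mu, forall x, D x -> `|F x| <= c * \1_A x} ->
  `|\int[mu]_(x in D) F x| <= c * fine (mu A).
Proof.
move=> mA c0 Afin FA; rewrite /Rintegral integralE.
have E1 : (EFin \o F)^\+%E = EFin \o F^\+.
  by apply/funext => x; rewrite /= funeposE /funrpos EFin_max.
have E2 : (EFin \o F)^\-%E = EFin \o F^\-.
  by apply/funext => x; rewrite /= funenegE /funrneg EFin_max.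
have -> : (fun x => ((fun x0 => (F x0)%:E)^\+ x)%E) = (fun x => (F^\+ x)%:E) by exact: E1.
have -> : (fun x => ((fun x0 => (F x0)%:E)^\- x)%E) = (fun x => (F^\- x)%:E) by exact: E2.
have I1 : (\int[mu]_(x in D) (F^\+ x)%:E <= c%:E * mu A)%E.
  apply: integral_le_indic => //; apply: filterS FA => x FA Dx.
  by rewrite (le_trans (ler_norm _))// FA.
have I2 : (\int[mu]_(x in D) (F^\- x)%:E <= c%:E * mu A)%E.
  have -> : F^\- = (\- F)^\+ by apply/funext => x; rewrite /funrneg /funrpos.
  apply: integral_le_indic => //; apply: filterS FA => x FA Dx.
  by rewrite (le_trans (ler_norm _))// normrN FA.
have J1 : (0 <= \int[mu]_(x in D) (F^\+ x)%:E)%E.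
  by apply: integral_ge0 => x _; rewrite lee_fin /funrpos le_max lexx orbT.
have J2 : (0 <= \int[mu]_(x in D) (F^\- x)%:E)%E.
  by apply: integral_ge0 => x _; rewrite lee_fin /funrneg le_max lexx orbT.
have Af : mu A \is a fin_num by rewrite ge0_fin_numE.
rewrite -(fineK Af) -EFinM in I1 I2.
move: I1 I2 J1 J2.
set p := (\int[mu]_(x in D) (F^\+ x)%:E)%E; set n := (\int[mu]_(x in D) (F^\- x)%:E)%E.
move: p n => [p| |] [n| |]//=; rewrite !lee_fin ler_norml => *.
by apply/andP; split; lra.
Qed.

End integral_bounds.

Section mollification.
Context {R : realType}.
Variables (Om : set (R * R)) (f : R * R -> R) (M0 : R).
Hypothesis mf : measurable_fun [set: measurableTypeR R * measurableTypeR R]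
  (f : measurableTypeR R * measurableTypeR R -> R).
Hypothesis fM0 : forall x, `|f x| <= M0.
Hypothesis f0 : forall x, ~ Om x -> f x = 0.
Local Notation mpt := (measurableTypeR R * measurableTypeR R)%type.

Lemma measurable_kern1 r x : measurable_fun [set: mpt] (kern r x : mpt -> R).
Proof.
apply: continuous_measurable_plane => y; apply: cvgM.
  by apply: (continuous_comp cvg_fst); exact: (smooth_continuous (smooth_rbump 0 _ _)).
by apply: (continuous_comp cvg_snd); exact: (smooth_continuous (smooth_rbump 0 _ _)).
Qed.

Lemma integrable_kern (h : R * R -> R) (K r : R) x : 0 < r ->
  measurable_fun [set: mpt] (h : mpt -> R) -> (forall y, `|h y| <= K) ->
  (@leb2 R).-integrable setT (fun y => (h y * kern r x y)%:E).
Proof.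
move=> r0 mh hK; have K0 : 0 <= K by rewrite (le_trans _ (hK (0, 0))).
apply: (@le_integrable _ _ _ leb2 setT measurableT _ (fun y => (K%:E * (kern r x y)%:E)%E)).
- by apply/measurable_EFinP; apply: measurable_funM => //; exact: measurable_kern1.
- move=> y _; rewrite /= lee_fin !normrM ler_wpM2r//.
  by rewrite (ger0_norm K0).
apply: integrableZl => //; apply/integrableP; split.
  by apply/measurable_EFinP; exact: measurable_kern1.
under eq_integral => y _ do rewrite /= ger0_norm ?kern_ge0//.
by rewrite integral_kern// ltry.
Qed.

Definition moll (r : R) (x : R * R) : R := \int[leb2]_y (f y * kern r x y).

Variables (phi : R * R -> R) (M : R).
Hypothesis fphi : aeq Om phi f.
Hypothesis M_ge0 : 0 <= M.

Lemma leb2_box (a b c d : R) : a <= b -> c <= d ->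
  leb2 (box a b c d) = ((b - a) * (d - c))%:E.
Proof.
move=> ab cd; rewrite /box leb2X//= !lebesgue_measure_itv/= !lte_fin.
have E (u v : R) : u <= v -> (if (u < v)%R then v%:E - u%:E else 0)%E = (v - u)%:E :> \bar R.
  move=> uv; case: ltP => // vu; rewrite (_ : v = u) ?subrr//.
  by apply/eqP; rewrite eq_le uv vu.
by rewrite !E// EFinM.
Qed.

Lemma measurable_box (a b c d : R) : measurable (box a b c d : set mpt).
Proof. by apply: measurableX. Qed.

(** If kern r x - kern r x' is the i-th partial derivative of a test function
    theta, then the difference of the two mollified values is the integral of
    phi times this derivative, that is, minus the integral of g theta, where g is
    the i-th weak derivative of phi. *)
Lemma mollB (i : 'I_2) (g theta : R * R -> R) (r : R) (x x' : R * R) (k a b c d : R) :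
  weak_partial Om i phi g -> {ae leb2, forall y, Om y -> `|g y| <= M} ->
  0 < r -> test_fun Om theta -> 0 <= k -> a <= b -> c <= d ->
  (forall y, 'D_(basis_vec i) theta y = kern r x y - kern r x' y) ->
  (forall y, `|theta y| <= k * \1_(box a b c d) y) ->
  `|moll r x - moll r x'| <= M * k * ((b - a) * (d - c)).
Proof.
move=> [_ _ wp] gM r0 tf k0 ab cd dth th.
have -> : moll r x - moll r x' = - \int[leb2]_(y in Om) (g y * theta y).
  rewrite /moll -RintegralB//; [|exact: integrable_kern..].
  rewrite -(wp _ tf) [RHS]Rintegral_mkcond.
  apply: ae_eq_Rintegral; apply: filterS fphi => y fp _.
  rewrite patchE; case: ifPn; rewrite ?notin_setE ?inE => Oy.
    by rewrite fp// dth mulrBr.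
  by rewrite f0// !mul0r subrr.
have -> : (b - a) * (d - c) = fine (leb2 (box a b c d)) by rewrite leb2_box.
rewrite normrN; apply: norm_Rintegral_le.
- exact: measurable_box.
- exact: mulr_ge0.
- by rewrite leb2_box// ltry.
- apply: filterS gM => y gM Oy; rewrite normrM -mulrA ler_pM//.
  exact: gM.
Qed.

Variables (g0 g1 : R * R -> R) (B : R).
Hypotheses (wp0 : weak_partial Om 0 phi g0) (wp1 : weak_partial Om 1 phi g1).
Hypotheses (g0M : {ae leb2, forall y, Om y -> `|g0 y| <= M})
           (g1M : {ae leb2, forall y, Om y -> `|g1 y| <= M}).
Hypothesis HB : forall x, sbump x <= B.

Let B0 : 0 <= B. Proof. by rewrite (le_trans _ (HB 0))// sbump_ge0. Qed.

Lemma box_mem a b c d (y : R * R) :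
  reflect (box a b c d y) ((a <= y.1 <= b) && (c <= y.2 <= d)).
Proof.
by apply: (iffP andP) => -[]; rewrite /box /= !in_itv/=.
Qed.

(** Here theta is the difference of two steps in the first variable times a
    bump in the second. Its size is of order |a - a'| / r^2 on a box of area of
    order r^2, so the bound does not depend on r. *)
Lemma moll_axis0 r a a' c : 0 < r -> `|a - a'| <= r ->
  box (Num.min a a') (Num.max a a' + r) c (c + r) `<=` Om ->
  `|moll r (a, c) - moll r (a', c)| <= 2 * M * B ^+ 2 * `|a - a'|.
Proof.
move=> r0 aa' sub.
pose th y : R := (rstep r a y.1 - rstep r a' y.1) * rbump r c y.2.
have mm : Num.min a a' <= Num.max a a' + r.
  apply: (@le_trans _ _ (Num.max a a')); last by rewrite lerDl ltW.
  by case: (leP a a') => // /ltW.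
have dd y : is_derive y (basis_vec 0) th (kern r (a, c) y - kern r (a', c) y).
  rewrite /kern/= -mulrBl.
  apply: (is_derive_prod0 (A := fun t => rstep r a t - rstep r a' t)).
  by apply: is_deriveB; exact: is_derive_rstep.
have := @mollB 0 g0 th r (a, c) (a', c) (B * `|a - a'| / r * (B / r)) _ _ _ _ wp0 g0M r0 _ _ mm _ _ _.
have le1 : Num.max a a' - Num.min a a' = `|a - a'|.
  case: (leP a a') => [h|/ltW h].
    by rewrite distrC ger0_norm ?subr_ge0.
  by rewrite ger0_norm ?subr_ge0.
move=> /(_ c (c + r)) H.
apply: (le_trans (H _ _ _ _ _)).
- apply: (@test_fun_prod _ Om (fun t => rstep r a t - rstep r a' t) (rbump r c) _ _ _ _ _ _ _ _ sub).
  + move=> n; rewrite (_ : (fun t => _) = (fun t => rstep r a t + (-1 * rstep r a' t + 0))); last first.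
      by apply/funext => t; rewrite mulN1r addr0.
    apply: smoothD; first exact: smooth_rstep.
    apply: (@smooth_comp _ _ (fun t => -1 * t + 0) (rstep r a')); first exact: smooth_affine.
    exact: smooth_rstep.
  + by move=> n; exact: smooth_rbump.
  + by move=> t; exact: rstepB_eq0.
  + by move=> t; exact: rbump_eq0.
- by rewrite !mulr_ge0// invr_ge0 ltW.
- by rewrite lerDl ltW.
- by move=> y; exact: derive_val.
- move=> y; rewrite indicE; have [|] := boolP (y \in _).
    move=> _; rewrite mulr1 normrM ler_pM ?rstepB_le//.
    by rewrite ger0_norm ?rbump_ge0// rbump_le.
  rewrite notin_setE => nb; rewrite mulr0 /th.
  have : ~~ ((Num.min a a' <= y.1 <= Num.max a a' + r) && (c <= y.2 <= c + r)).
    by apply/negP => h; apply: nb; exact/box_mem.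
  rewrite negb_and => /orP[h|h].
    by rewrite rstepB_eq0// mul0r normr0.
  by rewrite (@rbump_eq0 _ r c)// mulr0 normr0.
rewrite (_ : c + r - c = r); last by ring.
rewrite (_ : Num.max a a' + r - Num.min a a' = `|a - a'| + r); last by rewrite addrAC le1.
rewrite (_ : M * _ * _ = M * B ^+ 2 * `|a - a'| * ((`|a - a'| + r) / r)); last first.
  by field; rewrite gt_eqF.
rewrite (_ : 2 * M * B ^+ 2 * `|a - a'| = M * B ^+ 2 * `|a - a'| * 2); last by ring.
rewrite ler_wpM2l ?mulr_ge0// ?exprn_ge0//.
rewrite ler_pdivrMr//; lra.
Qed.

Lemma moll_axis1 r a c c' : 0 < r -> `|c - c'| <= r ->
  box a (a + r) (Num.min c c') (Num.max c c' + r) `<=` Om ->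
  `|moll r (a, c) - moll r (a, c')| <= 2 * M * B ^+ 2 * `|c - c'|.
Proof.
move=> r0 cc' sub.
pose th y : R := rbump r a y.1 * (rstep r c y.2 - rstep r c' y.2).
have mm : Num.min c c' <= Num.max c c' + r.
  apply: (@le_trans _ _ (Num.max c c')); last by rewrite lerDl ltW.
  by case: (leP c c') => // /ltW.
have dd y : is_derive y (basis_vec 1) th (kern r (a, c) y - kern r (a, c') y).
  rewrite /kern/= -mulrBr.
  apply: (@is_derive_prod1 _ (rbump r a) (fun t => rstep r c t - rstep r c' t)).
  by apply: is_deriveB; exact: is_derive_rstep.
have le1 : Num.max c c' - Num.min c c' = `|c - c'|.
  case: (leP c c') => [h|/ltW h].
    by rewrite distrC ger0_norm ?subr_ge0.
  by rewrite ger0_norm ?subr_ge0.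
have := @mollB 1 g1 th r (a, c) (a, c') (B / r * (B * `|c - c'| / r)) a (a + r) _ _ wp1 g1M r0 _ _ _ mm _ _.
move=> H.
apply: (le_trans (H _ _ _ _ _)).
- apply: (@test_fun_prod _ Om (rbump r a) (fun t => rstep r c t - rstep r c' t) _ _ _ _ _ _ _ _ sub).
  + by move=> n; exact: smooth_rbump.
  + move=> n; rewrite (_ : (fun t => _) = (fun t => rstep r c t + (-1 * rstep r c' t + 0))); last first.
      by apply/funext => t; rewrite mulN1r addr0.
    apply: smoothD; first exact: smooth_rstep.
    apply: (@smooth_comp _ _ (fun t => -1 * t + 0) (rstep r c')); first exact: smooth_affine.
    exact: smooth_rstep.
  + by move=> t; exact: rbump_eq0.
  + by move=> t; exact: rstepB_eq0.
- by rewrite !mulr_ge0// invr_ge0 ltW.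
- by rewrite lerDl ltW.
- by move=> y; exact: derive_val.
- move=> y; rewrite indicE; have [|] := boolP (y \in _).
    move=> _; rewrite mulr1 normrM ler_pM ?rstepB_le//.
    by rewrite ger0_norm ?rbump_ge0// rbump_le.
  rewrite notin_setE => nb; rewrite mulr0 /th.
  have : ~~ ((a <= y.1 <= a + r) && (Num.min c c' <= y.2 <= Num.max c c' + r)).
    by apply/negP => h; apply: nb; exact/box_mem.
  rewrite negb_and => /orP[h|h].
    by rewrite (@rbump_eq0 _ r a)// mul0r normr0.
  by rewrite rstepB_eq0// mulr0 normr0.
rewrite (_ : a + r - a = r); last by ring.
rewrite (_ : Num.max c c' + r - Num.min c c' = `|c - c'| + r); last by rewrite addrAC le1.
rewrite (_ : M * _ * _ = M * B ^+ 2 * `|c - c'| * ((`|c - c'| + r) / r)); last first.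
  by field; rewrite gt_eqF.
rewrite (_ : 2 * M * B ^+ 2 * `|c - c'| = M * B ^+ 2 * `|c - c'| * 2); last by ring.
rewrite ler_wpM2l ?mulr_ge0// ?exprn_ge0//.
rewrite ler_pdivrMr//; lra.
Qed.

(** Near such points the translated kernels of scale at most dl / 2 stay inside
    the domain. *)
Definition inner (dl : R) (x : R * R) :=
  forall y : R * R, `|y.1 - x.1| <= dl -> `|y.2 - x.2| <= dl -> Om y.

Let L := 2 * M * B ^+ 2.

(** Two moves along the axes, each at most as long as the scale. *)
Lemma moll_step r dl (x x' : R * R) : 0 < r -> 2 * r <= dl -> inner dl x ->
  `|x.1 - x'.1| <= r -> `|x.2 - x'.2| <= r ->
  `|moll r x - moll r x'| <= L * (`|x.1 - x'.1| + `|x.2 - x'.2|).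
Proof.
case: x x' => [a c] [a' c'] /= r0 rdl inx ra rc.
have Hmin (u v w : R) : Num.min u v <= w -> `|u - v| <= r -> u - r <= w.
  by rewrite ge_min ler_norml => /orP[] ? /andP[? ?]; lra.
have Hmax (u v w : R) : w <= Num.max u v + r -> `|u - v| <= r -> w <= u + 2 * r.
  rewrite -lerBlDr le_max ler_norml => /orP[] ? /andP[? ?]; lra.
have s1 : box (Num.min a a') (Num.max a a' + r) c (c + r) `<=` Om.
  move=> y /box_mem /andP[/andP[y1 y2] /andP[y3 y4]]; apply: inx => /=; rewrite ler_norml.
    have := Hmin _ _ _ y1 ra; have := Hmax _ _ _ y2 ra; lra.
  lra.
have s2 : box a' (a' + r) (Num.min c c') (Num.max c c' + r) `<=` Om.
  move=> y /box_mem /andP[/andP[y1 y2] /andP[y3 y4]]; apply: inx => /=; rewrite ler_norml.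
    by move: ra; rewrite ler_norml => /andP[? ?]; lra.
  have := Hmin _ _ _ y3 rc; have := Hmax _ _ _ y4 rc; lra.
rewrite mulrDr (le_trans (ler_distD (moll r (a', c)) _ _))// lerD//.
  exact: moll_axis0.
exact: moll_axis1.
Qed.

Hypothesis convOm : convex_set Om.

Lemma convex_setP (x x' : R * R) (t : R) : Om x -> Om x' -> 0 <= t <= 1 ->
  Om (x + t *: (x' - x)).
Proof.
move=> Ox Ox' t01.
have /andP[t0 t1] := t01.
pose l : {i01 R} := Itv01 t0 t1.
have := convOm l (mem_set Ox') (mem_set Ox); rewrite inE.
suff -> : convex.conv l (x' : convex_lmodType (R * R)%type) x = x + t *: (x' - x) by [].
transitivity (t *: x' + (1 - t) *: x); first by [].
by rewrite scalerBl scale1r scalerBr addrC -addrA [- _ + _]addrC.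
Qed.

Lemma inner_convex dl (x x' : R * R) (t : R) : inner dl x -> inner dl x' ->
  0 <= t <= 1 -> inner dl (x + t *: (x' - x)).
Proof.
move=> ix ix' t01 y y1 y2.
pose p := x + t *: (x' - x); pose e := y - p.
have := @convex_setP (x + e) (x' + e) t.
rewrite (_ : x + e + t *: (x' + e - (x + e)) = y).
  by apply => //; [apply: ix|apply: ix']; rewrite /= addrAC subrr add0r.
by rewrite opprD addrACA subrr addr0 addrAC -/p addrC subrK.
Qed.

(** The segment from x to x' stays in the inner domain by convexity; it is cut
    into pieces shorter than r, and the bounds of [moll_step] add up. *)
Lemma moll_lip r dl (x x' : R * R) : 0 < r -> 2 * r <= dl -> inner dl x ->
  inner dl x' ->
  `|moll r x - moll r x'| <= L * (`|x.1 - x'.1| + `|x.2 - x'.2|).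
Proof.
move=> r0 rdl ix ix'.
pose D1 := `|x.1 - x'.1|; pose D2 := `|x.2 - x'.2|.
have [N [N0 NE]] : exists N : nat, 0 < N%:R :> R /\ D1 + D2 <= N%:R * r.
  exists (Num.trunc ((D1 + D2) / r)).+1; split; first by rewrite ltr0n.
  by rewrite -ler_pdivrMr//; apply/ltW; exact: truncnS_gt.
pose z k := x + (k%:R / N%:R) *: (x' - x).
have D1_ge0 : 0 <= D1 := normr_ge0 _.
have D2_ge0 : 0 <= D2 := normr_ge0 _.
have L0 : 0 <= L by rewrite /L !mulr_ge0// exprn_ge0.
have zz k : (z k).1 - (z k.+1).1 = (x.1 - x'.1) / N%:R /\ (z k).2 - (z k.+1).2 = (x.2 - x'.2) / N%:R.
  rewrite /z /= /GRing.scale/= -[k.+1]addn1 natrD.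
  by split; field; rewrite gt_eqF.
have VN : 0 <= N%:R^-1 :> R by rewrite invr_ge0 ltW.
have main k : (k <= N)%N -> `|moll r x - moll r (z k)| <= L * ((D1 + D2) * (k%:R / N%:R)).
  elim: k => [|k IH] kN; first by rewrite /z mul0r scale0r addr0 subrr normr0 !mulr0.
  rewrite (le_trans (ler_distD (moll r (z k)) _ _))//.
  have izk : inner dl (z k).
    apply: inner_convex => //; rewrite divr_ge0//= ler_pdivrMr// mul1r ler_nat.
    exact: ltnW.
  have [e1 e2] := zz k.
  have d1 : `|(z k).1 - (z k.+1).1| = D1 / N%:R by rewrite e1 normrM (ger0_norm VN).
  have d2 : `|(z k).2 - (z k.+1).2| = D2 / N%:R by rewrite e2 normrM (ger0_norm VN).
  have := @moll_step r dl (z k) (z k.+1) r0 rdl izk.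
  rewrite d1 d2 !ler_pdivrMr// => H.
  have h1 : D1 <= r * N%:R by rewrite mulrC (le_trans _ NE)// lerDl.
  have h2 : D2 <= r * N%:R by rewrite mulrC (le_trans _ NE)// lerDr.
  have {}H := H h1 h2.
  apply: le_trans (lerD (IH (ltnW kN)) H) _; rewrite -[k.+1]addn1 natrD.
  by rewrite le_eqVlt; apply/orP; left; apply/eqP; field; rewrite gt_eqF.
have := main N (leqnn _); rewrite /z divff ?gt_eqF// scale1r mulr1.
by rewrite (_ : x + (x' - x) = x')// addrC subrK.
Qed.

End mollification.

(** * The Lipschitz representative *)

(** The sum of all H k is integrable, hence finite almost everywhere, and the
    terms of a convergent series tend to zero. The dyadic bounds are those that
    a choice of a subsequence provides. *)
Lemma summable_integral_ae_cvg0 d (T : measurableType d) (R : realType)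
    (mu : {measure set T -> \bar R}) (H : nat -> T -> \bar R) (c : R) :
  (forall k, measurable_fun setT (H k)) -> (forall k x, (0 <= H k x)%E) ->
  0 <= c ->
  (forall k, (\int[mu]_x H k x <= (c / (2 ^ k.+1)%:R)%:E)%E) ->
  {ae mu, forall x, forall e : R, 0 < e -> exists N, forall k, (N <= k)%N -> (H k x <= e%:E)%E}.
Proof.
move=> mH H0 c0 Hc.
have mS : measurable_fun setT (fun x => (\sum_(k <oo) H k x)%E).
  by apply: ge0_emeasurable_sum => // k x _ _; exact: H0.
have S0 x : (0 <= \sum_(k <oo) H k x)%E by apply: nneseries_ge0.
have iS : mu.-integrable setT (fun x => (\sum_(k <oo) H k x)%E).
  apply/integrableP; split => //.
  under eq_integral do rewrite gee0_abs//.
  rewrite integral_nneseries//.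
  apply: (@le_lt_trans _ _ c%:E); last exact: ltry.
  apply: le_trans (epsilon_trick0 xpredT c0).
  by apply: lee_nneseries => [k _ _|k _]; [exact: integral_ge0|exact: Hc].
have := integrable_ae measurableT iS; apply: filterS => x /(_ I) Sfin e e0.
have := @nneseries_tail_cvg R (fun k => H k x) xpredT.
move=> /(_ _ (fun k _ => H0 k x)); rewrite -ge0_fin_numE// => /(_ Sfin).
move=> /fine_cvgP[_] /cvgrPdist_le /(_ _ e0).
move=> [N _ HN]; exists N => k Nk; have := HN k Nk.
rewrite /= sub0r normrN.
have Hk : (H k x <= \sum_(k <= i <oo) H i x)%E.
  by apply: le_trans (nneseries_lim_ge k.+1 _) => //; rewrite big_nat1.
have tfin : (\sum_(k <= i <oo) H i x)%E \is a fin_num.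
  rewrite ge0_fin_numE; last by apply: nneseries_ge0.
  apply: le_lt_trans (_ : (\sum_(i <oo) H i x < +oo)%E); last by rewrite -ge0_fin_numE.
  by rewrite (nneseries_split 0%N k)// add0n leeDr// sume_ge0.
move=> he; apply: (le_trans Hk); rewrite -(fineK tfin) lee_fin.
exact: le_trans (ler_norm _) he.
Qed.

Section mcshane.
Context {R : realType}.
Implicit Types x z : R * R.
(** The distance in which two moves along the axes add up. *)
Definition dist1 x z : R := `|x.1 - z.1| + `|x.2 - z.2|.

Lemma dist1_ge0 x z : 0 <= dist1 x z. Proof. exact: addr_ge0. Qed.
Lemma dist1xx x : dist1 x x = 0. Proof. by rewrite /dist1 !subrr !normr0 addr0. Qed.
Lemma dist1C x z : dist1 x z = dist1 z x.
Proof. by rewrite /dist1 distrC [X in _ + X]distrC. Qed.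
Lemma dist1_triangle y x z : dist1 x z <= dist1 x y + dist1 y z.
Proof. by rewrite /dist1 addrACA lerD// ler_distD. Qed.

(** The infimal convolution h z = inf over x in S of f x + L dist1 x z. *)
Lemma mcshane (S : set (R * R)) (f : R * R -> R) (L : R) : 0 <= L ->
  (forall x x', S x -> S x' -> `|f x - f x'| <= L * dist1 x x') ->
  exists2 h : R * R -> R, forall x, S x -> h x = f x &
    forall z z', `|h z - h z'| <= L * dist1 z z'.
Proof.
move=> L0 fL; have [->|/set0P[x0 Sx0]] := eqVneq S set0.
  by exists (fun=> 0) => // z z'; rewrite subrr normr0 mulr_ge0// dist1_ge0.
pose A z := [set f x + L * dist1 x z | x in S].
have lbA z : lbound (A z) (f x0 - L * dist1 x0 z).
  move=> _ [x Sx <-]; have := fL _ _ Sx0 Sx; rewrite ler_norml => /andP[_ h].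
  have := @dist1_triangle z x0 x; rewrite (dist1C z) => /(ler_wpM2l L0).
  move: h; rewrite (mulrDr L (dist1 x0 z)); set a := L * dist1 x0 z; set b := L * dist1 x z.
  by set c := L * _ => h h'; lra.
have hA z : has_inf (A z).
  split; first by exists (f x0 + L * dist1 x0 z), x0.
  by exists (f x0 - L * dist1 x0 z).
have half z z' : inf (A z) <= inf (A z') + L * dist1 z z'.
  rewrite -lerBlDr; apply: lb_le_inf; first exact: (hA z').1.
  move=> _ [x Sx <-]; rewrite lerBlDr.
  apply: (@le_trans _ _ (f x + L * dist1 x z)).
    by apply: ge_inf; [exact: (hA z).2|exists x].
  rewrite -addrA lerD2l -mulrDr ler_wpM2l// (dist1C z).
  exact: dist1_triangle.
exists (fun z => inf (A z)).
  move=> x Sx; apply/eqP; rewrite eq_le; apply/andP; split.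
    apply: ge_inf; first exact: (hA x).2.
    by exists x => //; rewrite dist1xx mulr0 addr0.
  apply: lb_le_inf; first exact: (hA x).1.
  move=> _ [y Sy <-]; have := fL _ _ Sx Sy; rewrite ler_norml => /andP[_ h].
  by rewrite (dist1C y); lra.
move=> z z'; rewrite ler_norml; have := half z z'; have := half z' z.
rewrite (dist1C z' z) => ? ?; apply/andP; split; lra.
Qed.

End mcshane.

Section approximation.
Context {R : realType}.
Local Notation mpt := (measurableTypeR R * measurableTypeR R)%type.

(** Tonelli's theorem, the kernel having mass one in its first argument. *)
Lemma integral_convolution (h : R * R -> R) (r : R) : 0 < r ->
  measurable_fun [set: mpt] (h : mpt -> R) -> (forall y, 0 <= h y) ->
  (\int[leb2]_x \int[leb2]_y (h y * kern r x y)%:E = \int[leb2]_y (h y)%:E)%E.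
Proof.
move=> r0 mh h0.
have mk : measurable_fun setT (fun z : mpt * mpt => (h z.2 * kern r z.1 z.2)%:E).
  apply/measurable_EFinP; apply: measurable_funM; last exact: measurable_kern.
  by apply: (@measurableT_comp _ _ _ _ _ _ (h : mpt -> R)).
have := @fubini_tonelli _ _ mpt mpt R leb2_sigma_finite_measure leb2_sigma_finite_measure _ mk.
rewrite leb2E => -> /=; last by move=> z; rewrite lee_fin mulr_ge0// kern_ge0.
apply: eq_integral => y _.
under eq_integral do rewrite EFinM.
rewrite ge0_integralZl//=.
- by have := integral_kernl y r0; rewrite leb2E /= => ->; rewrite mule1.
- apply/measurable_EFinP.
  apply: (@measurableT_comp _ _ _ _ _ _ (fun z : mpt * mpt => kern r z.1 z.2) _ (fun x : mpt => (x, y))).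
    exact: measurable_kern.
  exact: measurable_pair2.
- by move=> x _; rewrite lee_fin kern_ge0.
- by rewrite lee_fin.
Qed.

Lemma measurable_convolution (h : R * R -> R) (r : R) : 0 < r ->
  measurable_fun [set: mpt] (h : mpt -> R) -> (forall y, 0 <= h y) ->
  measurable_fun [set: mpt] (fun x : mpt => (\int[leb2]_y (h y * kern r x y)%:E)%E).
Proof.
move=> r0 mh h0.
have mk : measurable_fun setT (fun z : mpt * mpt => (h z.2 * kern r z.1 z.2)%:E).
  apply/measurable_EFinP; apply: measurable_funM; last exact: measurable_kern.
  by apply: (@measurableT_comp _ _ _ _ _ _ (h : mpt -> R)).
have := @measurable_fun_fubini_tonelli_F _ _ mpt mpt R leb2_sigma_finite_measure _ mk.
rewrite leb2E.
by apply; move=> z; rewrite lee_fin mulr_ge0// kern_ge0.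
Qed.

Variables (f : R * R -> R) (M0 : R).
Hypothesis mf : measurable_fun [set: mpt] (f : mpt -> R).
Hypothesis fM0 : forall x, `|f x| <= M0.

(** Compare f with the continuous function psi: mollification changes f - psi
    by at most the mollification of |f - psi|, and psi by at most its oscillation
    at the scale of the kernel. *)
Lemma moll_approx (psi : R * R -> R) (K r eta : R) x : 0 < r ->
  measurable_fun [set: mpt] (psi : mpt -> R) -> (forall y, `|psi y| <= K) ->
  (forall y, box x.1 (x.1 + r) x.2 (x.2 + r) y -> `|psi x - psi y| <= eta) ->
  (`|f x - moll f r x|%:E <= (`|f x - psi x| + eta)%:E +
    \int[leb2]_y (`|f y - psi y| * kern r x y)%:E)%E.
Proof.
move=> r0 mpsi psiK osc.
have M00 : 0 <= M0 by rewrite (le_trans _ (fM0 x)).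
have K0 : 0 <= K by rewrite (le_trans _ (psiK x)).
have mfp : measurable_fun [set: mpt] (fun y : mpt => f y - psi y).
  exact: measurable_funB.
have I1 : (@leb2 R).-integrable setT (fun y => (`|f y - psi y| * kern r x y)%:E).
  apply: (@integrable_kern _ _ (M0 + K)) => //; first exact: measurableT_comp.
  by move=> y; rewrite normr_id (le_trans (ler_normB _ _))// lerD.
have I2 : (@leb2 R).-integrable setT (fun y => (f y * kern r x y)%:E).
  exact: (@integrable_kern _ _ M0).
have I3 : (@leb2 R).-integrable setT (fun y => (psi x * kern r x y)%:E).
  by apply: (@integrable_kern _ (fun=> psi x) K).
have I4 : (@leb2 R).-integrable setT (fun y => ((psi x - f y) * kern r x y)%:E).
  apply: (@integrable_kern _ _ (K + M0)) => //; first exact: measurable_funB.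
  by move=> y; rewrite (le_trans (ler_normB _ _))// lerD.
have I5 : (@leb2 R).-integrable setT (fun y => (eta * kern r x y)%:E).
  by apply: (@integrable_kern _ (fun=> eta) `|eta|).
have psiE c : \int[leb2]_y (c * kern r x y) = c.
  have kint : (@leb2 R).-integrable setT (EFin \o kern r x).
    have := @integrable_kern _ (fun=> 1) 1 r x r0.
    rewrite (_ : (fun y => (1 * _)%:E) = EFin \o kern r x); last first.
      by apply/funext => y /=; rewrite mul1r.
    by apply => // y; rewrite normr1.
  by rewrite RintegralZl//; rewrite /Rintegral integral_kern// mulr1.
rewrite -[X in (_ <= _ + X)%E]fineK; last exact: integrable_fin_num.
rewrite -EFinD lee_fin -addrA.
have -> : f x - moll f r x = (f x - psi x) + \int[leb2]_y ((psi x - f y) * kern r x y).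
  under eq_Rintegral do rewrite mulrBl.
  by rewrite RintegralB// psiE /moll addrA subrK.
rewrite (le_trans (ler_normD _ _))// lerD2l.
rewrite (le_trans (le_normr_Rintegral _ _))//.
rewrite -[X in X + _](psiE eta) -RintegralD//.
apply: le_Rintegral => //.
- have := integrable_norm I4; apply: eq_integrable => //.
- by have := integrableD measurableT I5 I1; apply: eq_integrable.
move=> y _; rewrite normrM (ger0_norm (kern_ge0 _ _ r0)) -mulrDl.
have [/osc h|nb] := pselect (box x.1 (x.1 + r) x.2 (x.2 + r) y); last first.
  by rewrite kern_eq0// !mulr0.
rewrite ler_wpM2r ?kern_ge0// -(subrK (psi y) (psi x)) -addrA.
by rewrite (le_trans (ler_normD _ _))// lerD// distrC.
Qed.

(** Uniform continuity on the compact support, carried over to the pairs of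
    points of which only one lies in the support. *)
Lemma test_fun_uniform (Om : set (R * R)) psi : test_fun Om psi ->
  forall e, 0 < e -> exists2 dl : R, 0 < dl & forall x y : R * R, ball x dl y ->
   `|psi x - psi y| <= e.
Proof.
move=> [ck [K [cK _ psi0]]] e e0; have [cpsi _] := ck 0%N.
have : \forall dl \near 0^'+, K `<=` [set x | forall y, ball x dl y -> `|psi x - psi y| <= e].
  apply: (iffLR (compact_near_coveringP K) cK) => x Kx.
  have /cvgrPdist_lt/(_ _ (_ : 0 < e / 2)) := cpsi x.
  rewrite divr_gt0// => /(_ isT) /nbhs_ballP[dl /= dl0 Hd].
  exists (ball x (dl / 2), [set d | d < dl / 2]).
    split => /=; first by apply: nbhsx_ballx; rewrite divr_gt0.
    by apply: nbhs_right_lt; rewrite divr_gt0.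
  move=> [x' d] [/= xx' ddl] y x'y.
  have xx'2 : ball x dl x'.
    by apply: le_ball xx'; rewrite ler_pdivrMr// ler_pMr// ler1n.
  have xy : ball x dl y.
    by apply: (ball_split xx'); apply: le_ball x'y; exact: ltW.
  rewrite (le_trans (ler_distD (psi x) _ _))// (splitr e) lerD// ltW//.
    by rewrite distrC; exact: Hd.
  exact: Hd.
move=> [dl /= dl0 /(_ (dl / 2)) HK].
have d20 : 0 < dl / 2 by rewrite divr_gt0.
have {}HK : K `<=` [set x | forall y, ball x (dl / 2) y -> `|psi x - psi y| <= e].
  apply: HK => //=; rewrite sub0r normrN gtr0_norm// ltr_pdivrMr// ltr_pMr// ltr1n//.
exists (dl / 2) => // x y xy.
have [Kx|nKx] := pselect (K x); first exact: HK.
have [Ky|nKy] := pselect (K y).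
  by rewrite distrC; apply: HK => //; exact: ball_sym.
by rewrite !psi0// subrr normr0 ltW.
Qed.

End approximation.

Section lipschitz_representative.
Context {R : realType}.
Local Notation mpt := (measurableTypeR R * measurableTypeR R)%type.
Variables (Om : set (R * R)) (f phi g0 g1 : R * R -> R) (M0 M : R).
Hypothesis oOm : open Om.
Hypothesis convOm : convex_set Om.
Hypothesis mf : measurable_fun [set: mpt] (f : mpt -> R).
Hypothesis fM0 : forall x, `|f x| <= M0.
Hypothesis f0 : forall x, ~ Om x -> f x = 0.
Hypothesis fphi : aeq Om phi f.
Hypothesis M_ge0 : 0 <= M.
Hypotheses (wp0 : weak_partial Om 0 phi g0) (wp1 : weak_partial Om 1 phi g1).
Hypotheses (g0M : {ae leb2, forall y, Om y -> `|g0 y| <= M})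
           (g1M : {ae leb2, forall y, Om y -> `|g1 y| <= M}).
Hypothesis density : forall e : R, 0 < e -> exists2 psi, test_fun Om psi &
  (\int[leb2]_y (`|f y - psi y|)%:E <= e%:E)%E.

Lemma test_fun_bounded (psi : R * R -> R) : test_fun Om psi ->
  exists K, forall y, `|psi y| <= K.
Proof.
move=> [ck [K [cK _ psi0]]]; have [cpsi _] := ck 0%N.
have [KE|K0] := eqVneq K set0.
  by exists 0 => y; rewrite psi0 ?normr0// KE.
have /set0P K0' := K0.
have cn : {within K, continuous (fun y => `|psi y|)}.
  by apply: continuous_subspaceT => y; apply: cvg_norm; exact: cpsi.
have [c _ Hc] := compact_EVT_max K0' cK cn.
exists `|psi c| => y; have [Ky|nKy] := pselect (K y).
  by apply: Hc; rewrite inE.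
by rewrite psi0// normr0.
Qed.

Lemma test_fun_measurable (psi : R * R -> R) : test_fun Om psi ->
  measurable_fun [set: mpt] (psi : mpt -> R).
Proof.
by move=> [ck _]; apply: continuous_measurable_plane; have [] := ck 0%N.
Qed.

Lemma inner_ex x : Om x -> exists2 dl : R, 0 < dl & inner Om dl x.
Proof.
move=> Ox; have /nbhs_ballP[e /= e0 eO] : nbhs x Om by exact: open_nbhs_nbhs.
exists (e / 2); first by rewrite divr_gt0.
have e2 : e / 2 < e by rewrite ltr_pdivrMr// ltr_pMr// ltr1n.
move=> y y1 y2; apply: eO; split; rewrite /ball/= distrC.
  exact: le_lt_trans e2.
exact: le_lt_trans e2.
Qed.

Lemma inner_le (d1 d2 : R) x : d1 <= d2 -> inner Om d2 x -> inner Om d1 x.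
Proof. by move=> d12 i2 y y1 y2; apply: i2; exact: le_trans d12. Qed.

(** The mollified functions share a Lipschitz constant, so it suffices that a
    sequence of them converges almost everywhere. By density f is within 2^(-k)
    in L^1 of a test function, and the scale is taken below the distance at which
    that test function oscillates by 1/k; then [moll_approx] bounds the distance
    of f to its mollification by 1/k plus a function whose integral is summable
    in k. *)
Lemma ae_lipschitz : exists2 L : R, 0 <= L &
  exists2 G : set (R * R), {ae leb2, forall x, G x} &
  forall x x', Om x -> G x -> Om x' -> G x' -> `|f x - f x'| <= L * dist1 x x'.
Proof.
have [B B0 HB] := @sbump_bounded R.
exists (2 * M * B ^+ 2).
  by rewrite expr2 !mulr_ge0// ltW.
(* The factor 1 / 2 is there because the function H below contains f minus the
   test function twice, once directly and once mollified. *)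
have /choice[pr Hpr] : forall k : nat, exists pr : (R * R -> R) * R,
  [/\ test_fun Om pr.1, (\int[leb2]_y (`|f y - pr.1 y|)%:E <= (1 / 2 / (2 ^ k.+1)%:R)%:E)%E,
    0 < pr.2 <= k.+1%:R^-1 &
    forall x y, box x.1 (x.1 + pr.2) x.2 (x.2 + pr.2) y -> `|pr.1 x - pr.1 y| <= k.+1%:R^-1].
  move=> k.
  have [|psi tpsi psie] := @density (1 / 2 / (2 ^ k.+1)%:R).
    by rewrite !divr_gt0// ltr0n expn_gt0.
  have k0 : 0 < k.+1%:R^-1 :> R by rewrite invr_gt0.
  have [dl dl0 Hdl] := test_fun_uniform tpsi k0.
  exists (psi, Num.min (k.+1%:R^-1) (dl / 2)); split => //=.
    by rewrite lt_min k0 divr_gt0//= ge_min lexx.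
  move=> x y /box_mem /andP[/andP[y1 y2] /andP[y3 y4]]; apply: Hdl.
  have r2 : Num.min (k.+1%:R^-1) (dl / 2) < dl.
    by rewrite gt_min orbC ltr_pdivrMr// ltr_pMr// ltr1n.
  move: r2 y2 y4; set r := Num.min _ _ => r2 y2 y4.
  by split; rewrite /ball/= ler0_norm; lra.
pose h k y := `|f y - (pr k).1 y|.
pose H k (x : mpt) := ((h k x)%:E + \int[leb2]_y (h k y * kern (pr k).2 x y)%:E)%E.
have mh k : measurable_fun setT (h k : mpt -> R).
  apply: measurableT_comp => //; apply: measurable_funB => //.
  by have [/test_fun_measurable] := Hpr k.
have r0 k : 0 < (pr k).2 by have [_ _ /andP[]] := Hpr k.
have c0 k (x : R * R) : (0 <= \int[leb2]_y (h k y * kern (pr k).2 x y)%:E)%E.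
  by apply: integral_ge0 => y _; rewrite lee_fin mulr_ge0 ?kern_ge0// /h.
have mc k := measurable_convolution (r0 k) (mh k) (fun y => normr_ge0 _).
have := @summable_integral_ae_cvg0 _ mpt R leb2 H 1.
move=> /(_ _ _ ler01 _) HH.
pose G := [set x | forall e : R, 0 < e -> exists N, forall k, (N <= k)%N -> (H k x <= e%:E)%E].
exists G.
  apply: HH => [k|k x|k].
  - by apply: emeasurable_funD; [exact/measurable_EFinP|exact: mc].
  - by rewrite /H adde_ge0// lee_fin /h.
  - rewrite /H (@ge0_integralD _ _ _ leb2 setT measurableT (fun x => (h k x)%:E) (fun x => \int[leb2]_y (h k y * kern (pr k).2 x y)%:E)%E); first last.
    + exact: mc.
    + by move=> x _; exact: c0.
    + exact/measurable_EFinP.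
    + by move=> x _; rewrite lee_fin /h.
    rewrite integral_convolution//; last by move=> y; exact: normr_ge0.
    have [_ le2 _ _] := Hpr k; rewrite (le_trans (leeD le2 le2))// -EFinD lee_fin.
    by rewrite -mulrDl -splitr.
move=> x x' Ox Gx Ox' Gx'; apply/ler_addgt0Pr => e e0.
have e40 : 0 < e / 4 by rewrite divr_gt0.
have [d1 d10 i1] := inner_ex Ox; have [d2 d20 i2] := inner_ex Ox'.
pose dl := Num.min d1 d2.
have dl0 : 0 < dl by rewrite lt_min d10.
have ix : inner Om dl x by apply: inner_le i1; rewrite ge_min lexx.
have ix' : inner Om dl x' by apply: inner_le i2; rewrite ge_min lexx orbT.
have [N1 HN1] := Gx _ e40; have [N2 HN2] := Gx' _ e40.
have dl20 : 0 < Num.min (e / 4) (dl / 2) by rewrite lt_min e40 divr_gt0.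
have [N3 _ HN3] := near_infty_natSinv_lt (PosNum dl20).
pose k := maxn N1 (maxn N2 N3).
have k1 : (N1 <= k)%N by rewrite leq_maxl.
have k2 : (N2 <= k)%N by rewrite /k maxnCA leq_maxl.
have k3 : (N3 <= k)%N by rewrite /k maxnA leq_maxr.
have := HN3 k k3; rewrite /= lt_min => /andP[ke kdl].
have [tpsi _ /andP[_ rk] osc] := Hpr k.
have [K HK] := test_fun_bounded tpsi.
have main z : (H k z <= (e / 4)%:E)%E -> `|f z - moll f (pr k).2 z| <= e / 2.
  move=> Hz.
  have := moll_approx mf fM0 (r0 k) (test_fun_measurable tpsi) HK (osc z).
  rewrite EFinD addeAC -/(h k z) -/(H k z) => /le_trans.
  move=> /(_ _ (leeD Hz (lexx _))); rewrite -EFinD lee_fin => /le_trans; apply.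
  by move: ke; set t := _^-1 => ke; lra.
have m1 := main x (HN1 k k1); have m2 := main x' (HN2 k k2).
have lip : `|moll f (pr k).2 x - moll f (pr k).2 x'| <= 2 * M * B ^+ 2 * dist1 x x'.
  apply: (@moll_lip R Om f M0 mf fM0 f0 phi M fphi M_ge0 g0 g1 B wp0 wp1 g0M g1M HB convOm _ dl) => //.
  by rewrite mulrC -ler_pdivlMr// (le_trans rk)// ltW.
rewrite distrC in m2.
apply: le_trans (ler_distD (moll f (pr k).2 x) _ _) _.
apply: le_trans (lerD (lexx _) (ler_distD (moll f (pr k).2 x') _ _)) _.
by apply: le_trans (lerD m1 (lerD lip m2)) _; rewrite addrCA -splitr.
Qed.

Lemma lipschitz_representative : exists2 L : R, 0 <= L &
  exists2 h : R * R -> R, aeq Om phi h &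
    forall x x', `|h x - h x'| <= L * dist1 x x'.
Proof.
have [L L0 [G aeG HG]] := ae_lipschitz; exists L => //.
have [h hf hL] := @mcshane R (Om `&` G) f L L0
  (fun x x' Sx Sx' => HG x x' Sx.1 Sx.2 Sx'.1 Sx'.2).
exists h => //; apply: filterS2 fphi aeG => x fp Gx Ox.
by rewrite fp// hf.
Qed.

End lipschitz_representative.

(** * Lebesgue norms on a domain *)

Section lebesgue_norms.
Context {R : realType}.
Variable Om : set (R * R).
Hypothesis mOm : measurable (Om : set (measurableTypeR R * measurableTypeR R)).
Local Notation mpt := (measurableTypeR R * measurableTypeR R)%type.
Implicit Types f g : R * R -> R.

(** The norm of L^infinity is by definition zero on a space of measure zero, so
    its reading as an essential supremum rests on this. *)
Lemma leb2_setT_gt0 : (0 < @leb2 R setT)%E.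
Proof.
apply: (@lt_le_trans _ _ (leb2 (box 0 1 0 1 : set (R * R)))).
  by rewrite leb2_box// subr0 mulr1 lte01.
by apply: le_measure; rewrite ?inE//; exact: measurable_box.
Qed.

Lemma poweR2 (x : \bar R) : (0 <= x)%E -> (x `^ 2 = x ^+ 2)%E.
Proof.
case: x => [r||]//; first by rewrite lee_fin => r0; rewrite poweR_EFin powR_mulrn// EFin_expe.
by move=> _; rewrite poweRyr//= expe2 mulyy.
Qed.

Lemma LpN2_sqr f : (LpN Om 2%:E f ^+ 2 = \int[leb2]_(x in Om) (f x ^+ 2)%:E)%E.
Proof.
rewrite /LpN -poweR2 ?Lnorm_ge0// poweR_Lnorm//.
rewrite [RHS]integral_mkcond; apply: eq_integral => x _.
rewrite patchE indicE; case: ifPn => Ox.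
  by rewrite mul1r /= powR_mulrn// real_normK// num_real.
by rewrite mul0r /= normr0 powR0.
Qed.

Lemma LpN2_leP f (c : R) : 0 <= c ->
  (LpN Om 2%:E f <= c%:E)%E <-> (\int[leb2]_(x in Om) (f x ^+ 2)%:E <= (c ^+ 2)%:E)%E.
Proof.
by move=> c0; rewrite -LpN2_sqr EFin_expe lee_sqr// ?lee_fin//; exact: Lnorm_ge0.
Qed.

(** The measurability of g enters through a Borel function equal to it almost
    everywhere: the constant c has to be moved out of the integral. *)
Lemma LpN2_scale f g (c K : R) : 0 <= c -> 0 <= K -> lmeasurable Om g ->
  (LpN Om 2%:E g <= K%:E)%E ->
  {ae leb2, forall x, Om x -> `|f x| <= c * `|g x|} ->
  (LpN Om 2%:E f <= (c * K)%:E)%E.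
Proof.
move=> c0 K0 [g' mg gg'] gK fg.
have {}gK : (\int[leb2]_(x in Om) (g' x ^+ 2)%:E <= (K ^+ 2)%:E)%E.
  move/(LpN2_leP _ K0) : gK; apply: le_trans; apply: ae_le_integral_ge0.
  - by move=> x _; rewrite lee_fin sqr_ge0.
  - by move=> x _; rewrite lee_fin sqr_ge0.
  by apply: filterS gg' => x gg' Ox; rewrite gg'.
apply/LpN2_leP; first exact: mulr_ge0.
apply: (@le_trans _ _ (\int[leb2]_(x in Om) ((c ^+ 2)%:E * (g' x ^+ 2)%:E))%E).
  apply: ae_le_integral_ge0.
  - by move=> x _; rewrite lee_fin sqr_ge0.
  - by move=> x _; rewrite -EFinM lee_fin mulr_ge0 ?sqr_ge0.
  apply: filterS2 fg gg' => x fg gg' Ox; rewrite lee_fin -[leLHS]real_normK ?num_real//.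
  rewrite -gg'// -exprMn -[leRHS]real_normK ?num_real// lerXn2r ?nnegrE//.
  by rewrite normrM (ger0_norm c0) fg.
rewrite ge0_integralZl//=; last 3 first.
- by apply/measurable_EFinP; apply: measurable_funTS; exact: measurable_funX.
- by move=> x _; rewrite lee_fin sqr_ge0.
- by rewrite lee_fin sqr_ge0.
rewrite exprMn (EFinM (c ^+ 2)); apply: lee_wpmul2l => //.
by rewrite lee_fin sqr_ge0.
Qed.

(** The triangle inequality up to a factor, from (s + t)^2 <= 2 s^2 + 2 t^2. *)
Lemma LpN2_add f g1 g2 (K1 K2 : R) : 0 <= K1 -> 0 <= K2 ->
  lmeasurable Om g1 -> lmeasurable Om g2 ->
  (LpN Om 2%:E g1 <= K1%:E)%E -> (LpN Om 2%:E g2 <= K2%:E)%E ->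
  {ae leb2, forall x, Om x -> `|f x| <= `|g1 x| + `|g2 x|} ->
  (LpN Om 2%:E f <= (2 * (K1 + K2))%:E)%E.
Proof.
move=> K10 K20 [h1 mh1 gh1] [h2 mh2 gh2] gK1 gK2 fg.
have ext g h K : 0 <= K -> aeq Om g h -> (LpN Om 2%:E g <= K%:E)%E ->
  (\int[leb2]_(x in Om) (h x ^+ 2)%:E <= (K ^+ 2)%:E)%E.
  move=> K0 gh gK; move/(LpN2_leP _ K0) : gK; apply: le_trans; apply: ae_le_integral_ge0.
  - by move=> x _; rewrite lee_fin sqr_ge0.
  - by move=> x _; rewrite lee_fin sqr_ge0.
  by apply: filterS gh => x gh Ox; rewrite gh.
have {}gK1 := ext _ _ _ K10 gh1 gK1; have {}gK2 := ext _ _ _ K20 gh2 gK2.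
apply/LpN2_leP; first by rewrite mulr_ge0// addr_ge0.
have mh (h : mpt -> R) : measurable_fun setT h -> measurable_fun Om (fun x => (2 * h x ^+ 2)%:E).
  move=> mh; apply/measurable_EFinP; apply: measurable_funTS.
  by apply: measurable_funM => //; exact: measurable_funX.
apply: (@le_trans _ _ (\int[leb2]_(x in Om) ((2 * h1 x ^+ 2)%:E + (2 * h2 x ^+ 2)%:E))%E).
  apply: ae_le_integral_ge0.
  - by move=> x _; rewrite lee_fin sqr_ge0.
  - move=> x _; rewrite -EFinD lee_fin; apply: addr_ge0; apply: mulr_ge0 => //;
    exact: sqr_ge0.
  apply: filterS3 fg gh1 gh2 => x fg e1 e2 Ox.
  rewrite -EFinD lee_fin -[leLHS]real_normK ?num_real//.
  rewrite -e1// -e2// -[X in 2 * X + _]real_normK ?num_real// -[X in _ + 2 * X]real_normK ?num_real//.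
  apply: (@le_trans _ _ ((`|g1 x| + `|g2 x|) ^+ 2)).
    by rewrite lerXn2r ?nnegrE ?addr_ge0// fg.
  have := sqr_ge0 (`|g1 x| - `|g2 x|); nra.
rewrite ge0_integralD//; last 4 first.
- by move=> x _; rewrite lee_fin mulr_ge0 ?sqr_ge0.
- exact: mh.
- by move=> x _; rewrite lee_fin mulr_ge0 ?sqr_ge0.
- exact: mh.
have Z (h : mpt -> R) K : measurable_fun setT h ->
  (\int[leb2]_(x in Om) (h x ^+ 2)%:E <= (K ^+ 2)%:E)%E ->
  (\int[leb2]_(x in Om) (2 * h x ^+ 2)%:E <= (2 * K ^+ 2)%:E)%E.
  move=> mh' hK; under eq_integral do rewrite EFinM.
  rewrite ge0_integralZl//=.
  - by rewrite EFinM; apply: lee_wpmul2l => //; rewrite lee_fin.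
  - by apply/measurable_EFinP; apply: measurable_funTS; exact: measurable_funX.
  - by move=> x _; rewrite lee_fin sqr_ge0.
apply: le_trans (leeD (Z _ _ mh1 gK1) (Z _ _ mh2 gK2)) _.
by rewrite -EFinD lee_fin; nra.
Qed.

Lemma LpN2_bounded f (c : R) : 0 <= c -> (leb2 Om < +oo)%E ->
  {ae leb2, forall x, Om x -> `|f x| <= c} ->
  (LpN Om 2%:E f <= (c * Num.sqrt (fine (leb2 Om)))%:E)%E.
Proof.
move=> c0 Ofin fc; apply/LpN2_leP; first by rewrite mulr_ge0// sqrtr_ge0.
apply: (@le_trans _ _ (\int[leb2]_(x in Om) (c ^+ 2)%:E)%E).
  apply: ae_le_integral_ge0.
  - by move=> x _; rewrite lee_fin sqr_ge0.
  - by move=> x _; rewrite lee_fin sqr_ge0.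
  apply: filterS fc => x /[apply] fc; rewrite lee_fin -[leLHS]real_normK ?num_real//.
  by rewrite lerXn2r ?nnegrE.
rewrite integral_cst// exprMn sqr_sqrtr ?fine_ge0// (EFinM (c ^+ 2)) fineK//.
by rewrite ge0_fin_numE.
Qed.

Lemma LpN_infty_ae f (c : R) : (LpN Om +oo%E f <= c%:E)%E ->
  {ae leb2, forall x, Om x -> `|f x| <= c}.
Proof.
rewrite /LpN unlock leb2_setT_gt0 => /ess_supP; apply: filterS => x /= H Ox.
by move: H; rewrite indicE mem_set// mul1r lee_fin.
Qed.

Lemma LpN_infty_le f (c : R) : 0 <= c -> {ae leb2, forall x, Om x -> `|f x| <= c} ->
  (LpN Om +oo%E f <= c%:E)%E.
Proof.
move=> c0 fc; rewrite /LpN unlock leb2_setT_gt0; apply/ess_supP.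
apply: filterS fc => x fc /=; rewrite indicE lee_fin.
have [/set_mem Ox|] := boolP (x \in Om); first by rewrite mul1r fc.
by rewrite mul0r normr0.
Qed.

Lemma memLp_infty_bounded f : memLp Om +oo%E f ->
  exists2 M, 0 <= M & {ae leb2, forall x, Om x -> `|f x| <= M}.
Proof.
move=> [_]; have : (0 <= LpN Om +oo%E f)%E by exact: Lnorm_ge0.
move E : (LpN Om +oo%E f) => [c||]//= c0 _; exists c; first by rewrite -lee_fin.
by apply: LpN_infty_ae; rewrite E.
Qed.

Lemma bounded_memLp_infty f (c : R) : 0 <= c -> lmeasurable Om f ->
  {ae leb2, forall x, Om x -> `|f x| <= c} -> memLp Om +oo%E f.
Proof.
move=> c0 mf fc; split => //; apply: le_lt_trans (LpN_infty_le c0 fc) _.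
exact: ltry.
Qed.

(** The Borel representative is truncated at the bound and set to zero outside
    the domain, so that the properties hold at every point. *)
Lemma lmeasurable_bounded_borel f (M : R) : 0 <= M -> lmeasurable Om f ->
  {ae leb2, forall x, Om x -> `|f x| <= M} ->
  exists g : R * R -> R, [/\ measurable_fun [set: mpt] (g : mpt -> R),
    forall x, `|g x| <= M, forall x, ~ Om x -> g x = 0 & aeq Om f g].
Proof.
move=> M0 [g mg fg] fM.
exists (fun x => \1_Om x * Num.max (- M) (Num.min M (g x))); split.
- apply: measurable_funM; first exact: measurable_indic.
  by apply: measurable_maxr => //; exact: measurable_minr.
- move=> x; rewrite indicE; case: (x \in Om); last by rewrite mul0r normr0.
  rewrite mul1r ler_norml le_max lexx/= ge_max ge_min lexx/= andbT; lra.
- by move=> x Ox; rewrite indicE memNset// mul0r.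
- apply: filterS2 fg fM => x fg fM Ox; rewrite indicE mem_set// mul1r -fg//.
  have := fM Ox; rewrite ler_norml => /andP[h1 h2].
  by rewrite (min_idPr h2) (max_idPr h1).
Qed.

Lemma eq_LpN (p : R) f g : aeq Om f g -> LpN Om p%:E f = LpN Om p%:E g.
Proof.
move=> fg; rewrite /LpN unlock; congr (_ `^ _)%E; apply: ae_eq_integral_gen.
apply: filterS fg => x fg _; rewrite !indicE.
by have [/set_mem Ox|] := boolP (x \in Om); rewrite ?mul0r// fg.
Qed.

(** Hoelder's inequality with the indicator of the domain. *)
Lemma integral_norm_le_LpN (p : R) : 1 < p -> (leb2 Om < +oo)%E ->
  exists2 K : R, 0 < K & forall f, measurable_fun [set: mpt] (f : mpt -> R) ->
    (\int[leb2]_(x in Om) (`|f x|)%:E <= LpN Om p%:E f * K%:E)%E.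
Proof.
move=> p1 Ofin; pose q := (1 - p^-1)^-1.
have p0 : 0 < p by apply: lt_trans p1.
have q0 : 0 < q by rewrite invr_gt0 subr_gt0 invf_lt1.
have Nfin : ('N[leb2]_q%:E[EFin \o (\1_Om : mpt -> R)] < +oo)%E.
  rewrite -Lnorm_abse unlock; apply: poweR_lty.
  rewrite (_ : (\int[leb2]_x _)%E = \int[leb2]_x (\1_Om x)%:E)%E; last first.
    apply: eq_integral => x _ /=; rewrite indicE; case: (x \in Om).
      by rewrite !normr1 powR1.
    by rewrite !normr0 powR0// gt_eqF.
  by rewrite integral_indic// setIT.
have N0 : (0 <= 'N[leb2]_q%:E[EFin \o (\1_Om : mpt -> R)])%E by exact: Lnorm_ge0.
exists (fine 'N[leb2]_q%:E[EFin \o (\1_Om : mpt -> R)] + 1).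
  by rewrite ltr_pwDr// fine_ge0.
move=> f mf.
have m1 : measurable_fun [set: mpt] (fun x : mpt => \1_Om x * f x).
  by apply: measurable_funM => //; exact: measurable_indic.
have m2 : measurable_fun [set: mpt] (\1_Om : mpt -> R) by exact: measurable_indic.
have := @hoelder _ mpt R leb2 (fun x => \1_Om x * f x) (\1_Om) p q m1 m2 p0 q0.
rewrite /q invrK addrC subrK => /(_ erefl); rewrite Lnorm1.
rewrite (_ : (\int[leb2]_x _)%E = \int[leb2]_(x in Om) `|f x|%:E)%E; last first.
  rewrite [RHS]integral_mkcond; apply: eq_integral => x _; rewrite patchE /= indicE.
  by case: (x \in Om); rewrite ?mul1r ?mulr1// mul0r mul0r normr0.
move=> /le_trans; apply; rewrite -/q; apply: lee_wpmul2l; first exact: Lnorm_ge0.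
by rewrite EFinD fineK ?leeDl// ge0_fin_numE.
Qed.

End lebesgue_norms.

(** * The projection formula *)

Section clamp.
Context {R : realType}.
Variables (al be : R).
Hypothesis ab : al < be.
Definition clamp (t : R) : R := Num.max al (Num.min be t).

Lemma clamp_itv t : al <= clamp t <= be.
Proof.
rewrite /clamp le_max lexx/= ge_max (ltW ab)/= ge_min lexx//.
Qed.

Lemma clampP t : [\/ t <= al /\ clamp t = al, al <= t <= be /\ clamp t = t |
  be <= t /\ clamp t = be].
Proof.
rewrite /clamp; have [h1|h1] := leP be t.
  by rewrite max_r ?(ltW ab)//; constructor 3.
have [h2|h2] := leP al t; first by constructor 2; rewrite (ltW h1).
by constructor 1; rewrite ltW.
Qed.

Lemma clamp_lip s t : `|clamp s - clamp t| <= `|s - t|.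
Proof.
wlog st : s t / s <= t.
  move=> H; have [st|/ltW ts] := leP s t; first exact: H.
  by rewrite distrC (distrC s); exact: H.
rewrite distrC (distrC s) [leRHS]ger0_norm ?subr_ge0// ler_norml.
case: (clampP s) => [[h1 ->]|[/andP[h1 h1'] ->]|[h1 ->]];
  by case: (clampP t) => [[h2 ->]|[/andP[h2 h2'] ->]|[h2 ->]]; have abl : al < be := ab; apply/andP; split; lra.
Qed.

Lemma clamp_gt t : t < clamp t -> clamp t = al.
Proof.
by case: (clampP t) => [[h1 ->]|[/andP[h1 h1'] ->]|[h1 ->]]//; rewrite ?ltxx// ltNge h1.
Qed.

Lemma clamp_lt t : clamp t < t -> clamp t = be.
Proof.
by case: (clampP t) => [[h1 ->]|[/andP[h1 h1'] ->]|[h1 ->]]//; rewrite ?ltxx// ltNge h1.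
Qed.

(** The obtuse angle criterion (t - clamp t) (u - clamp t) <= 0 for the
    projection of t on the interval. *)
Lemma clamp_proj t u : al <= u <= be ->
  (u - t) * (clamp t - u) <= - (u - clamp t) ^+ 2.
Proof.
move=> /andP[u1 u2].
suff : (t - clamp t) * (u - clamp t) <= 0 by nra.
by case: (clampP t) => [[h1 ->]|[/andP[h1 h1'] ->]|[h1 ->]]; nra.
Qed.

End clamp.

Section convex_domain.
Context {R : realType}.
Variable Om : set (R * R).
Hypotheses (oOm : open Om) (convOm : convex_set Om) (bOm : bounded_set Om).
Local Notation mpt := (measurableTypeR R * measurableTypeR R)%type.

Lemma measurable_domain : measurable (Om : set mpt).
Proof. exact: open_measurable_plane. Qed.

Lemma leb2_domain_fin : (leb2 Om < +oo)%E.
Proof.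
have [r [r0 sub fin]] := bounded_leb2 bOm.
apply: le_lt_trans fin; apply: le_measure; rewrite ?inE//.
  exact: measurable_domain.
apply: closed_measurable_plane.
have -> : [set x : R * R | `|x.1| <= r /\ `|x.2| <= r] = box (- r) r (- r) r.
  by apply/seteqP; split => x; rewrite /box /= !in_itv/= !ler_norml.
by apply: compact_closed; [exact: norm_hausdorff|exact: compact_box].
Qed.

(** Membership in the closure of the test functions supplies the density in L^1
    that [lipschitz_representative] asks for, and the weak derivatives in
    L^infinity supply the bounds. *)
Lemma W1infty_lipschitz (p : R) (phi : R * R -> R) : 1 < p ->
  W1p0 Om p%:E phi -> W1p Om +oo%E phi ->
  exists2 L : R, 0 <= L &
  exists2 h : R * R -> R, aeq Om phi h &
    forall x x', `|h x - h x'| <= L * dist1 x x'.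
Proof.
move=> p1 [_ [psi [tpsi cpsi]]] [phioo gr].
have mOm := measurable_domain; have fOm := leb2_domain_fin.
have [g0 wp0 /(memLp_infty_bounded)[M1 M10 g0M]] := gr 0.
have [g1 wp1 /(memLp_infty_bounded)[M2 M20 g1M]] := gr 1.
have [M0 M00 phiM] := memLp_infty_bounded phioo.
have [f [mf fM f0 phif]] := lmeasurable_bounded_borel mOm M00 phioo.1 phiM.
apply: (@lipschitz_representative R Om f phi g0 g1 M0 (M1 + M2)) => //.
- exact: addr_ge0.
- by apply: filterS g0M => x /[apply] h; rewrite (le_trans h)// lerDl.
- by apply: filterS g1M => x /[apply] h; rewrite (le_trans h)// lerDr.
move=> e e0.
have [K K0 HK] := integral_norm_le_LpN mOm p1 fOm.
have eK : 0 < e / K by rewrite divr_gt0.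
move: cpsi => /fine_cvgP[finN /cvgrPdist_le/(_ _ eK)].
move=> /(filterI finN)[N _ /(_ N (leqnn _))[/= fN HN]].
exists (psi N) => //.
have mpsi := test_fun_measurable (tpsi N).
have mfpsi : measurable_fun [set: mpt] (fun x : mpt => f x - psi N x).
  exact: measurable_funB.
have -> : (\int[leb2]_y `|f y - psi N y|%:E = \int[leb2]_(y in Om) `|f y - psi N y|%:E)%E.
  rewrite [RHS]integral_mkcond; apply: eq_integral => y _; rewrite patchE.
  case: ifPn => //; rewrite notin_setE => Oy; rewrite f0// sub0r normrN.
  have [_ [C [_ CO C0]]] := tpsi N; rewrite C0 ?normr0// => Cy; apply: Oy; exact: CO.
apply: le_trans (HK _ mfpsi) _.
have -> : LpN Om p%:E (fun x => f x - psi N x) = LpN Om p%:E (phi \- psi N).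
  by apply/esym/eq_LpN; apply: filterS phif => x /[apply] /= ->.
have L0 : (0 <= LpN Om p%:E (phi \- psi N))%E by exact: Lnorm_ge0.
have LW : (LpN Om p%:E (phi \- psi N) <= W1N Om p%:E (phi \- psi N))%E.
  by rewrite /W1N leeDl// sume_ge0// => i _; exact: Lnorm_ge0.
move: HN; rewrite sub0r normrN ger0_norm; last first.
  by rewrite fine_ge0// (le_trans L0).
rewrite -lee_fin fineK// => HN.
rewrite (@le_trans _ _ ((e / K)%:E * K%:E)%E)//.
  apply: lee_wpmul2r; first by rewrite lee_fin ltW.
  exact: le_trans LW HN.
by rewrite -EFinM divfK// gt_eqF.
Qed.

End convex_domain.

Section optimal_control.
Context {R : realType}.
Variable P : problem R.
Local Notation Om := (Omega P).
Hypotheses (oOm : open Om) (convOm : convex_set Om) (bOm : bounded_set Om).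
Hypothesis nu0 : 0 < nu P.
Hypothesis ab : alpha P < beta P.
Local Notation mpt := (measurableTypeR R * measurableTypeR R)%type.

Lemma bounded_integrable (F : R * R -> R) (c : R) :
  measurable_fun [set: mpt] (F : mpt -> R) -> (forall x, `|F x| <= c) ->
  (@leb2 R).-integrable Om (EFin \o F).
Proof.
move=> mF Fc; have mOm := measurable_domain oOm; have fOm := leb2_domain_fin oOm bOm.
have := @measurable_bounded_integrable _ mpt R leb2 F Om mOm fOm.
apply; first exact: measurable_funTS.
exists c; split; first exact: num_real.
move=> x cx y _ /=; exact: le_trans (Fc y) (ltW cx).
Qed.

Lemma Uad_bound u : Uad P u ->
  {ae leb2, forall x, Om x -> `|u x| <= `|alpha P| + `|beta P|}.
Proof.
move=> [_]; apply: filterS => x /[apply] /andP[h1 h2].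
rewrite ler_norml; have := ler_norm (beta P); have := ler_norm (- alpha P).
rewrite normrN; have := normr_ge0 (alpha P); have := normr_ge0 (beta P).
by move=> *; apply/andP; split; lra.
Qed.

(** Testing the variational inequality with the projection w of - phi / nu
    gives, by the obtuse angle criterion, that the integral of (u - w)^2 is not
    positive. *)
Lemma projection_formula (u phi : R * R -> R) (M : R) : 0 <= M -> Uad P u ->
  lmeasurable Om phi -> {ae leb2, forall x, Om x -> `|phi x| <= M} ->
  (forall w, Uad P w -> 0 <= dj P u phi (w \- u)) ->
  aeq Om u (fun x => clamp (alpha P) (beta P) (- phi x / nu P)).
Proof.
move=> M0 Uu mphi phiM vi.
have mOm := measurable_domain oOm; have fOm := leb2_domain_fin oOm bOm.
pose N := `|alpha P| + `|beta P|; have N0 : 0 <= N by exact: addr_ge0.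
have [f [mf fM f0 phif]] := lmeasurable_bounded_borel mOm M0 mphi phiM.
have clN t : `|clamp (alpha P) (beta P) t| <= N.
  have /andP[h1 h2] := clamp_itv ab t.
  rewrite ler_norml /N; have := ler_norm (beta P); have := ler_norm (- alpha P).
  rewrite normrN; have := normr_ge0 (alpha P); have := normr_ge0 (beta P).
  by move: h1 h2 => *; apply/andP; split; lra.
have [v' [mv' _ _ uv']] := lmeasurable_bounded_borel mOm N0 Uu.1.1 (Uad_bound Uu).
have mcl (g : mpt -> R) : measurable_fun setT g ->
    measurable_fun setT (fun x => clamp (alpha P) (beta P) (g x)).
  by move=> mg; apply: measurable_maxr => //; exact: measurable_minr.
pose v x := clamp (alpha P) (beta P) (v' x).
have mv : measurable_fun [set: mpt] (v : mpt -> R) by exact: mcl.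
have vN x : `|v x| <= N by exact: clN.
have uv : aeq Om u v.
  apply: filterS2 uv' Uu.2 => x e1 e2 Ox; rewrite /v -e1//.
  have /andP[h1 h2] := e2 Ox.
  by rewrite /clamp (min_idPr h2) (max_idPr h1).
pose w x := clamp (alpha P) (beta P) (- f x / nu P).
have mw : measurable_fun [set: mpt] (w : mpt -> R).
  by apply: mcl; apply: measurable_funM => //; exact: measurableT_comp.
have wN x : `|w x| <= N by exact: clN.
have Uw : Uad P w.
  split; last by apply: aeW => x _; exact: clamp_itv.
  apply: (bounded_memLp_infty N0); first exact: borel_lmeasurable.
  exact: aeW.
have := vi _ Uw.
rewrite /dj (_ : \int[leb2]_(x in Om) _ = \int[leb2]_(x in Om) ((f x + nu P * v x) * (w x - v x))); last first.
  by apply: ae_eq_Rintegral; apply: filterS2 phif uv => x e1 e2 Ox /=; rewrite e1// e2.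
have mD : measurable_fun [set: mpt] (fun x : mpt => (v x - w x) ^+ 2).
  by apply: measurable_funX; exact: measurable_funB.
have i1 : (@leb2 R).-integrable Om (EFin \o (fun x => (f x + nu P * v x) * (w x - v x))).
  apply: (@bounded_integrable _ ((M + nu P * N) * (N + N))).
    apply: measurable_funM; last exact: measurable_funB.
    by apply: measurable_funD => //; exact: measurable_funM.
  move=> x; rewrite normrM ler_pM//.
    rewrite (le_trans (ler_normD _ _))// lerD// normrM (gtr0_norm nu0).
    by rewrite ler_wpM2l// ltW.
  by rewrite (le_trans (ler_normB _ _))// lerD.
have i2 : (@leb2 R).-integrable Om (EFin \o (fun x => (v x - w x) ^+ 2)).
  apply: (@bounded_integrable _ ((N + N) ^+ 2)) => // x.
  rewrite normrX lerXn2r ?nnegrE ?addr_ge0//.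
  by rewrite (le_trans (ler_normB _ _))// lerD.
have i3 : (@leb2 R).-integrable Om (EFin \o (fun x => - nu P * (v x - w x) ^+ 2)).
  rewrite (_ : _ \o _ = (fun x => (- nu P)%:E * ((v x - w x) ^+ 2)%:E)%E); last by apply/funext.
  exact: integrableZl.
move=> /le_trans /(_ (le_Rintegral mOm i1 i3 _)).
have pw x : (f x + nu P * v x) * (w x - v x) <= - nu P * (v x - w x) ^+ 2.
  have -> : f x + nu P * v x = nu P * (v x - - f x / nu P).
    by rewrite mulrBr mulNr mulrN opprK mulrCA divff ?mulr1 ?gt_eqF// addrC.
  rewrite -mulrA (mulNr (nu P)) -(mulrN (nu P)) ler_pM2l//.
  exact: (clamp_proj ab _ (clamp_itv ab _)).
move=> /(_ (fun x _ => pw x)); rewrite RintegralZl// mulNr oppr_ge0 pmulr_rle0// => D0.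
have {}D0 : \int[leb2]_(x in Om) (v x - w x) ^+ 2 = 0.
  by apply/eqP; rewrite eq_le D0 Rintegral_ge0// => x _; exact: sqr_ge0.
have mE : measurable_fun Om (fun x : mpt => ((v x - w x) ^+ 2)%:E).
  by apply/measurable_EFinP; exact: measurable_funTS.
have := (ae_eq_integral_abs leb2 mOm mE).1; case.
  rewrite -[LHS]fineK; last first.
    by have := integrable_fin_num mOm (integrable_abse i2).
  congr EFin; rewrite -[RHS]D0 /Rintegral; congr fine; apply: eq_integral => x _ /=.
  by rewrite ger0_norm// sqr_ge0.
move=> N1 [mN1 N10 sN1].
have De : {ae leb2, forall x, Om x -> v x = w x}.
  exists N1; split => // x /= H; apply: sN1 => /= H'; apply: H => Ox.
  by have /eqP := H' Ox; rewrite eqe sqrf_eq0 subr_eq0 => /eqP.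
by apply: filterS3 De uv phif => x e1 e2 e3 Ox; rewrite e2// e1// e3.
Qed.

End optimal_control.

(** * Triangles and barycentric coordinates *)

Section triangles.
Context {R : realType}.
Local Notation pt := (R * R)%type.
Local Notation mpt := (measurableTypeR R * measurableTypeR R)%type.
Implicit Types (T : @triangle R) (x y : pt).

Lemma hull_triangleP T x : hull T x <-> exists w : nat -> R,
  [/\ forall i, 0 <= w i, w 0%N + w 1%N + w 2%N = 1,
    x.1 = w 0%N * (T`_0).1 + w 1%N * (T`_1).1 + w 2%N * (T`_2).1 &
    x.2 = w 0%N * (T`_0).2 + w 1%N * (T`_1).2 + w 2%N * (T`_2).2].
Proof.
rewrite /hull size_tuple /=; split => -[w H]; exists w; move: H;
  rewrite !big_ord_recr !big_ord0/= !add0r; first by case=> w0 w1 ->.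
by case=> w0 w1; case: x => ? ? /= -> ->.
Qed.

Lemma hull_nth T (i : nat) : (i < 3)%N -> hull T T`_i.
Proof.
move=> i3; apply/hull_triangleP; exists (fun j => (j == i)%:R).
by case: i i3 => [|[|[|//]]] _; split => //=; rewrite ?(mul0r, mul1r, addr0, add0r).
Qed.

Lemma hull_bound T : exists K, forall x, hull T x -> `|x.1| <= K /\ `|x.2| <= K.
Proof.
pose K := \sum_(i < 3) (`|(T`_i).1| + `|(T`_i).2|).
exists K => x /hull_triangleP[w [w0 w1 -> ->]].
have wle i : (i < 3)%N -> w i <= 1.
  have := w0 0%N; have := w0 1%N; have := w0 2%N.
  by case: i => [|[|[|//]]] ? ? ? _; lra.
have H (a b c : R) : `|w 0%N * a + w 1%N * b + w 2%N * c| <= `|a| + `|b| + `|c|.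
  rewrite (le_trans (ler_normD _ _))// lerD// ?(le_trans (ler_normD _ _))//.
    by rewrite lerD// normrM ler_piMl// ger0_norm// wle.
  by rewrite normrM ler_piMl// ger0_norm// wle.
rewrite /K !big_ord_recr big_ord0/= add0r.
by split; apply: (le_trans (H _ _ _)); rewrite -!addrA;
  have := normr_ge0 (T`_0).1; have := normr_ge0 (T`_1).1; have := normr_ge0 (T`_2).1;
  have := normr_ge0 (T`_0).2; have := normr_ge0 (T`_1).2; have := normr_ge0 (T`_2).2; lra.
Qed.

Lemma enorm_ge_coord x : `|x.1| <= enorm x /\ `|x.2| <= enorm x.
Proof.
rewrite /enorm /dot -!expr2.
have H (a b : R) : `|a| <= Num.sqrt (a ^+ 2 + b ^+ 2).
  by rewrite -sqrtr_sqr ler_wsqrtr// lerDl sqr_ge0.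
by split => //; rewrite addrC.
Qed.

Lemma enorm_le x (a b : R) : `|x.1| <= a -> `|x.2| <= b -> enorm x <= a + b.
Proof.
move=> xa xb; have a0 : 0 <= a by apply: le_trans xa. have b0 : 0 <= b by apply: le_trans xb.
rewrite /enorm /dot -!expr2 -[leRHS]ger0_norm ?addr_ge0// -sqrtr_sqr ler_wsqrtr//.
rewrite -[x.1 ^+ 2]real_normK ?num_real// -[x.2 ^+ 2]real_normK ?num_real//.
have := normr_ge0 x.1; have := normr_ge0 x.2; nra.
Qed.

Lemma enorm_le_tdiam T x y : hull T x -> hull T y -> enorm (x - y) <= tdiam T.
Proof.
move=> Tx Ty; apply: ub_le_sup; last by exists x => //; exists y.
have [K HK] := hull_bound T.
exists ((K + K) + (K + K)) => _ [a Ta [b Tb <-]].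
have [a1 a2] := HK a Ta; have [b1 b2] := HK b Tb.
by apply: enorm_le; rewrite (le_trans (ler_normB _ _))// lerD.
Qed.

Lemma dist1_le_tdiam T x y : hull T x -> hull T y -> dist1 x y <= 2 * tdiam T.
Proof.
move=> Tx Ty; have := enorm_le_tdiam Tx Ty; have [] := enorm_ge_coord (x - y).
rewrite /dist1/= => ? ? ?; lra.
Qed.

Definition cross x y : R := x.1 * y.2 - x.2 * y.1.

Definition tdet T : R := cross (T`_1 - T`_0) (T`_2 - T`_0).

(** If the edges were parallel, the product with a nonzero normal to them would
    be constant on the triangle, hence on a neighbourhood of an interior point. *)
Lemma tdet_neq0 T : interior (hull T) !=set0 -> tdet T != 0.
Proof.
move=> [x /nbhs_ballP[e /= e0 He]]; apply/eqP => D0.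
have [n n0 [n1 n2]] : exists2 n : pt, n != 0 &
    dot n (T`_1 - T`_0) = 0 /\ dot n (T`_2 - T`_0) = 0.
  move: D0; rewrite /tdet /cross /dot; set d := T`_1 - T`_0; set d' := T`_2 - T`_0 => D0.
  have pp (a : pt) : a != 0 -> (- a.2, a.1) != 0 :> pt.
    apply: contra => /eqP[/eqP]; rewrite oppr_eq0 => /eqP a2 a1.
    by case: a a1 a2 => ? ? /= -> ->.
  have [d0|d0] := eqVneq d 0; last first.
    exists (- d.2, d.1); first exact: pp.
    move: (d) (d') D0 => [a1 a2] [b1 b2] /= D0; split; first by ring.
    by transitivity (a1 * b2 - a2 * b1); [ring|].
  have [d'0|d'0] := eqVneq d' 0; last first.
    exists (- d'.2, d'.1); first exact: pp.
    move: (d) (d') D0 => [a1 a2] [b1 b2] /= D0; split; last by ring.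
    by transitivity (- (a1 * b2 - a2 * b1)); [ring|rewrite D0 oppr0].
  exists (1, 0); first by apply/eqP => -[/eqP]; rewrite oner_eq0.
  by rewrite d0 d'0/= !mulr0 addr0.
have onl y : hull T y -> dot n (y - T`_0) = 0.
  move=> /hull_triangleP[w [_ w1 y1 y2]].
  move: n1 n2; rewrite /dot/= y1 y2 => n1 n2.
  have -> : w 0%N = 1 - w 1%N - w 2%N by lra.
  transitivity (w 1%N * (n.1 * ((T`_1).1 - (T`_0).1) + n.2 * ((T`_1).2 - (T`_0).2)) +
    w 2%N * (n.1 * ((T`_2).1 - (T`_0).1) + n.2 * ((T`_2).2 - (T`_0).2))); first by ring.
  by rewrite n1 n2 !mulr0 addr0.
have e20 : 0 < e / 2 by rewrite divr_gt0.
have ee : e / 2 < e by rewrite ltr_pdivrMr// ltr_pMr// ltr1n.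
have h0 : hull T x by apply: He; exact: ballxx.
have h1 : hull T (x.1 + e / 2, x.2).
  apply: He; split; rewrite /ball/=; last by rewrite subrr normr0.
  by rewrite opprD addrA subrr sub0r normrN gtr0_norm.
have h2 : hull T (x.1, x.2 + e / 2).
  apply: He; split; rewrite /ball/=; first by rewrite subrr normr0.
  by rewrite opprD addrA subrr sub0r normrN gtr0_norm.
move: (onl _ h0) (onl _ h1) (onl _ h2); rewrite /dot/= => q0 q1 q2.
have z1 : n.1 * (e / 2) = 0 by lra.
have z2 : n.2 * (e / 2) = 0 by lra.
move/eqP : z1; rewrite mulf_eq0 (gt_eqF e20) orbF => /eqP z1.
move/eqP : z2; rewrite mulf_eq0 (gt_eqF e20) orbF => /eqP z2.
by move/eqP : n0; apply; case: (n) z1 z2 => ? ? /= -> ->.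
Qed.

(** The barycentric coordinates of x by Cramer's rule. *)
Definition bary T (i : nat) x : R :=
  let l1 := cross (x - T`_0) (T`_2 - T`_0) / tdet T in
  let l2 := cross (T`_1 - T`_0) (x - T`_0) / tdet T in
  match i with 0 => 1 - l1 - l2 | 1 => l1 | _ => l2 end.

Lemma sum_bary T x : bary T 0 x + bary T 1 x + bary T 2 x = 1.
Proof. rewrite /bary; ring. Qed.

Lemma bary_affine T i : affine_on setT (bary T i).
Proof.
have af1 : affine_on setT (bary T 1).
  exists (cross (- T`_0) (T`_2 - T`_0) / tdet T).
  exists ((T`_2 - T`_0).2 / tdet T, - (T`_2 - T`_0).1 / tdet T) => x _.
  by rewrite /bary /cross /dot/=; ring.
have af2 : affine_on setT (bary T 2).
  exists (cross (T`_1 - T`_0) (- T`_0) / tdet T).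
  exists (- (T`_1 - T`_0).2 / tdet T, (T`_1 - T`_0).1 / tdet T) => x _.
  by rewrite /bary /cross /dot/=; ring.
case: i => [|[|i]] //.
have [c1 [d1 E1]] := af1; have [c2 [d2 E2]] := af2.
exists (1 - c1 - c2), (- d1 - d2) => x _.
have := E1 x I; have := E2 x I; have := sum_bary T x; rewrite /dot/=; lra.
Qed.

Lemma bary_comb T x : tdet T != 0 ->
  x.1 = bary T 0 x * (T`_0).1 + bary T 1 x * (T`_1).1 + bary T 2 x * (T`_2).1 /\
  x.2 = bary T 0 x * (T`_0).2 + bary T 1 x * (T`_1).2 + bary T 2 x * (T`_2).2.
Proof.
rewrite /bary /tdet /cross/=.
move: T`_0 T`_1 T`_2 => v0 v1 v2 /= D0; split; by field.
Qed.

Lemma bary_nth T i j : tdet T != 0 -> (i < 3)%N -> (j < 3)%N ->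
  bary T i T`_j = (i == j)%:R.
Proof.
rewrite /bary /tdet /cross/= => D0 i3 j3; move: D0.
case: i i3 => [|[|[|//]]] _; case: j j3 => [|[|[|//]]] _ /=;
  move: T`_0 T`_1 T`_2 => v0 v1 v2 D0; by field.
Qed.

Lemma affine_comb (f : pt -> R) (s : seq pt) (w : nat -> R) :
  affine_on setT f -> \sum_(i < size s) w i = 1 ->
  f (\sum_(i < size s) w i *: s`_i) = \sum_(i < size s) w i * f s`_i.
Proof.
move=> [c [d fE]] w1; rewrite fE//.
have -> : \sum_(i < size s) w i * f s`_i = \sum_(i < size s) (w i * c + w i * dot d s`_i).
  by apply: eq_bigr => i _; rewrite fE// mulrDr.
rewrite big_split/= -mulr_suml w1 mul1r; congr (c + _).
elim/big_ind2: _ => //.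
- by rewrite /dot/= !mulr0 addr0.
- by move=> p r q s' pE qE; rewrite -pE -qE /dot/=; ring.
- by move=> i _; rewrite /dot/= /GRing.scale/=; ring.
Qed.

Lemma hull_baryP T x : tdet T != 0 ->
  hull T x <-> forall i, (i < 3)%N -> 0 <= bary T i x.
Proof.
move=> D0; split => [[w [w0 w1 xE]] i i3|H].
  rewrite xE affine_comb//; last exact: bary_affine.
  apply: sumr_ge0 => -[j j3] _ /=; move: j3; rewrite size_tuple => j3.
  by rewrite bary_nth// mulr_ge0.
apply/hull_triangleP; exists (fun i => if (i < 3)%N then bary T i x else 0).
have [x1 x2] := bary_comb x D0; split => //=; last exact: sum_bary.
by move=> i; case: ifPn => // /H.
Qed.

Lemma affine_continuous (f : pt -> R) : affine_on setT f -> continuous f.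
Proof.
move=> [c [d fE]]; have -> : f = (fun x => c + (d.1 * x.1 + d.2 * x.2)).
  by apply/funext => x; rewrite fE.
move=> x; apply: cvgD; first exact: cvg_cst.
by apply: cvgD; apply: cvgM; [exact: cvg_cst|exact: cvg_fst|exact: cvg_cst|exact: cvg_snd].
Qed.

Lemma closed_hull T : tdet T != 0 -> closed (hull T).
Proof.
move=> D0.
have -> : hull T = \bigcap_(i in [set i | (i < 3)%N]) (bary T i @^-1` [set t | 0 <= t]).
  apply/seteqP; split => x.
    by move=> /(hull_baryP _ D0) H i /= i3; exact: H.
  by move=> H; apply/(hull_baryP _ D0) => i i3; exact: H.
apply: closed_bigI => i _; apply: closed_comp; last exact: closed_ge.
by move=> x _; apply: affine_continuous; exact: bary_affine.
Qed.

(** The zero set is a line: each of its vertical sections is a point, or it is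
    itself vertical. *)
Lemma affine_zero_null (f : pt -> R) x y : affine_on setT f -> f x != f y ->
  {ae leb2, forall z, f z != 0}.
Proof.
move=> af fxy; have cf := affine_continuous af; have [c [d fE]] := af.
pose A := f @^-1` [set 0].
have mA : measurable (A : set mpt).
  apply: closed_measurable_plane; apply: closed_comp => //.
exists A; split => //; last by move=> z /= /negP; rewrite negbK => /eqP.
have [d20|d20] := eqVneq d.2 0; last first.
  rewrite /leb2 /= /product_measure1 /=; apply: integral0_eq => z1 _.
  rewrite (_ : xsection A z1 = [set - (c + d.1 * z1) / d.2]) ?lebesgue_measure_set1//.
  apply/seteqP; split => z2; rewrite /xsection /= inE /A /= fE//= /dot/=.
    move=> H; rewrite -[LHS](mulfK d20); congr (_ / _); lra.
  by move=> ->; field.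
have d10 : d.1 != 0.
  apply/eqP => d10; move/eqP : fxy; apply; rewrite !fE// /dot d10 d20; ring.
rewrite (_ : A = [set - c / d.1] `*` setT).
  by rewrite leb2X//= lebesgue_measure_set1 mul0e.
apply/seteqP; split => -[z1 z2]; rewrite /A /= fE// /dot/= d20.
  move=> H; split => //; rewrite -[LHS](mulfK d10); congr (_ / _); lra.
by move=> [-> _]; field.
Qed.

End triangles.

(** * Interpolation on a triangulation *)

(** A filter is stable under finite intersections. *)
Lemma near_mem_seq (T : eqType) (X : Type) (F : set_system X) (s : seq T)
    (Q : T -> X -> Prop) : Filter F ->
  (forall t, t \in s -> \forall x \near F, Q t x) ->
  \forall x \near F, forall t, t \in s -> Q t x.
Proof.
move=> FF; elim: s => [_|t s IH H]; first by apply: nearW.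
have H1 := H t (mem_head _ _).
have H2 : \forall x \near F, forall t, t \in s -> Q t x.
  by apply: IH => u us; apply: H; rewrite inE us orbT.
apply: filterS2 H1 H2 => x h1 h2 u; rewrite inE => /orP[/eqP ->//|]; exact: h2.
Qed.

Section interpolation.
Context {R : realType}.
Local Notation pt := (R * R)%type.
Local Notation mpt := (measurableTypeR R * measurableTypeR R)%type.
Local Notation triangle := (@triangle R).
Implicit Types (T : triangle) (x y : pt).

(** A sum of indicators, so that measurability comes from the triangles being
    closed. *)
Fixpoint glue (F : triangle -> pt -> R) (s : seq triangle) x : R :=
  if s is T :: s' then
    \1_(hull T) x * F T x + (1 - \1_(hull T) x) * glue F s' x
  else 0.

Lemma glueP F s x : (exists2 T : triangle, T \in s & hull T x) ->
  exists2 T : triangle, T \in s & hull T x /\ glue F s x = F T x.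
Proof.
elim: s => [|T s IH] [T0]//; rewrite inE => T0s T0x /=.
have [Tx|nTx] := pselect (hull T x).
  exists T; rewrite ?mem_head//; split => //.
  by rewrite indicE mem_set// mul1r subrr mul0r addr0.
have [|T1 T1s [T1x E]] := IH.
  case/orP : T0s => [/eqP T0T|T0s]; first by rewrite T0T in T0x.
  by exists T0.
exists T1; first by rewrite inE T1s orbT.
by split => //; rewrite indicE memNset// mul0r add0r subr0 mul1r.
Qed.

Lemma measurable_glue F s : (forall T : triangle, T \in s -> tdet T != 0) ->
  (forall T, measurable_fun [set: mpt] (F T : mpt -> R)) ->
  measurable_fun [set: mpt] (glue F s : mpt -> R).
Proof.
move=> D0 mF; elim: s D0 => [|T s IH] D0 /=; first exact: measurable_cst.
have mT : measurable_fun [set: mpt] (\1_(hull T) : mpt -> R).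
  apply: measurable_indic; apply: closed_measurable_plane; apply: closed_hull.
  by apply: D0; rewrite mem_head.
apply: measurable_funD; first by apply: measurable_funM.
apply: measurable_funM; first by apply: measurable_funB.
by apply: IH => T' T's; apply: D0; rewrite inE T's orbT.
Qed.

Variables (Om : set pt) (mesh : seq triangle) (h : R).
Hypotheses (tri : triangulates Om mesh)
  (msize : forall T : triangle, T \in mesh -> tdiam T <= h).

Let D0 T : T \in mesh -> tdet T != 0.
Proof. by case: tri => /(_ T) + _ _ => /[apply]; exact: tdet_neq0. Qed.

Let cover x : closure Om x -> exists2 T : triangle, T \in mesh & hull T x.
Proof. by case: tri => _ -> _ [T /= Tm Tx]; exists T. Qed.

Let meet T T' x : T \in mesh -> T' \in mesh -> hull T x -> hull T' x ->
  hull [seq v <- T | v \in tval T'] x.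
Proof. by case: tri => _ _ H Tm T'm Tx T'x; rewrite -(H _ _ Tm T'm). Qed.

(** Two triangles of the mesh meet in the hull of their common vertices. At a
    point off the zero lines of the barycentric coordinates all three vertices
    carry weight, so every vertex is common and the triangles have the same hull.
    Hence the choice made in [glue] is immaterial almost everywhere. *)
Lemma hull_eq_ae : {ae leb2, forall x, forall T T' : triangle, T \in mesh -> T' \in mesh ->
  hull T x -> hull T' x -> hull T = hull T'}.
Proof.
have : {ae leb2, forall x, forall T : triangle, T \in mesh ->
    forall k, k \in [:: 0; 1; 2]%N -> bary T k x != 0}.
  apply: near_mem_seq => T Tm; apply: near_mem_seq => k k3.
  have k3' : (k < 3)%N by move: k3; rewrite !inE => /or3P[] /eqP ->.
  have [j j3 jk] : exists2 j, (j < 3)%N & k != j.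
    by case: (k) k3' => [|[|[|]]]// _; [exists 1%N|exists 0%N|exists 0%N].
  apply: (@affine_zero_null _ _ T`_k T`_j); first exact: bary_affine.
  by rewrite !bary_nth ?D0// eqxx (negbTE jk) oner_eq0.
apply: filterS => x gx.
have sub T T' : T \in mesh -> T' \in mesh -> hull T x -> hull T' x ->
    hull T `<=` hull T'.
  move=> Tm T'm Tx T'x.
  suff /all_filterP E : all (fun v => v \in tval T') T.
    by case: tri => _ _ /(_ _ _ Tm T'm); rewrite E => <-; exact: subIsetr.
  apply/(all_nthP 0) => k; rewrite size_tuple => k3; apply: contrapT => /negP kT'.
  have k3' : k \in [:: 0; 1; 2]%N by case: (k) k3 => [|[|[|]]].
  have := gx T Tm k k3'; have [w [_ w1 ->]] := meet Tm T'm Tx T'x.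
  rewrite affine_comb//; last exact: bary_affine.
  rewrite big1 ?eqxx// => -[i i3] _ /=.
  have := mem_nth 0 i3; rewrite mem_filter => /andP[iT' /(nthP 0)[j]].
  rewrite size_tuple => j3 E; rewrite -E bary_nth ?D0//.
  have [kj|] := eqVneq k j; last by rewrite mulr0.
  by move: kT'; rewrite kj E iT'.
by move=> T T' Tm T'm Tx T'x; apply/seteqP; split; exact: sub.
Qed.

Variables (ut gt : pt -> R) (Lu Lg al be : R).
Hypotheses (Lu0 : 0 <= Lu) (Lg0 : 0 <= Lg).
Hypotheses (ut_lip : forall x y, `|ut x - ut y| <= Lu * dist1 x y)
  (gt_lip : forall x y, `|gt x - gt y| <= Lg * dist1 x y).
Hypothesis (ut_itv : forall x, al <= ut x <= be).
Hypotheses (gt_pos : forall x, 0 < gt x -> ut x = al)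
  (gt_neg : forall x, gt x < 0 -> ut x = be).

(** Where |gt x| <= Lg d the two factors are both of order d. Otherwise gt keeps
    its sign between x and v, so that x and v are in the same active set of the
    constraints and ut x = ut v. *)
Lemma near_estimate d x v : dist1 x v <= d ->
  gt x * (ut v - ut x) <= Lg * Lu * d ^+ 2.
Proof.
move=> xvd; have d0 : 0 <= d by apply: le_trans xvd; exact: dist1_ge0.
have G : `|gt x - gt v| <= Lg * d by rewrite (le_trans (gt_lip _ _))// ler_wpM2l.
have U : `|ut v - ut x| <= Lu * d.
  by rewrite distrC (le_trans (ut_lip _ _))// ler_wpM2l.
have K0 : 0 <= Lg * Lu * d ^+ 2 by rewrite !mulr_ge0// sqr_ge0.
have [gx|gx] := leP `|gt x| (Lg * d).
  rewrite (le_trans (ler_norm _))// normrM.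
  rewrite (_ : Lg * Lu * d ^+ 2 = (Lg * d) * (Lu * d)); last by ring.
  exact: ler_pM.
suff -> : ut v = ut x by rewrite subrr mulr0.
have LgL : 0 <= Lg * d by exact: mulr_ge0.
move: G; rewrite ler_norml => /andP[G1 G2].
have [x0|x0] := leP 0 (gt x).
  rewrite (ger0_norm x0) in gx.
  by rewrite !gt_pos//; lra.
rewrite (ltr0_norm x0) in gx.
by rewrite !gt_neg//; lra.
Qed.

(** All three estimates are preserved by averaging, which covers the two kinds
    of interpolation at once. *)
Lemma average_estimate d x (n : nat) (w : nat -> R) (v : nat -> pt) :
  0 <= d -> (forall i, 0 <= w i) -> \sum_(i < n) w i = 1 ->
  (forall i, (i < n)%N -> dist1 x (v i) <= d) ->
  let u := \sum_(i < n) w i * ut (v i) in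
  [/\ al <= u <= be, `|u - ut x| <= Lu * d & gt x * (u - ut x) <= Lg * Lu * d ^+ 2].
Proof.
move=> d0 w0 w1 vd u.
have uB : u - ut x = \sum_(i < n) w i * (ut (v i) - ut x).
  rewrite -[X in _ - X]mul1r -w1 mulr_suml -sumrB; apply: eq_bigr => i _.
  by rewrite mulrBr.
split.
- apply/andP; split.
    rewrite -[leLHS]mul1r -w1 mulr_suml; apply: ler_sum => i _.
    by rewrite ler_wpM2l//; case/andP: (ut_itv (v i)).
  rewrite -[leRHS]mul1r -w1 mulr_suml; apply: ler_sum => i _.
  by rewrite ler_wpM2l//; case/andP: (ut_itv (v i)).
- rewrite uB (le_trans (ler_norm_sum _ _ _))//.
  rewrite -[leRHS]mul1r -w1 mulr_suml; apply: ler_sum => i _.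
  rewrite normrM (ger0_norm (w0 i)) ler_wpM2l// distrC (le_trans (ut_lip _ _))//.
  by rewrite ler_wpM2l// vd.
- rewrite uB mulr_sumr -[leRHS]mul1r -w1 mulr_suml; apply: ler_sum => i _.
  rewrite mulrCA ler_wpM2l//; apply: near_estimate; exact: vd.
Qed.

Definition interp0 := glue (fun T _ => ut (xget 0 (hull T))) mesh.

Definition nodal T x : R := bary T 0 x * ut T`_0 + bary T 1 x * ut T`_1 + bary T 2 x * ut T`_2.

Definition interp1 := glue nodal mesh.

Lemma nodal_affine T : affine_on setT (nodal T).
Proof.
have [c0 [d0 E0]] := bary_affine T 0; have [c1 [d1 E1]] := bary_affine T 1.
have [c2 [d2 E2]] := bary_affine T 2.
exists (c0 * ut T`_0 + c1 * ut T`_1 + c2 * ut T`_2).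
exists (ut T`_0 *: d0 + ut T`_1 *: d1 + ut T`_2 *: d2) => x _.
by rewrite /nodal E0// E1// E2// /dot/= /GRing.scale/=; ring.
Qed.

Lemma nodal_vertex T v : T \in mesh -> v \in tval T -> nodal T v = ut v.
Proof.
move=> Tm /(nthP 0)[k]; rewrite size_tuple => k3 <-.
rewrite /nodal !bary_nth ?D0//; case: k k3 => [|[|[|]]]//= _; ring.
Qed.

(** On the common part, the hull of the common vertices, both functions are
    determined by their values at these vertices. *)
Lemma nodal_meet T T' x : T \in mesh -> T' \in mesh -> hull T x -> hull T' x ->
  nodal T x = nodal T' x.
Proof.
move=> Tm T'm Tx T'x; have [w [_ w1 ->]] := meet Tm T'm Tx T'x.
rewrite !affine_comb//; try exact: nodal_affine.
apply: eq_bigr => -[i i3] _ /=; congr (_ * _).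
have := mem_nth 0 i3; rewrite mem_filter => /andP[iT' iT].
by rewrite !nodal_vertex.
Qed.

Lemma interp1E T x : T \in mesh -> hull T x -> interp1 x = nodal T x.
Proof.
move=> Tm Tx; have [|T' T'm [T'x E]] := @glueP nodal mesh x; first by exists T.
rewrite /interp1 E.
exact: nodal_meet.
Qed.

(** Every triangle not containing x stays away from x, and on each of those
    containing x the function is affine. *)
Lemma interp1_continuous : {within closure Om, continuous interp1}.
Proof.
apply/subspace_continuousP => x Ox; apply/cvgrPdist_lt => e e0.
have H : \forall y \near x, forall T : triangle, T \in mesh -> hull T y -> `|interp1 x - interp1 y| < e.
  apply: (@near_mem_seq _ _ (nbhs x)) => T Tm.
  have [Tx|nTx] := pselect (hull T x).
    have /cvgrPdist_lt/(_ _ e0) := @affine_continuous _ _ (nodal_affine T) x.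
    by apply: filterS => y H Ty; rewrite !(@interp1E T).
  have : nbhs x (~` hull T).
    by apply: open_nbhs_nbhs; split => //; apply: closed_openC; exact: closed_hull (D0 Tm).
  by apply: filterS => y nTy /nTy.
apply: filterS H => y H Oy; have [T Tm Ty] := cover Oy; exact: H Ty.
Qed.

Let d2h T x y : T \in mesh -> hull T x -> hull T y -> dist1 x y <= 2 * h.
Proof.
by move=> Tm Tx Ty; rewrite (le_trans (dist1_le_tdiam Tx Ty))// ler_wpM2l// msize.
Qed.

Let hull_xget T : T \in mesh -> hull T (xget 0 (hull T)).
Proof.
move=> Tm; case: xgetP => [y _//|H]; exfalso.
exact: (H T`_0 (@hull_nth R T 0 isT)).
Qed.

Lemma interp0_estimate x : closure Om x ->
  [/\ al <= interp0 x <= be, `|interp0 x - ut x| <= Lu * (2 * h) &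
    gt x * (interp0 x - ut x) <= Lg * Lu * (2 * h) ^+ 2].
Proof.
move=> Ox; have [T Tm [Tx E]] := @glueP (fun T _ => ut (xget 0 (hull T))) mesh x (cover Ox).
rewrite /interp0 E.
have xd : dist1 x (xget 0 (hull T)) <= 2 * h by apply: (d2h Tm) => //; exact: hull_xget.
have d0 : 0 <= 2 * h by apply: le_trans xd; exact: dist1_ge0.
have := @average_estimate (2 * h) x 1 (fun=> 1) (fun=> xget 0 (hull T)) d0.
by rewrite !big_ord1 mul1r; apply.
Qed.

Lemma interp1_estimate x : closure Om x ->
  [/\ al <= interp1 x <= be, `|interp1 x - ut x| <= Lu * (2 * h) &
    gt x * (interp1 x - ut x) <= Lg * Lu * (2 * h) ^+ 2].
Proof.
move=> /cover[T Tm Tx]; rewrite (interp1E Tm Tx).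
have d0 : 0 <= 2 * h by apply: le_trans (dist1_ge0 x x) _; exact: (d2h Tm Tx Tx).
have := @average_estimate (2 * h) x 3 (fun i => if (i < 3)%N then bary T i x else 0) (fun i => T`_i) d0.
rewrite !big_ord_recr !big_ord0/= !add0r; apply.
- by move=> i; case: ifPn => // i3; exact: (hull_baryP x (D0 Tm)).1.
- exact: sum_bary.
- by move=> i i3; apply: (d2h Tm) => //; exact: hull_nth.
Qed.

Lemma interpolant (i : 'I_2) : exists uh, [/\ Uh i Om mesh uh, memLp Om +oo%E uh &
  forall x, closure Om x ->
  [/\ al <= uh x <= be, `|uh x - ut x| <= Lu * (2 * h) &
    gt x * (uh x - ut x) <= Lg * Lu * (2 * h) ^+ 2]].
Proof.
have bd (u : pt -> R) : measurable_fun [set: mpt] (u : mpt -> R) ->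
    (forall x, closure Om x -> al <= u x <= be) -> memLp Om +oo%E u.
  move=> mu ub; apply: (@bounded_memLp_infty _ _ _ (`|al| + `|be|)).
  - exact: addr_ge0.
  - exact: borel_lmeasurable.
  - apply: aeW => x /subset_closure /ub /andP[h1 h2].
    rewrite ler_norml; have := ler_norm be; have := ler_norm (- al).
    rewrite normrN; have := normr_ge0 al; have := normr_ge0 be.
    by move=> *; apply/andP; split; lra.
rewrite /Uh; case: ifPn => _.
  have mi : measurable_fun [set: mpt] (interp0 : mpt -> R).
    by apply: measurable_glue => // T; exact: measurable_cst.
  have b0 : memLp Om +oo%E interp0.
    by apply: bd => // x /interp0_estimate[].
  exists interp0; split => //; last exact: interp0_estimate.
  split => // T Tm; exists (ut (xget 0 (hull T))).
  apply: filterS hull_eq_ae => x H Tx.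
  have [|T' T'm [T'x E]] := @glueP (fun T _ => ut (xget 0 (hull T))) mesh x.
    by exists T.
  by rewrite /interp0 E (H T T').
have mi : measurable_fun [set: mpt] (interp1 : mpt -> R).
  apply: measurable_glue => // T; apply: continuous_measurable_plane.
  by apply: affine_continuous; exact: nodal_affine.
exists interp1; split; last exact: interp1_estimate.
  split; first exact: interp1_continuous.
  move=> T Tm; have [c [d E]] := nodal_affine T; exists c, d => x Tx.
  by rewrite (interp1E Tm Tx) E.
by apply: bd => // x /interp1_estimate[].
Qed.

End interpolation.

(** * Bounds in the maximum norm *)

(** The positive part has a finite integral. If that of the negative part is
    infinite, the integral is 0 by convention, and the sign of c gives the bound. *)
Lemma Rintegral_le_cst d (T : measurableType d) (R : realType)
    (mu : {measure set T -> \bar R}) (D : set T) (F : T -> R) (c : R) :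
  measurable D -> (mu D < +oo)%E -> 0 <= c ->
  {ae mu, forall x, D x -> F x <= c} ->
  \int[mu]_(x in D) F x <= c * fine (mu D).
Proof.
move=> mD Dfin c0 Fc; rewrite /Rintegral integralE.
have -> : (fun x => ((fun x0 => (F x0)%:E)^\+ x)%E) = (fun x => (F^\+ x)%:E).
  by apply/funext => x; rewrite /= funeposE /funrpos EFin_max.
have I1 : (\int[mu]_(x in D) (F^\+ x)%:E <= c%:E * mu D)%E.
  apply: integral_le_indic => //; apply: filterS Fc => x Fc Dx.
  by rewrite indicE mem_set// mulr1 Fc.
have J1 : (0 <= \int[mu]_(x in D) (F^\+ x)%:E)%E.
  by apply: integral_ge0 => x _; rewrite lee_fin /funrpos le_max lexx orbT.
have J2 : (0 <= \int[mu]_(x in D) ((fun x0 => (F x0)%:E)^\- x)%E)%E by exact: integral_ge0.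
have Df : mu D \is a fin_num by rewrite ge0_fin_numE.
have K0 : 0 <= c * fine (mu D) by rewrite mulr_ge0// fine_ge0.
rewrite -(fineK Df) -EFinM in I1.
move: I1 J1 J2; set p := (\int[mu]_(x in D) (F^\+ x)%:E)%E.
set n := (\int[mu]_(x in D) ((fun x0 => (F x0)%:E)^\- x)%E)%E.
by move: p n => [p| |] [n| |]//=; rewrite !lee_fin => *; lra.
Qed.

Section discrete_sup_bound.
Context {R : realType}.
Local Notation pt := (R * R)%type.
Local Notation mpt := (measurableTypeR R * measurableTypeR R)%type.
Variable Om : set pt.
Hypothesis oOm : open Om.

(** Norms on the three-dimensional space of affine functions are equivalent; as
    an explicit argument, a small square in the triangle, on the side of its
    centre where the affine function grows in absolute value, has
    |y| >= m = |y x1| + r / 2 (|d.1| + |d.2|), and m bounds y on the triangle up to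
    a factor. The norm of y' and the distance of y to y' bound m. *)
Lemma affine_sup_le_L2 (T : @triangle R) : interior (hull T) !=set0 ->
  hull T `<=` closure Om -> exists2 K : R, 0 <= K &
  forall (y y' : pt -> R) (M c : R), affine_on (hull T) y -> 0 <= M -> 0 <= c ->
    (LpN Om 2%:E y' <= M%:E)%E ->
    {ae leb2, forall x, Om x -> `|y x - y' x| <= c} ->
    forall x, hull T x -> `|y x| <= K * (M + c).
Proof.
move=> [x0 ix0] Tcl.
have [x1 [r r0 rsub]] : exists x1 : pt, exists2 r : R, 0 < r &
    forall z : pt, `|z.1 - x1.1| <= r -> `|z.2 - x1.2| <= r -> Om z /\ hull T z.
  have ox0 : nbhs x0 (interior (hull T)).
    by apply: open_nbhs_nbhs; split => //; exact: open_interior.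
  have [x1 [Ox1 ix1]] := Tcl _ (interior_subset ix0) _ ox0.
  have /nbhs_ballP[e /= e0 He] : nbhs x1 (Om `&` hull T).
    by apply: filterI => //; exact: open_nbhs_nbhs.
  exists x1, (e / 2); first by rewrite divr_gt0.
  have e2 : e / 2 < e by rewrite ltr_pdivrMr// ltr_pMr// ltr1n.
  by move=> z z1 z2; apply: He; split; rewrite /ball/= distrC; exact: le_lt_trans e2.
have Tx1 : hull T x1 by apply: (rsub x1 _ _).2; rewrite subrr normr0 ltW.
pose B := tdiam T.
have B0 : 0 <= B.
  apply: le_trans (enorm_le_tdiam Tx1 Tx1); exact: sqrtr_ge0.
exists ((1 + 2 * B / r) * (1 + 2 / r)).
  by rewrite mulr_ge0 ?addr_ge0 ?divr_ge0 ?mulr_ge0// ltW.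
move=> y y' M c [c0 [d yE]] M0 cc0 y'M yy'.
pose a := y x1.
have yz z : hull T z -> y z = a + d.1 * (z.1 - x1.1) + d.2 * (z.2 - x1.2).
  by move=> Tz; rewrite /a !yE// /dot; ring.
pose m := `|a| + r / 2 * (`|d.1| + `|d.2|).
have m0 : 0 <= m by rewrite addr_ge0// mulr_ge0 ?addr_ge0// divr_ge0// ltW.
have mM : m <= c + 2 * M / r.
  have [mc|mc] := leP m c; first by rewrite (le_trans mc)// lerDl divr_ge0 ?mulr_ge0// ltW.
  (* The sign of y at the centre x1, and for each coordinate the direction in
     which the corresponding slope has this sign; the square of side r / 2 lies at
     distance r / 2 from x1 in these two directions. *)
  pose s : R := if 0 <= a then 1 else -1.
  pose t (e : R) : R := if 0 <= s * e then 1 else -1.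
  have ts e : s * e * t e = `|e|.
    rewrite /t /s; case: (leP 0 a) => _; case: ifPn => [h|/negP h].
    - by rewrite !mul1r in h *; rewrite mulr1 ger0_norm.
    - by rewrite mul1r in h *; rewrite mulrN1 ler0_norm//; apply/ltW; rewrite ltNge; exact/negP.
    - by rewrite !mulN1r in h *; rewrite mulr1 ler0_norm// -oppr_ge0.
    - rewrite !mulN1r in h *; rewrite mulrN1 opprK ger0_norm//.
      by rewrite -oppr_le0; apply/ltW; rewrite ltNge; exact/negP.
  have sa : s * a = `|a|.
    rewrite /s; case: (leP 0 a) => h; first by rewrite mul1r ger0_norm.
    by rewrite mulN1r ltr0_norm.
  pose lo (e : R) : R := if 0 <= s * e then r / 2 else - r.
  have lot e u : lo e <= u <= lo e + r / 2 -> r / 2 <= t e * u /\ `|u| <= r.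
    rewrite /lo /t ler_norml; case: ifPn => _ /andP[? ?]; rewrite ?mul1r ?mulN1r;
    by split; [lra|apply/andP; split; lra].
  pose Q := box (x1.1 + lo d.1) (x1.1 + lo d.1 + r / 2) (x1.2 + lo d.2) (x1.2 + lo d.2 + r / 2).
  have Qm z : Q z -> Om z /\ m <= `|y z|.
    move=> /box_mem /andP[/andP[z1 z2] /andP[z3 z4]].
    have [|a1 b1] := lot d.1 (z.1 - x1.1); first by apply/andP; split; lra.
    have [|a2 b2] := lot d.2 (z.2 - x1.2); first by apply/andP; split; lra.
    have [Oz Tz] := rsub z b1 b2; split => //.
    rewrite yz//.
    have s1 : `|s| = 1 by rewrite /s; case: ifP; rewrite ?normrN normr1.
    have tt e : t e * t e = 1 by rewrite /t; case: ifP => _; rewrite ?mulrNN mulr1.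
    rewrite -[leRHS]mul1r -s1 -normrM (le_trans _ (ler_norm _))//.
    have E (e u : R) : s * (e * u) = `|e| * (t e * u).
      rewrite -ts (_ : s * e * t e * (t e * u) = s * (e * u) * (t e * t e)); last by ring.
      by rewrite tt mulr1.
    rewrite 2!(mulrDr s) sa !E /m -addrA lerD2l (mulrDr (r / 2)).
    by apply: lerD; rewrite mulrC; exact: ler_wpM2l.
  have mQ : measurable (Q : set mpt) by exact: measurable_box.
  have Qe : leb2 Q = ((r / 2) ^+ 2)%:E.
    rewrite leb2_box ?lerDl ?divr_ge0 ?ltW//; congr EFin.
    have cancel (u w : R) : u + w - u = w by ring.
    by rewrite !cancel expr2.
  have H : ((((m - c) * (r / 2)) ^+ 2)%:E <= (M ^+ 2)%:E)%E.
    have /(LpN2_leP _ _ M0) := y'M; apply: le_trans.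
    apply: (@le_trans _ _ (\int[leb2]_(x in Om) (((m - c) ^+ 2)%:E * (\1_Q x)%:E))%E).
      rewrite ge0_integralZl//=; last 3 first.
      - exact: open_measurable_plane.
      - by apply/measurable_EFinP; apply: measurable_funTS; exact: measurable_indic.
      - by rewrite lee_fin sqr_ge0.
      rewrite integral_indic//; last exact: open_measurable_plane.
      rewrite (_ : Q `&` Om = Q); last by apply: setIidl => z /Qm[].
      by rewrite -/leb2 Qe -EFinM lee_fin exprMn.
    apply: ae_le_integral_ge0.
    - by move=> x _; rewrite -EFinM lee_fin mulr_ge0 ?sqr_ge0// indicE.
    - by move=> x _; rewrite lee_fin sqr_ge0.
    apply: filterS yy' => x yy' Ox; rewrite -EFinM lee_fin indicE.
    have [/set_mem/Qm[_ mx]|_] := boolP (x \in Q); last by rewrite mulr0 sqr_ge0.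
    rewrite mulr1 -[leRHS]real_normK ?num_real// lerXn2r ?nnegrE//.
      by rewrite subr_ge0 ltW.
    have := yy' Ox; have := ler_distD (y' x) (y x) 0; rewrite !subr0; lra.
  move: H; rewrite lee_fin ler_sqr ?nnegrE//; last first.
    by apply: mulr_ge0; [rewrite subr_ge0 ltW|rewrite divr_ge0// ltW].
  move=> H; rewrite -lerBlDl ler_pdivlMr//; lra.
move=> z Tz.
have [z1 z2] : `|z.1 - x1.1| <= B /\ `|z.2 - x1.2| <= B.
  have := enorm_le_tdiam Tz Tx1; have [h1 h2] := enorm_ge_coord (z - x1).
  by move=> h; split; apply: le_trans h.
have yzle : `|y z| <= `|a| + (`|d.1| + `|d.2|) * B.
  rewrite yz// -addrA (le_trans (ler_normD _ _))// lerD2l (le_trans (ler_normD _ _))//.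
  by rewrite mulrDl lerD// normrM ler_wpM2l.
have dm : `|d.1| + `|d.2| <= 2 * m / r.
  rewrite ler_pdivlMr// /m; have := normr_ge0 a; lra.
apply: (@le_trans _ _ ((1 + 2 * B / r) * m)).
  apply: le_trans yzle _; rewrite (mulrDl 1 (2 * B / r)) mul1r; apply: lerD.
    by rewrite /m lerDl mulr_ge0 ?addr_ge0// divr_ge0// ltW.
  rewrite (_ : 2 * B / r * m = 2 * m / r * B); last by ring.
  by rewrite ler_wpM2r.
rewrite -(mulrA (1 + 2 * B / r)); apply: ler_wpM2l.
  by rewrite addr_ge0// divr_ge0 ?mulr_ge0// ltW.
apply: le_trans mM _; rewrite (mulrDl 1 (2 / r)) mul1r.
have h2 : 0 <= 2 / r * c by rewrite mulr_ge0// divr_ge0// ltW.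
rewrite (_ : 2 / r * (M + c) = 2 * M / r + 2 / r * c); last by ring.
lra.
Qed.

(** The finitely many triangles of one mesh give one constant. *)
Lemma Vh_sup_le_L2 (mesh : seq (@triangle R)) : triangulates Om mesh ->
  exists2 K : R, 0 <= K &
  forall (y y' : pt -> R) (M c : R), Vh Om mesh y -> 0 <= M -> 0 <= c ->
    (LpN Om 2%:E y' <= M%:E)%E ->
    {ae leb2, forall x, Om x -> `|y x - y' x| <= c} ->
    forall x, closure Om x -> `|y x| <= K * (M + c).
Proof.
move=> [iT clE _].
have sub T : T \in mesh -> hull T `<=` closure Om.
  by move=> Tm z Tz; rewrite clE; exists T.
suff [K K0 HK] : exists2 K : R, 0 <= K & forall T : @triangle R, T \in mesh ->
    forall (y y' : pt -> R) (M c : R), affine_on (hull T) y -> 0 <= M -> 0 <= c ->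
    (LpN Om 2%:E y' <= M%:E)%E ->
    {ae leb2, forall x, Om x -> `|y x - y' x| <= c} ->
    forall x, hull T x -> `|y x| <= K * (M + c).
  exists K => // y y' M c [_ ya _] M0 c0 y'M yy' x; rewrite clE => -[T /= Tm Tx].
  exact: (HK T Tm y y' M c (ya T Tm) M0 c0 y'M yy').
elim: mesh iT {clE} sub => [|T s IH] iT sub; first by exists 0.
have [|T' T's|K K0 HK] := IH.
- by move=> T' T's; apply: iT; rewrite inE T's orbT.
- by apply: sub; rewrite inE T's orbT.
have [K1 K10 HK1] := affine_sup_le_L2 (iT T (mem_head _ _)) (sub T (mem_head _ _)).
exists (K + K1); first exact: addr_ge0.
move=> T'; rewrite inE => /orP[/eqP ->|T's] y y' M c ya M0 c0 y'M yy' x Tx.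
  apply: le_trans (HK1 _ _ _ _ ya M0 c0 y'M yy' _ Tx) _.
  by rewrite ler_wpM2r ?addr_ge0// lerDr.
apply: le_trans (HK _ T's _ _ _ _ ya M0 c0 y'M yy' _ Tx) _.
by rewrite ler_wpM2r ?addr_ge0// lerDl.
Qed.

End discrete_sup_bound.

Section coefficient.
Context {R : realType}.
Variable P : problem R.
Hypotheses (ha0 : C2 (coef_a0 P)) (ha1 : C2 (coef_a1 P)).

Lemma C2_derive_bounded (f : R -> R) (M : R) : C2 f ->
  exists2 A, 0 <= A & forall t, `|t| <= M -> `|derive1 f t| <= A.
Proof.
move=> [_ df _]; have [M0|M0] := ltP M 0.
  by exists 0 => // t tM; have := le_lt_trans tM M0; rewrite normr_lt0.
have cf : {within `[- M, M], continuous (fun t => `|derive1 f t|)}.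
  apply: continuous_subspaceT => t; apply: cvg_norm.
  by apply: differentiable_continuous; apply/derivable1_diffP; exact: df.
have [|c _ Hc] := EVT_max _ cf; first by lra.
exists `|derive1 f c| => // t; rewrite ler_norml => tM.
by apply: Hc; rewrite in_itv.
Qed.

(** Away from the kink the coefficient coincides locally with one of its two
    branches, and at the kink the function vanishes by definition. *)
Lemma da_bounded (M : R) : exists2 A, 0 <= A &
  forall t, `|t| <= M -> `|da P t| <= A.
Proof.
have [A0 A00 H0] := C2_derive_bounded M ha0.
have [A1 A10 H1] := C2_derive_bounded M ha1.
exists (A0 + A1); first exact: addr_ge0.
move=> t tM; rewrite /da; have [tt|tt|tt] := ltgtP t (tbar P); last first.
- by rewrite normr0 addr_ge0.
- rewrite (_ : derive1 (coef_a P) t = derive1 (coef_a1 P) t).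
    by apply: le_trans (H1 t tM) _; rewrite lerDr.
  rewrite !derive1E; apply: near_eq_derive => //.
  near=> s; rewrite /coef_a leNgt (_ : tbar P < s)//.
  by near: s; exact: lt_nbhsr.
- rewrite (_ : derive1 (coef_a P) t = derive1 (coef_a0 P) t).
    by apply: le_trans (H0 t tM) _; rewrite lerDl.
  rewrite !derive1E; apply: near_eq_derive => //.
  near=> s; rewrite /coef_a (_ : s <= tbar P)//.
  by near: s; exact: lt_le_nbhsl.
Unshelve. all: by end_near. Qed.

End coefficient.

(** * Linear decay of the consistency error *)

Section consistency.
Context {R : realType}.
Variable P : problem R.
Local Notation Om := (Omega P).
Local Notation S := (S P).
Hypothesis oOm : open Om.
Variable CS : R.
Hypothesis CS0 : 0 <= CS.
Hypothesis state_bound : forall u, Uad P u ->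
  W2p Om 2%:E (S u) /\ (W2N Om 2%:E (S u) <= CS%:E)%E.
Let mOm := measurable_domain oOm.

Lemma state_LpN2 u : Uad P u -> (LpN Om 2%:E (S u) <= CS%:E)%E.
Proof.
move=> Uu; have [_ W2] := state_bound Uu; apply: le_trans W2.
rewrite /W2N leeDl// sume_ge0// => i _.
by rewrite /W1N adde_ge0 ?Lnorm_ge0// sume_ge0// => k _; exact: Lnorm_ge0.
Qed.

Lemma partial_LpN2 u (i : 'I_2) : Uad P u ->
  lmeasurable Om (partial Om i (S u)) /\
  (LpN Om 2%:E (partial Om i (S u)) <= CS%:E)%E.
Proof.
move=> Uu; have [[_ /(_ i)[[mi _] _]] W2] := state_bound Uu; split => //.
have N0 f : (0 <= W1N Om 2%:E f)%E.
  by rewrite /W1N adde_ge0 ?Lnorm_ge0// sume_ge0// => k _; exact: Lnorm_ge0.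
apply: le_trans W2; apply: (@le_trans _ _ (W1N Om 2%:E (partial Om i (S u)))).
  by rewrite /W1N leeDl// sume_ge0// => k _; exact: Lnorm_ge0.
rewrite /W2N (bigD1 i)//= addeCA leeDl//.
by rewrite adde_ge0 ?Lnorm_ge0// sume_ge0.
Qed.

Let slope u x : R := `|partial Om 0 (S u) x| + `|partial Om 1 (S u) x|.

Let slope_LpN2 u : Uad P u ->
  lmeasurable Om (slope u) /\ (LpN Om 2%:E (slope u) <= (4 * CS)%:E)%E.
Proof.
move=> Uu; have [m0 b0] := partial_LpN2 0 Uu; have [m1 b1] := partial_LpN2 1 Uu.
split; first by apply: lmeasurableD; exact: lmeasurable_norm.
rewrite (_ : 4 * CS = 2 * (CS + CS)); last by ring.
apply: (LpN2_add mOm CS0 CS0 m0 m1 b0 b1); apply: aeW => x _.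
by rewrite ger0_norm// addr_ge0.
Qed.

Lemma Z_LpN2 u w (A : R) : Uad P u -> Uad P w -> 0 <= A ->
  {ae leb2, forall x, Om x -> `|da P (S u x)| <= A} ->
  {ae leb2, forall x, Om x -> `|da P (S w x)| <= A} ->
  (LpN Om 2%:E (enorm \o Z P (S u) (S w)) <= (A * (16 * CS))%:E)%E.
Proof.
move=> Uu Uw A0 uA wA.
have [mu bu] := slope_LpN2 Uu; have [mw bw] := slope_LpN2 Uw.
have C40 : 0 <= 4 * CS by rewrite mulr_ge0.
pose g x := slope u x + slope w x.
have g0 x : 0 <= g x by rewrite !addr_ge0.
have gK : (LpN Om 2%:E g <= (16 * CS)%:E)%E.
  rewrite (_ : 16 * CS = 2 * (4 * CS + 4 * CS)); last by ring.
  apply: (LpN2_add mOm C40 C40 mu mw bu bw); apply: aeW => x _.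
  by rewrite ger0_norm// /g lerD// ler_norm.
apply: (LpN2_scale mOm A0 _ _ gK); first by rewrite mulr_ge0.
  exact: lmeasurableD.
apply: filterS2 uA wA => x uA wA Ox.
rewrite (ger0_norm (g0 x)) [leLHS]ger0_norm; last exact: sqrtr_ge0.
have D (a c p q : R) : `|a| <= A -> `|c| <= A ->
    `|a * p - c * q| <= A * (`|p| + `|q|).
  move=> aA cA; apply: le_trans (ler_normB _ _) _.
  by rewrite !normrM (mulrDr A); apply: lerD; exact: ler_wpM2r.
have H (i : 'I_2) := D _ _ (partial Om i (S u) x) (partial Om i (S w) x) (uA Ox) (wA Ox).
have E := @enorm_le R (Z P (S u) (S w) x) _ _ (H 0) (H 1).
have rearrange (p q r s : R) : A * (p + q) + A * (r + s) = A * (p + r + (q + s)).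
  by ring.
by apply: le_trans E _; rewrite rearrange.
Qed.

Lemma V_LpN2 u (r : \bar R) : Uad P u ->
  (LpN Om 2%:E (V P (S u) r) <= (sigma0 P * (4 * CS))%:E)%E.
Proof.
move=> Uu; have [mu bu] := slope_LpN2 Uu.
have s0 : 0 <= sigma0 P by exact: normr_ge0.
apply: (LpN2_scale mOm s0 _ mu bu); first by rewrite mulr_ge0.
apply: aeW => x _; rewrite /V normrM (ger0_norm s0).
rewrite ler_wpM2l//.
have sum2 (F : 'I_2 -> R) : \sum_(m < 2) F m = F 0 + F 1.
  rewrite !big_ord_recl big_ord0 addr0; congr (_ + F _); exact/val_inj.
have T (c : bool) (p : R) : `|if c then `|p| else 0| <= `|p|.
  by case: c; rewrite ?normr_id// normr0.
rewrite sum2 [leRHS]ger0_norm; last exact: addr_ge0.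
apply: le_trans (ler_normD _ _) _; apply: lerD; exact: T.
Qed.

(** Z is bounded by the gradients of both states, V by that of one, and the
    factor h in front of them gives the order. *)
Lemma eps_h_linear ptilde kappa mesh gamma (h A : R) ubar u :
  0 < h <= 1 -> 0 <= gamma -> 0 <= A -> Uad P u -> Uad P ubar ->
  {ae leb2, forall x, Om x -> `|da P (S u x)| <= A} ->
  {ae leb2, forall x, Om x -> `|da P (S ubar x)| <= A} ->
  (eps_h P (S ubar) ptilde kappa mesh gamma h u <=
   ((1 + A * (16 * CS) + sigma0 P * (4 * CS)) * h)%:E)%E.
Proof.
move=> /andP[h0 h1] g0 A0 Uu Uubar uA ubarA.
have hh : (0 <= h%:E)%E by rewrite lee_fin ltW.
rewrite /eps_h 2!mulrDl mul1r !EFinD; apply: leeD; first apply: leeD.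
- by rewrite lee_fin; apply: ge1r_powR; rewrite ?h0// lerDl.
- by rewrite [in leRHS]mulrC EFinM; apply: lee_wpmul2l => //; exact: Z_LpN2.
- by rewrite [in leRHS]mulrC EFinM; apply: lee_wpmul2l => //; exact: V_LpN2.
Qed.

End consistency.

Section sup_bound.
Context {R : realType}.
Variable P : problem R.
Local Notation Om := (Omega P).
Local Notation S := (S P).

(** The mesh is fixed here: the constant of [Vh_sup_le_L2] may degenerate with
    the mesh size. The state is compared with the discrete state, and the
    discrete state, being close to a function bounded in L^2, is bounded. *)
Lemma state_sup_bound (ybar ubar : R * R -> R) (mesh : seq (@triangle R))
    (ptilde kappa rho h C CS : R) :
  open Om -> triangulates Om mesh -> 0 < h -> 0 <= CS ->
  (forall u, L2ball P ubar rho u -> exists! y, W1p0_ball P ybar ptilde kappa y /\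
     is_discrete_state P mesh u y) ->
  (forall u, L2ball P ubar rho u ->
     let d := S u \- Sh P ybar ptilde kappa mesh u in
     (LpN Om 2%:E d + h%:E * W1N Om 2%:E d + h%:E * LpN Om +oo%E d <=
      (C * h ^+ 2)%R%:E)%E) ->
  (forall u, Uad P u -> (LpN Om 2%:E (S u) <= CS%:E)%E) ->
  exists2 M, 0 <= M & forall u, Uad P u -> L2ball P ubar rho u ->
    {ae leb2, forall x, Om x -> `|S u x| <= M}.
Proof.
move=> oOm tri h0 CS0 ex err SL2.
have [K K0 HK] := Vh_sup_le_L2 oOm tri.
pose c := `|C| * h; have c0 : 0 <= c by rewrite mulr_ge0// ltW.
exists (K * (CS + c) + c); first by rewrite addr_ge0// mulr_ge0// addr_ge0.
move=> u Uu uB; have [y [yP _]] := ex u uB.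
have [_ [shV _]] : W1p0_ball P ybar ptilde kappa (Sh P ybar ptilde kappa mesh u) /\
    is_discrete_state P mesh u (Sh P ybar ptilde kappa mesh u).
  rewrite /Sh; case: xgetP => [y' -> //|/(_ y) []]; exact: yP.
have E : {ae leb2, forall x, Om x ->
    `|S u x - Sh P ybar ptilde kappa mesh u x| <= c}.
  apply: (@LpN_infty_ae _ Om (S u \- Sh P ybar ptilde kappa mesh u)).
  have hh : (0 <= h%:E)%E by rewrite lee_fin ltW.
  have /= := err u uB; set d := (S u \- _).
  have W0 : (0 <= W1N Om 2%:E d)%E.
    by rewrite /W1N adde_ge0 ?Lnorm_ge0// sume_ge0// => k _; exact: Lnorm_ge0.
  move=> H; have {}H : (h%:E * LpN Om +oo%E d <= h%:E * c%:E)%E.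
    rewrite -EFinM; apply: (@le_trans _ _ (C * h ^+ 2)%:E).
      by apply: le_trans H; rewrite leeDr// adde_ge0 ?Lnorm_ge0// mule_ge0.
    rewrite lee_fin /c (_ : h * (`|C| * h) = `|C| * h ^+ 2); last by ring.
    by rewrite ler_wpM2r ?sqr_ge0// ler_norm.
  by move: H; rewrite lee_pmul2l.
have E' : {ae leb2, forall x, Om x ->
    `|Sh P ybar ptilde kappa mesh u x - S u x| <= c}.
  by apply: filterS E => x /[apply]; rewrite distrC.
have B := HK _ _ CS c shV CS0 c0 (SL2 u Uu) E'.
apply: filterS E => x /[dup] Ex /[swap] Ox /(_ Ox) {}Ex.
have := B x (subset_closure Ox).
have := ler_normD (S u x - Sh P ybar ptilde kappa mesh u x)
  (Sh P ybar ptilde kappa mesh u x).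
rewrite subrK => h1 h2; apply: le_trans h1 _; rewrite addrC; exact: lerD.
Qed.

End sup_bound.

(** * A discrete admissible control close to the optimal one *)

Section test_control.
Context {R : realType}.
Variable P : problem R.
Local Notation Om := (Omega P).
Hypotheses (oOm : open Om) (convOm : convex_set Om) (bOm : bounded_set Om).
Hypothesis nu0 : 0 < nu P.
Hypothesis ab : alpha P < beta P.
Let mOm := measurable_domain oOm.
Let fOm := leb2_domain_fin oOm bOm.

Lemma memLp_infty_2 (f : R * R -> R) : memLp Om +oo%E f -> memLp Om 2%:E f.
Proof.
move=> fi; have [M M0 fM] := memLp_infty_bounded fi.
split; first exact: fi.1.
exact: le_lt_trans (LpN2_bounded mOm M0 fOm fM) (ltry _).
Qed.

(** The interpolant of the Lipschitz representative of the optimal control. The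
    differences with respect to this representative are estimated at every point,
    and the integrals only see the values almost everywhere. *)
Lemma discrete_test_control (p : R) (ubar phibar : R * R -> R) :
  1 < p -> W1p0 Om p%:E phibar -> W1p Om +oo%E phibar -> Uad P ubar ->
  (forall u, Uad P u -> 0 <= dj P ubar phibar (u \- ubar)) ->
  exists W D : R, [/\ 0 <= W, 0 <= D &
    forall (mesh : seq (@triangle R)) (h : R) (i : 'I_2), 0 <= h ->
    triangulates Om mesh -> (forall T, T \in mesh -> tdiam T <= h) ->
    exists uh, [/\ Uadh P mesh i uh,
      (LpN Om 2%:E (uh \- ubar) <= (W * h)%:E)%E,
      (LpN Om 2%:E (ubar \- uh) <= (W * h)%:E)%E &
      dj P ubar phibar (uh \- ubar) <= D * h ^+ 2]].
Proof.
move=> p1 phi0 phi1 Uubar vi.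
pose vol := fine (leb2 Om); have vol0 : 0 <= vol by exact: fine_ge0.
have [L L0 [phi phiE philip]] := W1infty_lipschitz oOm convOm bOm p1 phi0 phi1.
have [Mphi Mphi0 phiM] := memLp_infty_bounded phi1.1.
have proj := projection_formula oOm bOm nu0 ab Mphi0 Uubar phi1.1.1 phiM vi.
pose ut x := clamp (alpha P) (beta P) (- phi x / nu P).
pose gt x := phi x + nu P * ut x.
have utE : aeq Om ubar ut.
  by apply: filterS2 proj phiE => x e1 e2 Ox; rewrite /ut e1// e2.
have ut_lip x y : `|ut x - ut y| <= L / nu P * dist1 x y.
  apply: le_trans (clamp_lip ab _ _) _.
  rewrite -mulrBl normrM normfV (gtr0_norm nu0) -opprD normrN mulrAC.
  by rewrite ler_pM2r ?invr_gt0// philip.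
have gt_lip x y : `|gt x - gt y| <= 2 * L * dist1 x y.
  rewrite /gt opprD addrACA -mulrBr (le_trans (ler_normD _ _))//.
  have -> : 2 * L * dist1 x y = L * dist1 x y + nu P * (L / nu P * dist1 x y).
    by field; rewrite gt_eqF.
  by rewrite lerD// normrM (gtr0_norm nu0) ler_pM2l.
have gtE x : gt x = nu P * (ut x - - phi x / nu P).
  by rewrite /gt; field; rewrite gt_eqF.
have gt_pos x : 0 < gt x -> ut x = alpha P.
  by rewrite gtE pmulr_rgt0// subr_gt0; exact: clamp_gt.
have gt_neg x : gt x < 0 -> ut x = beta P.
  by rewrite gtE pmulr_rlt0// subr_lt0; exact: clamp_lt.
have ut_itv x : alpha P <= ut x <= beta P by exact: clamp_itv.
have Lnu0 : 0 <= L / nu P by rewrite divr_ge0// ltW.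
have L20 : 0 <= 2 * L by rewrite mulr_ge0.
have LL0 : 0 <= 2 * L * (L / nu P) by exact: mulr_ge0.
exists (L / nu P * 2 * Num.sqrt vol), (2 * L * (L / nu P) * 4 * vol); split.
- by apply: mulr_ge0; [exact: mulr_ge0|exact: sqrtr_ge0].
- by do 2 apply: mulr_ge0 => //.
move=> mesh h i h0 tri msize.
have [uh [uhU uhoo uhE]] := interpolant tri msize Lnu0 L20 ut_lip gt_lip ut_itv
  gt_pos gt_neg i.
have c0 : 0 <= L / nu P * 2 * h by apply: mulr_ge0 => //; exact: mulr_ge0.
have dE : {ae leb2, forall x, Om x -> `|ubar x - uh x| <= L / nu P * 2 * h}.
  apply: filterS utE => x e Ox; rewrite e// distrC -(mulrA (L / nu P)).
  by have [] := uhE x (subset_closure Ox).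
exists uh; split.
- by split => //; split => //; apply: aeW => x /subset_closure /uhE[].
- rewrite mulrAC; apply: LpN2_bounded => //.
  by apply: filterS dE => x /[apply] /=; rewrite distrC.
- by rewrite mulrAC; exact: LpN2_bounded.
rewrite /dj (_ : \int[leb2]_(x in Om) _ =
  \int[leb2]_(x in Om) (gt x * (uh x - ut x))); last first.
  by apply: ae_eq_Rintegral; apply: filterS2 phiE utE => x e1 e2 Ox /=; rewrite e1// e2.
rewrite (_ : _ * h ^+ 2 = 2 * L * (L / nu P) * (2 * h) ^+ 2 * vol); last by ring.
apply: Rintegral_le_cst => //; first by apply: mulr_ge0 => //; exact: sqr_ge0.
by apply: aeW => x /subset_closure /uhE[].
Qed.

End test_control.

(** * The error estimate *)

Theorem theorem5p13 (R : realType) (P : problem R) (pbar pstar : R)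
  (hOmega : convex_polygonal_domain (Omega P))
  (hb : [lipschitz coef_b P x | x in closure (Omega P)])
  (hb0 : exists2 blow : R, 0 < blow &
     forall x, closure (Omega P) x -> blow <= coef_b P x)
  (ha0 : C2 (coef_a0 P)) (ha1 : C2 (coef_a1 P))
  (ha01 : coef_a0 P (tbar P) = coef_a1 P (tbar P))
  (ha : forall t, 0 <= coef_a P t)
  (hpbar : 2 < pbar) (hL : admissible_L P pbar)
  (hab : alpha P < beta P) (hnu : 0 < nu P)
  (hpstar : 2 < pstar)
  (hS : forall p : R, 2 <= p < pstar -> forall M : R, exists C : R,
     forall u, memLp (Omega P) p%:E u -> (LpN (Omega P) p%:E u <= M%:E)%E ->
       W2p (Omega P) p%:E (S P u) /\
       (W2N (Omega P) p%:E (S P u) <= C%:E)%E)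
  (* The mesh sizes range over a set H accumulating at 0: no triangulation has
     a mesh size larger than the diameter of the domain. *)
  (H : set R) (mesh : R -> seq (@triangle R)) (rhobar deltabar : R)
  (hH : forall h, H h -> 0 < h)
  (hH0 : forall e, 0 < e -> exists2 h, H h & h < e)
  (hrhobar : 0 < rhobar) (hdeltabar : 0 < deltabar)
  (hmesh : forall h, H h -> [/\ triangulates (Omega P) (mesh h),
     mesh_size (mesh h) h & forall T, T \in mesh h ->
       tdiam T / tball T <= deltabar /\ h / tdiam T <= rhobar])
  (i : 'I_2)
  (ubar : R * R -> R) (hubar : Uad P ubar)
  (ptilde h1 rho kappa h2 : R)
  (hptilde : 4 <= ptilde) (hh1 : 0 < h1) (hrho : 0 < rho) (hkappa : 0 < kappa)
  (hSh : forall h, H h -> h < h1 -> forall u, L2ball P ubar rho u ->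
     exists! y, W1p0_ball P (S P ubar) ptilde kappa y /\
                is_discrete_state P (mesh h) u y)
  (hSSh : exists C : R, forall h, H h -> h < h1 ->
     forall u, L2ball P ubar rho u ->
       let d := S P u \- Sh P (S P ubar) ptilde kappa (mesh h) u in
       (LpN (Omega P) 2%:E d + h%:E * W1N (Omega P) 2%:E d
        + h%:E * LpN (Omega P) +oo%E d <= (C * h ^+ 2)%R%:E)%E)
  (hh2 : 0 < h2 < h1)
  (hlin : forall h, H h -> h < h2 ->
     forall y, W1p0_ball P (S P ubar) ptilde kappa y ->
       Vh (Omega P) (mesh h) y -> discrete_linearized_iso P (mesh h) y)
  (gamma p0 p1 : R)
  (hp0 : 2 < p0) (hp1 : 2 < p1 < pstar)
  (hgamma : 1 - 2 / p0 <= gamma)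
  (hgamma' : gamma < Num.min (1 / p0) (1 - 2 / p1))
  (hmin : Num.min (1 / p0) (1 - 2 / p1) < 1 / 2)
  (epsbar : R) (hepsbar : 0 < epsbar < rho)
  (hstrict : forall u, Uad P u -> L2ball P ubar epsbar u ->
     ~ aeq (Omega P) u ubar -> j P ubar < j P u)
  (hfin : finite_set (components P (S P ubar)))
  (hcomp : forall C, components P (S P ubar) C ->
     regular_component P (S P ubar) C \/ singular_component P (S P ubar) C)
  (phibar : R * R -> R)
  (hphi0 : W1p0 (Omega P) pbar%:E phibar)
  (hphi1 : W1p (Omega P) +oo%E phibar)
  (hadj : is_adjoint_state P (S P ubar) phibar)
  (hvi : forall u, Uad P u -> 0 <= dj P ubar phibar (u \- ubar))
  (hssc : forall v, critical_cone P ubar phibar v ->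
     ~ aeq (Omega P) v (fun=> 0) -> 0 < Q P ubar (S P ubar) phibar v)
  (hhat : R) (hhhat : 0 < hhat < h2)
  (ybarh ubarh : R -> R * R -> R)
  (hsol : forall h, H h -> h < hhat ->
     discrete_solution P (S P ubar) ptilde kappa (mesh h) i ubar epsbar
       (ybarh h) (ubarh h))
  (hycvg : W1N (Omega P) 2%:E (ybarh h \- S P ubar)
     @[h --> within H 0^'+] --> 0%E)
  (hucvg : LpN (Omega P) 2%:E (ubarh h \- ubar)
     @[h --> within H 0^'+] --> 0%E)
  (hest : exists C epshat : R, [/\ 0 < C, 0 < epshat <= epsbar &
     forall h, H h -> h < hhat -> forall uh, Uadh P (mesh h) i uh ->
       L2ball P ubar epshat uh ->
       ((LpN (Omega P) 2%:E (ubarh h \- ubar)) ^+ 2 <=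
        C%:E *
        ((eps_h P (S P ubar) ptilde kappa (mesh h) gamma h (ubarh h)) ^+ 2
         + (LpN (Omega P) 2%:E (ubar \- uh)) ^+ 2
         + (dj P ubar phibar (uh \- ubar))%:E))%E]) :
  exists C hstar : R, [/\ 0 < C, 0 < hstar < hhat &
    forall h, H h -> h < hstar ->
      (LpN (Omega P) 2%:E (ubarh h \- ubar) <= (C * h)%:E)%E].
Proof.
have [oOm _ bOm convOm _] := hOmega.
have mOm := measurable_domain oOm; have fOm := leb2_domain_fin oOm bOm.
have [hhat0 _] : 0 < hhat /\ hhat < h2 by exact/andP.
have [_ epsrho] : 0 < epsbar /\ epsbar < rho by exact/andP.
have [CS CS0 HCS] : exists2 CS : R, 0 <= CS & forall u, Uad P u ->
    W2p (Omega P) 2%:E (S P u) /\ (W2N (Omega P) 2%:E (S P u) <= CS%:E)%E.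
  have [|CS HCS] := hS 2 _
      ((`|alpha P| + `|beta P|) * Num.sqrt (fine (leb2 (Omega P)))).
    by rewrite lexx.
  exists `|CS|; first exact: normr_ge0.
  move=> u Uu; have [|w2 w2N] := HCS u (memLp_infty_2 oOm bOm Uu.1).
    by apply: LpN2_bounded => //; exact: Uad_bound.
  by split => //; apply: le_trans w2N _; rewrite lee_fin ler_norm.
have ubarB : L2ball P ubar rho ubar.
  split; first exact: memLp_infty_2 hubar.1.
  apply: le_trans (LpN2_bounded mOm (lexx 0) fOm _) _.
    by apply: aeW => x _ /=; rewrite subrr normr0.
  by rewrite mul0r lee_fin ltW.
have ubarhU h : H h -> h < hhat -> Uad P (ubarh h) /\ L2ball P ubar rho (ubarh h).
  move=> Hh hh; have [[Uu _] [mu Nu] _ _] := hsol _ Hh hh; split => //; split => //.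
  by apply: le_trans Nu _; rewrite lee_fin ltW.
have [M M0 HM] : exists2 M, 0 <= M & forall u, Uad P u -> L2ball P ubar rho u ->
    {ae leb2, forall x, Omega P x -> `|S P u x| <= M}.
  (* Any mesh for which the discrete states exist will do. *)
  have [h0 Hh0 h01] := hH0 _ hh1; have [C HC] := hSSh.
  have [tri _ _] := hmesh _ Hh0.
  apply: (state_sup_bound oOm tri (hH _ Hh0) CS0) => //.
  - exact: hSh Hh0 h01.
  - exact: HC Hh0 h01.
  - by move=> u Uu; exact: (state_LpN2 HCS).
have [A A0 HA] := da_bounded ha0 ha1 M.
have g0 : 0 <= gamma.
  by apply: le_trans hgamma; rewrite subr_ge0 ler_pdivrMr ?mul1r ?ltW// (lt_trans _ hp0).
pose E := 1 + A * (16 * CS) + sigma0 P * (4 * CS).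
have E0 : 0 <= E by rewrite /E !addr_ge0// mulr_ge0// ?mulr_ge0//; exact: normr_ge0.
have Heps h : H h -> h < hhat -> h <= 1 ->
    (eps_h P (S P ubar) ptilde kappa (mesh h) gamma h (ubarh h) <= (E * h)%:E)%E.
  move=> Hh hh hle1; have [Uu Bu] := ubarhU _ Hh hh.
  apply: (eps_h_linear oOm CS0 HCS) => //.
  - by rewrite hH.
  - by apply: filterS (HM _ Uu Bu) => x /[apply]; exact: HA.
  - by apply: filterS (HM _ hubar ubarB) => x /[apply]; exact: HA.
have pbar1 : 1 < pbar by apply: lt_trans hpbar; rewrite ltr1n.
have [W [D [W0 D0 Htest]]] :=
  discrete_test_control oOm convOm bOm hnu hab pbar1 hphi0 hphi1 hubar hvi.
have [C [epshat [C0 /andP[epshat0 epshat1] Hest]]] := hest.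
pose K := C * (E ^+ 2 + W ^+ 2 + D).
have K0 : 0 <= K by rewrite /K mulr_ge0 ?addr_ge0 ?sqr_ge0// ltW.
have W10 : 0 < W + 1 by rewrite ltr_wpDl.
(* The last condition puts the test control into the ball of radius epshat. *)
have [m [m0 m1 m2 m3]] : exists m : R,
    [/\ 0 < m, m < hhat, m <= 1 & m * (W + 1) <= epshat].
  exists (Num.min (Num.min (hhat / 2) 1) (epshat / (W + 1))); split.
  - by rewrite !lt_min ltr01 !divr_gt0.
  - by rewrite !gt_min ltr_pdivrMr// ltr_pMr// ltr1n.
  - by rewrite !ge_min lexx orbT.
  - by rewrite -ler_pdivlMr// ge_min lexx orbT.
exists (Num.sqrt K + 1), m; split.
- by rewrite ltr_wpDl ?sqrtr_ge0.
- by rewrite m0.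
move=> h Hh hm; have h0 := hH _ Hh; have hge0 := ltW h0.
have hh : h < hhat by exact: lt_trans m1.
have hle1 : h <= 1 by exact: le_trans (ltW hm) m2.
have hW : W * h <= epshat.
  apply: le_trans m3; rewrite mulrC; apply: ler_pM => //; first exact: ltW.
  by rewrite lerDl.
have [tri [msize _] _] := hmesh _ Hh.
have [uh [Uuh uhN uhN' uhD]] := Htest _ _ i hge0 tri msize.
have uhB : L2ball P ubar epshat uh.
  split; first exact: memLp_infty_2 Uuh.1.1.
  by apply: le_trans uhN _; rewrite lee_fin.
have := Hest h Hh hh uh Uuh uhB.
set X := LpN _ _ (ubarh h \- ubar) => HX.
have X0 : (0 <= X)%E by exact: Lnorm_ge0.
have {}HX : (X ^+ 2 <= (K * h ^+ 2)%:E)%E.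
  apply: le_trans HX _.
  have -> : (K * h ^+ 2)%:E =
      (C%:E * ((E * h)%:E ^+ 2 + (W * h)%:E ^+ 2 + (D * h ^+ 2)%:E))%E.
    by rewrite -!EFin_expe -!EFinD -EFinM /K; congr EFin; ring.
  apply: lee_wpmul2l; first by rewrite lee_fin ltW.
  apply: leeD; last by rewrite lee_fin.
  apply: leeD; rewrite lee_sqr ?lee_fin ?mulr_ge0 ?Lnorm_ge0//; first exact: Heps.
  by rewrite /eps_h !adde_ge0// ?mule_ge0 ?Lnorm_ge0 ?lee_fin// powR_ge0.
have {}HX : (X <= (Num.sqrt K * h)%:E)%E.
  rewrite -lee_sqr//; last by rewrite lee_fin mulr_ge0 ?sqrtr_ge0.
  by rewrite -EFin_expe exprMn sqr_sqrtr.
by apply: le_trans HX _; rewrite lee_fin ler_wpM2r ?lerDl.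
Qed.
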